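(* Let $\Gamma$ be a finite graph, $U$ a locally compact group, $\mathcal{O}\le U$ an open subgroup and $\varphi\colon\mathcal{O}\hookrightarrow U$ a continuous open monomorphism such that $\varphi(\mathcal{O})=\mathcal{O}$ and $|U:\mathcal{O}|<\infty$. Let $\mathcal{F}$ be any family of $\mathcal{A}_\Gamma(\varphi)$ containing $U$ and consisting of closed subgroups $H\le\mathcal{A}_\Gamma(\varphi)$ such that $|H:H\cap gUg^{-1}|<\infty$ for some $g\in\mathcal{A}_\Gamma(\varphi)$. Then $\widetilde{S}_\Gamma(\varphi)$ is a model for the classifying $\mathcal{A}_\Gamma(\varphi)$-CW-complex $\mathrm{E}_{\mathcal{F}}\mathcal{A}_\Gamma(\varphi)$ of $\mathcal{A}_\Gamma(\varphi)$ with respect to $\mathcal{F}$.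
   Context: All topological groups are Hausdorff; graphs are simplicial with non-empty vertex set. A continuous open monomorphism is an injective group homomorphism that is continuous and open. Topological RAAG: for $\Gamma=(S,E)$ finite, put $\mathcal{H}_S(\varphi)=(U*F(S))/\langle\langle t\omega t^{-1}\varphi(\omega)^{-1}\mid t\in S,\omega\in\mathcal{O}\rangle\rangle$, with the unique group topology making the canonical embedding $U\hookrightarrow\mathcal{H}_S(\varphi)$ continuous and open; $\mathcal{A}_\Gamma(\varphi)=\mathcal{H}_S(\varphi)/\langle\langle sts^{-1}t^{-1}\mid\{s,t\}\in E\rangle\rangle$ with the quotient topology. It contains $U$ as an open subgroup. Generalised universal Salvetti complex $\widetilde{S}_\Gamma(\varphi)$: vertices are the cosets $gU$, $g\in\mathcal{A}_\Gamma(\varphi)$. For each $g$ and each $T=\{t_1,\dots,t_k\}\subseteq S$ that is empty or spans a clique of $\Gamma$, there is a $k$-dimensional Euclidean unit cube $gQ_T$ with vertex set $\{gt_1^{\varepsilon_1}\cdots t_k^{\varepsilon_k}U\mid\varepsilon_i\in\{0,1\}\}$, the vertex indexed by $\varepsilon$ corresponding to $\varepsilon\in[0,1]^k$; faces are the corresponding lower-dimensional cubes of this kind, and a cell is determined by its vertex set. $\mathcal{A}_\Gamma(\varphi)$ acts by left multiplication. A family of a locally compact group $G$ is a non-empty collection of closed subgroups of $G$ closed under conjugation and finite intersections. A model for $\mathrm{E}_{\mathcal{F}}G$ is a $G$-CW-complex whose pointwise cell stabilisers all lie in $\mathcal{F}$ and such that, for every $H\in\mathcal{F}$, the set of $H$-fixed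 points is weakly contractible (in particular non-empty). *)

(* Defs.v *)
From HB Require Import structures.
From mathcomp Require Import all_boot all_order all_algebra.
From mathcomp Require Import generic_quotient.
From Stdlib Require Import Relation_Operators.
From mathcomp Require Import all_classical all_reals all_analysis.
Import numFieldNormedType.Exports.

Set Implicit Arguments.
Unset Strict Implicit.
Unset Printing Implicit Defensive.

Local Open Scope classical_set_scope.
Local Open Scope quotient_scope.
Local Open Scope group_scope.

HB.structure Definition PreTopologicalGroup := {G of Group G & Topological G}.

HB.mixin Record isTopologicalGroup G & PreTopologicalGroup G := {
  mulg_continuous : continuous (fun p : G * G => p.1 * p.2) ;
  invg_continuous : continuous (fun x : G => x^-1) }.

(* Separation is not part of the structure. *)
#[short(type="topologicalGroupType")]
HB.structure Definition TopologicalGroup :=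
  {G of isTopologicalGroup G & PreTopologicalGroup G}.

Section Subgroups.
Variable G : groupType.

Record subgroup := Subgroup {
  sg_set :> set G ;
  sg1 : sg_set 1 ;
  sgM : forall x y, sg_set x -> sg_set y -> sg_set (x * y) ;
  sgV : forall x, sg_set x -> sg_set x^-1 }.

Definition lcoset (g : G) (K : set G) : set G := [set g * k | k in K].

Definition conjs (g : G) (K : set G) : set G := [set g * k * g^-1 | k in K].

(* [|H : K| < oo], for subgroups [K] of [H] *)
Definition finite_index (H K : set G) : Prop :=
  finite_set [set lcoset h K | h in H].

Section Cosets.
Variable H : subgroup.

Definition coset_rel : rel G := fun x y => `[< sg_set H (x^-1 * y) >].

Lemma coset_rel_equiv : equiv_class_of coset_rel.
Proof.
split=> [x|x y|y x z].
- by apply/asboolP; rewrite mulVg; exact: sg1.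
- by apply/asboolP/asboolP => /sgV; rewrite invgM invgK.
- move=> /asboolP xy /asboolP yz; apply/asboolP.
  by have := sgM xy yz; rewrite mulgA -(mulgA x^-1) mulgV mulg1.
Qed.

Canonical coset_equiv := EquivRelPack coset_rel_equiv.

Definition coset_quot := {eq_quot coset_rel}.
HB.instance Definition _ := EqQuotient.on coset_quot.
HB.instance Definition _ := Choice.on coset_quot.

Lemma coset_quotP (x y : G) :
  \pi_coset_quot x = \pi_coset_quot y <-> sg_set H (x^-1 * y).
Proof.
split; first by move=> /eqquotP /asboolP.
by move=> xy; apply/eqquotP/asboolP.
Qed.

End Cosets.

Definition is_normal (N : set G) := forall g x, N x -> N (g * x * g^-1).

Section NormalClosure.
Variable Rel : set G.

Definition normal_closure_set : set G :=
  [set x | forall N : subgroup, is_normal N -> Rel `<=` N -> sg_set N x].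

Definition normal_closure : subgroup.
Proof.
exists normal_closure_set.
- by move=> N _ _; exact: sg1.
- by move=> x y Nx Ny N nN RN; apply: sgM; [exact: Nx|exact: Ny].
- by move=> x Nx N nN RN; apply: sgV; exact: Nx.
Defined.

Lemma normal_closure_normal : is_normal normal_closure.
Proof. by move=> g x Nx N nN RN; exact/nN/(Nx N nN RN). Qed.

Lemma normal_closure_sub : Rel `<=` normal_closure.
Proof. by move=> x Rx N _; apply. Qed.

End NormalClosure.
End Subgroups.

Section QuotientGroup.
Variables (G : groupType) (Rel : set G).

(* [G / <<Rel>>] *)
Definition quotient_group := coset_quot (normal_closure Rel).

HB.instance Definition _ := EqQuotient.on quotient_group.
HB.instance Definition _ := Choice.on quotient_group.

Let N := sg_set (normal_closure Rel).
Local Notation Q := quotient_group.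

Definition qg_mul (a b : Q) : Q := \pi_Q (repr a * repr b).
Definition qg_one : Q := \pi_Q 1.
Definition qg_inv (a : Q) : Q := \pi_Q (repr a)^-1.

Lemma qg_piE (x y : G) : N (x^-1 * y) -> \pi_Q x = \pi_Q y.
Proof. by move=> ?; apply/coset_quotP. Qed.

Lemma qg_reprE (x : G) : N (x^-1 * repr (\pi_Q x)).
Proof. by apply/(coset_quotP (normal_closure Rel)); rewrite reprK. Qed.

Lemma qg_conj (g x : G) : N x -> N (g^-1 * x * g).
Proof.
by move=> Nx; have := @normal_closure_normal _ Rel g^-1 x Nx; rewrite invgK.
Qed.

Lemma qg_piM (x y : G) : qg_mul (\pi_Q x) (\pi_Q y) = \pi_Q (x * y).
Proof.
apply/esym/qg_piE; rewrite invgM.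
have -> : forall a b, y^-1 * x^-1 * (a * b) =
    (y^-1 * (x^-1 * a) * y) * (y^-1 * b).
  by move=> a b; rewrite !mulgA -(mulgA _ y) mulgV mulg1.
by apply: sgM; [apply: qg_conj|]; exact: qg_reprE.
Qed.

Lemma qg_piV (x : G) : qg_inv (\pi_Q x) = \pi_Q x^-1.
Proof.
apply: qg_piE; rewrite invgK.
have := @normal_closure_normal _ Rel x _ (qg_reprE x).
by rewrite mulgA mulgV mul1g.
Qed.

Lemma qg_mulA : associative qg_mul.
Proof.
elim/quotW=> x; elim/quotW=> y; elim/quotW=> z.
by rewrite (qg_piM y z) (qg_piM x y) (qg_piM x (y * z)) (qg_piM (x * y)) mulgA.
Qed.
Lemma qg_mul1 : left_id qg_one qg_mul.
Proof. by elim/quotW=> x; rewrite qg_piM mul1g. Qed.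
Lemma qg_mulr1 : right_id qg_one qg_mul.
Proof. by elim/quotW=> x; rewrite qg_piM mulg1. Qed.
Lemma qg_mulV : left_inverse qg_one qg_inv qg_mul.
Proof. by elim/quotW=> x; rewrite qg_piV qg_piM mulVg. Qed.
Lemma qg_mulrV : right_inverse qg_one qg_inv qg_mul.
Proof. by elim/quotW=> x; rewrite qg_piV qg_piM mulgV. Qed.

HB.instance Definition _ :=
  isGroup.Build quotient_group qg_mulA qg_mul1 qg_mulr1 qg_mulV qg_mulrV.

Lemma qg_piMg (x y : G) : \pi_Q (x * y) = \pi_Q x * \pi_Q y.
Proof. by rewrite -qg_piM. Qed.
Lemma qg_piVg (x : G) : \pi_Q x^-1 = (\pi_Q x)^-1.
Proof. by rewrite -qg_piV. Qed.

End QuotientGroup.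

Section TopologicalGroupTheory.
Variable G : topologicalGroupType.
Implicit Types (g : G) (W : set G).

Lemma lmul_continuous g : continuous (fun x : G => g * x).
Proof.
move=> x; apply: (@continuous_comp _ _ _ (fun x : G => (g, x))
  (fun p : G * G => p.1 * p.2)); last exact: mulg_continuous.
by apply: cvg_pair => /=; [exact: cvg_cst|exact: cvg_id].
Qed.

Lemma rmul_continuous g : continuous (fun x : G => x * g).
Proof.
move=> x; apply: (@continuous_comp _ _ _ (fun x : G => (x, g))
  (fun p : G * G => p.1 * p.2)); last exact: mulg_continuous.
by apply: cvg_pair => /=; [exact: cvg_id|exact: cvg_cst].
Qed.

End TopologicalGroupTheory.

Section QuotientTopologicalGroup.
Variables (G : topologicalGroupType) (Rel : set G).

Local Notation Q := (quotient_group Rel).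
Let N := sg_set (normal_closure Rel).

(* The quotient topology; the instance of [quotient_topology] is not reused
   because its underlying [choiceType] is not the one of [{eq_quot _}]. *)
Definition qg_open (W : set Q) : Prop := open ((\pi_Q : G -> Q) @^-1` W).

Lemma qg_openT : qg_open setT.
Proof. by rewrite /qg_open preimage_setT; exact: openT. Qed.

Lemma qg_openI : setI_closed qg_open.
Proof. by move=> A B oA oB; exact: openI. Qed.

Lemma qg_open_bigU (I : Type) (f : I -> set Q) :
  (forall i, qg_open (f i)) -> qg_open (\bigcup_i f i).
Proof. by move=> of_; apply: bigcup_open => i _; exact: of_. Qed.

HB.instance Definition _ :=
  isOpenTopological.Build Q qg_openT qg_openI qg_open_bigU.

Lemma qg_openE (W : set Q) : open W = open ((\pi_Q : G -> Q) @^-1` W).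
Proof. by []. Qed.

Lemma qg_pi_open (W : set G) : open W -> open ((\pi_Q : G -> Q) @` W).
Proof.
move=> oW; rewrite qg_openE.
have -> : (\pi_Q : G -> Q) @^-1` ((\pi_Q : G -> Q) @` W) =
    \bigcup_(n in N) ((fun x => x * n) @^-1` W).
  apply/seteqP; split=> x /=.
    case=> w Ww /(coset_quotP (normal_closure Rel)) Nwx.
    exists (w^-1 * x)^-1; first exact: sgV.
    by rewrite /= invgM invgK mulgA mulgV mul1g.
  case=> n Nn /= Wxn; exists (x * n) => //.
  apply/(coset_quotP (normal_closure Rel)).
  by rewrite invgM -mulgA mulVg mulg1; exact: sgV.
apply: bigcup_open => n Nn; apply: open_comp => // x _.
exact: rmul_continuous.
Qed.

Lemma qg_pi_continuous : continuous (\pi_Q : G -> Q).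
Proof. by apply/continuousP => A; rewrite qg_openE. Qed.

Lemma qg_mul_continuous : continuous (fun p : Q * Q => p.1 * p.2).
Proof.
case; elim/quotW=> x; elim/quotW=> y.
rewrite /continuous_at /= -qg_piMg => W.
move=> /(qg_pi_continuous (x := x * y)) /(@mulg_continuous G (x, y)).
case=> -[A B] /= [nA nB] AB.
rewrite nbhsE in nA; rewrite nbhsE in nB.
case: nA nB => A' [oA' A'x] A'A [B' [oB' B'y] B'B].
suff : filter_prod (nbhs (\pi_Q x : Q)) (nbhs (\pi_Q y : Q))
    ((fun p : Q * Q => p.1 * p.2) @^-1` W) by [].
exists ((\pi_Q : G -> Q) @` A', (\pi_Q : G -> Q) @` B').
  split; apply: open_nbhs_nbhs; split; try exact: qg_pi_open.
    by exists x.
  by exists y.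
case=> _ _ /= [[a A'a <-] [b B'b <-]]; rewrite -qg_piMg.
by apply: (AB (a, b)); split=> /=; [exact: A'A|exact: B'B].
Qed.

Lemma qg_inv_continuous : continuous (fun x : Q => x^-1).
Proof.
apply/continuousP => W oW; rewrite qg_openE.
have -> : (\pi_Q : G -> Q) @^-1` ((fun x : Q => x^-1) @^-1` W) =
    (fun x : G => x^-1) @^-1` ((\pi_Q : G -> Q) @^-1` W).
  by apply/seteqP; split=> x /=; rewrite qg_piVg.
by apply: open_comp; [move=> x _; exact: invg_continuous|exact: oW].
Qed.

HB.instance Definition _ :=
  isTopologicalGroup.Build Q qg_mul_continuous qg_inv_continuous.

End QuotientTopologicalGroup.

Section WordGroup.

Inductive word_eq (A : Type) (r : seq A -> seq A -> Prop) :
    seq A -> seq A -> Prop :=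
| word_step p q u v : r u v -> word_eq r (p ++ u ++ q) (p ++ v ++ q)
| word_refl u : word_eq r u u
| word_sym u v : word_eq r u v -> word_eq r v u
| word_trans v u w : word_eq r u v -> word_eq r v w -> word_eq r u w.

Lemma word_eq_ctx (A : Type) (r : seq A -> seq A -> Prop) p q u v :
  word_eq r u v -> word_eq r (p ++ u ++ q) (p ++ v ++ q).
Proof.
elim=> {u v} [p' q' u v ruv|u|u v _ IH|v u w _ IH1 _ IH2].
- have E x : p ++ (p' ++ x ++ q') ++ q = (p ++ p') ++ x ++ (q' ++ q).
    by rewrite -!catA.
  by rewrite !E; exact: word_step.
- exact: word_refl.
- exact: word_sym.
- exact: word_trans IH1 IH2.
Qed.

Lemma word_eq_cat (A : Type) (r : seq A -> seq A -> Prop) u u' v v' :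
  word_eq r u u' -> word_eq r v v' -> word_eq r (u ++ v) (u' ++ v').
Proof.
move=> uu' vv'; apply: (@word_trans _ _ (u' ++ v)).
  exact: (@word_eq_ctx _ r [::] v u u').
by have := @word_eq_ctx _ r u' [::] v v' vv'; rewrite !cats0.
Qed.

(* A monoid presentation in which every letter has an inverse letter. *)
Record presentation := Presentation {
  letter : choiceType ;
  letterV : letter -> letter ;
  relation : seq letter -> seq letter -> Prop ;
  letterVl : forall a, word_eq relation [:: letterV a; a] [::] ;
  letterVr : forall a, word_eq relation [:: a; letterV a] [::] }.

Variable P : presentation.
Local Notation weq := (word_eq (@relation P)).

Definition word_rel : rel (seq (letter P)) := fun u v => `[< weq u v >].

Lemma word_rel_equiv : equiv_class_of word_rel.
Proof.
split=> [u|u v|v u w].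
- by apply/asboolP; exact: word_refl.
- by apply/asboolP/asboolP; exact: word_sym.
- by move=> /asboolP uv /asboolP vw; apply/asboolP; exact: word_trans uv vw.
Qed.

Canonical word_equiv := EquivRelPack word_rel_equiv.

Definition word_group := {eq_quot word_rel}.
HB.instance Definition _ := EqQuotient.on word_group.
HB.instance Definition _ := Choice.on word_group.

Lemma word_groupP (u v : seq (letter P)) :
  \pi_word_group u = \pi_word_group v <-> weq u v.
Proof.
split; first by move=> /eqquotP /asboolP.
by move=> uv; apply/eqquotP/asboolP.
Qed.

Definition wordV (u : seq (letter P)) := [seq letterV a | a <- rev u].

Lemma wordVl u : weq (wordV u ++ u) [::].
Proof.
elim/last_ind: u => [|u a IH]; first exact: word_refl.
rewrite /wordV rev_rcons /= -cats1.
apply: (@word_trans _ _ [:: letterV a; a]); last exact: letterVl.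
have := @word_eq_ctx _ _ [:: letterV a] [:: a] _ _ IH.
by rewrite /= -catA.
Qed.

Lemma wordVr u : weq (u ++ wordV u) [::].
Proof.
elim: u => [|a u IH]; first exact: word_refl.
rewrite /wordV rev_cons map_rcons -cats1.
apply: (@word_trans _ _ [:: a; letterV a]); last exact: letterVr.
have := @word_eq_ctx _ _ [:: a] [:: letterV a] _ _ IH.
by rewrite /= -catA.
Qed.

Lemma wordV_eq u v : weq u v -> weq (wordV u) (wordV v).
Proof.
move=> uv; apply: (@word_trans _ _ (wordV u ++ (v ++ wordV v))).
  apply: word_sym; rewrite -[X in weq _ X]cats0.
  by apply: word_eq_cat; [exact: word_refl|exact: wordVr].
rewrite catA -[X in weq _ X]cat0s.
apply: word_eq_cat; last exact: word_refl.
apply: (@word_trans _ _ (wordV u ++ u)); last exact: wordVl.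
by apply: word_eq_cat; [exact: word_refl|exact: word_sym].
Qed.

Local Notation W := word_group.
Definition wg_mul (a b : W) : W := \pi_W (repr a ++ repr b).
Definition wg_one : W := \pi_W [::].
Definition wg_inv (a : W) : W := \pi_W (wordV (repr a)).

Lemma wg_reprE u : weq (repr (\pi_W u)) u.
Proof. by apply/word_groupP; rewrite reprK. Qed.

Lemma wg_piM u v : wg_mul (\pi_W u) (\pi_W v) = \pi_W (u ++ v).
Proof. by apply/word_groupP/word_eq_cat; exact: wg_reprE. Qed.

Lemma wg_piV u : wg_inv (\pi_W u) = \pi_W (wordV u).
Proof. by apply/word_groupP/wordV_eq; exact: wg_reprE. Qed.

Lemma wg_mulA : associative wg_mul.
Proof.
elim/quotW=> u; elim/quotW=> v; elim/quotW=> w.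
by rewrite (wg_piM v w) (wg_piM u v) (wg_piM u (v ++ w)) (wg_piM (u ++ v)) catA.
Qed.
Lemma wg_mul1 : left_id wg_one wg_mul.
Proof. by elim/quotW=> u; rewrite wg_piM. Qed.
Lemma wg_mulr1 : right_id wg_one wg_mul.
Proof. by elim/quotW=> u; rewrite wg_piM cats0. Qed.
Lemma wg_mulV : left_inverse wg_one wg_inv wg_mul.
Proof. by elim/quotW=> u; rewrite wg_piV wg_piM; apply/word_groupP/wordVl. Qed.
Lemma wg_mulrV : right_inverse wg_one wg_inv wg_mul.
Proof. by elim/quotW=> u; rewrite wg_piV wg_piM; apply/word_groupP/wordVr. Qed.

HB.instance Definition _ :=
  isGroup.Build word_group wg_mulA wg_mul1 wg_mulr1 wg_mulV wg_mulrV.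

Lemma wg_piMg u v : \pi_W (u ++ v) = \pi_W u * \pi_W v.
Proof. by rewrite -wg_piM. Qed.

End WordGroup.

Section FreeGroup.
Variable S : choiceType.

(* [(s, true)] is the generator [s] and [(s, false)] its inverse *)
Inductive free_rel : seq (S * bool) -> seq (S * bool) -> Prop :=
| FreeRel s b : free_rel [:: (s, b); (s, ~~ b)] [::].

Lemma free_letterVr (a : S * bool) :
  word_eq free_rel [:: a; (a.1, ~~ a.2)] [::].
Proof.
by case: a => s b; exact: (@word_step _ _ [::] [::] _ _ (FreeRel s b)).
Qed.

Lemma free_letterVl (a : S * bool) :
  word_eq free_rel [:: (a.1, ~~ a.2); a] [::].
Proof. by have := free_letterVr (a.1, ~~ a.2); rewrite /= negbK; case: a. Qed.

Definition free_presentation := Presentation free_letterVl free_letterVr.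

Definition free_group := word_group free_presentation.
HB.instance Definition _ := EqQuotient.on free_group.
HB.instance Definition _ := Group.on free_group.

Definition free_gen (s : S) : free_group := \pi_free_group [:: (s, true)].

End FreeGroup.

Section FreeProduct.
Variables G H : groupType.

Inductive fprod_rel : seq (G + H) -> seq (G + H) -> Prop :=
| FprodMl a b : fprod_rel [:: inl a; inl b] [:: inl (a * b)]
| FprodMr a b : fprod_rel [:: inr a; inr b] [:: inr (a * b)]
| Fprod1l : fprod_rel [:: inl 1] [::]
| Fprod1r : fprod_rel [:: inr 1] [::].

Definition fprod_letterV (x : G + H) : G + H :=
  match x with inl a => inl a^-1 | inr b => inr b^-1 end.

Lemma fprod_letterVl x : word_eq fprod_rel [:: fprod_letterV x; x] [::].
Proof.
case: x => a.
  apply: word_trans (@word_step _ _ [::] [::] _ _ Fprod1l).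
  by have := @word_step _ _ [::] [::] _ _ (FprodMl a^-1 a); rewrite mulVg.
apply: word_trans (@word_step _ _ [::] [::] _ _ Fprod1r).
by have := @word_step _ _ [::] [::] _ _ (FprodMr a^-1 a); rewrite mulVg.
Qed.

Lemma fprod_letterVr x : word_eq fprod_rel [:: x; fprod_letterV x] [::].
Proof.
case: x => a.
  apply: word_trans (@word_step _ _ [::] [::] _ _ Fprod1l).
  by have := @word_step _ _ [::] [::] _ _ (FprodMl a a^-1); rewrite mulgV.
apply: word_trans (@word_step _ _ [::] [::] _ _ Fprod1r).
by have := @word_step _ _ [::] [::] _ _ (FprodMr a a^-1); rewrite mulgV.
Qed.

Definition fprod_presentation := Presentation fprod_letterVl fprod_letterVr.

Definition free_product := word_group fprod_presentation.
HB.instance Definition _ := EqQuotient.on free_product.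
HB.instance Definition _ := Group.on free_product.

Definition fprod_inl (a : G) : free_product := \pi_free_product [:: inl a].
Definition fprod_inr (b : H) : free_product := \pi_free_product [:: inr b].

End FreeProduct.

Record openSubgroup (U : topologicalGroupType) := OpenSubgroup {
  os_subgroup :> subgroup U ;
  os_open : open (os_subgroup : set U) }.

(* A continuous open monomorphism [O -> U] is represented by a function
   defined on the whole of [U], whose values outside [O] are never used. *)
Record openMono (U : topologicalGroupType) (O : openSubgroup U) := OpenMono {
  om_fun :> U -> U ;
  omM : forall x y, sg_set O x -> sg_set O y -> om_fun (x * y) = om_fun x * om_fun y ;
  om_inj : forall x y, sg_set O x -> sg_set O y -> om_fun x = om_fun y -> x = y ;
  om_continuous : {within (O : set U), continuous om_fun} ;
  om_open : forall V : set U, V `<=` O -> open V -> open (om_fun @` V) }.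

Section HNN.
Variables (S : choiceType) (U : topologicalGroupType).
Variables (O : openSubgroup U) (phi : openMono O).

Local Notation UFS := (free_product U (free_group S)).

Definition hnn_relators : set UFS :=
  [set r | exists t w, sg_set O w /\
    r = fprod_inr U (free_gen t) * fprod_inl _ w * (fprod_inr U (free_gen t))^-1
        * (fprod_inl _ (phi w))^-1].

Definition hnn := quotient_group hnn_relators.
HB.instance Definition _ := EqQuotient.on hnn.
HB.instance Definition _ := Group.on hnn.

Definition hnn_base (u : U) : hnn := \pi_hnn (fprod_inl _ u).
Definition hnn_gen (t : S) : hnn := \pi_hnn (fprod_inr _ (free_gen t)).

Lemma hnn_baseM u v : hnn_base (u * v) = hnn_base u * hnn_base v.
Proof.
rewrite /hnn_base -[RHS]qg_piMg; congr (\pi_hnn _).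
rewrite /fprod_inl -[RHS]wg_piMg; apply/word_groupP/word_sym.
exact: (@word_step _ _ [::] [::] _ _ (FprodMl _ u v)).
Qed.

Lemma hnn_base1 : hnn_base 1 = 1.
Proof. by apply: (mulgI (hnn_base 1)); rewrite -hnn_baseM !mulg1. Qed.

Lemma hnn_baseV u : hnn_base u^-1 = (hnn_base u)^-1.
Proof.
by apply: (mulgI (hnn_base u)); rewrite -hnn_baseM !mulgV hnn_base1.
Qed.

Lemma hnn_relE t w : sg_set O w ->
  hnn_gen t * hnn_base w * (hnn_gen t)^-1 = hnn_base (phi w).
Proof.
move=> Ow; pose a : UFS := fprod_inr U (free_gen t).
pose b : UFS := fprod_inl _ w; pose c : UFS := fprod_inl _ (phi w).
have -> : hnn_gen t * hnn_base w * (hnn_gen t)^-1 = \pi_hnn (a * b * a^-1).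
  apply/esym; etransitivity; first exact: qg_piMg.
  by congr (_ * _); [exact: qg_piMg|exact: qg_piVg].
apply/(coset_quotP (normal_closure hnn_relators)); rewrite -/c.
have Nr : sg_set (normal_closure hnn_relators) (a * b * a^-1 * c^-1).
  by apply: normal_closure_sub; exists t, w.
have := @normal_closure_normal _ hnn_relators c^-1 _ (sgV Nr).
by rewrite invgM !invgK mulKg.
Qed.


(* The set [W] is open iff so are the traces on [U] of all its translates:
   this is the only group topology for which [hnn_base] is continuous and
   open, see [hnn_base_continuous], [hnn_base_open] and [hnn_topology_unique]
   below. *)
Definition hnn_open (W : set hnn) : Prop :=
  forall g, open [set u | W (g * hnn_base u)].

Lemma hnn_openT : hnn_open setT.
Proof. by move=> g; exact: openT. Qed.

Lemma hnn_openI : setI_closed hnn_open.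
Proof. by move=> A B oA oB g; exact: (openI (oA g) (oB g)). Qed.

Lemma hnn_open_bigU (I : Type) (f : I -> set hnn) :
  (forall i, hnn_open (f i)) -> hnn_open (\bigcup_i f i).
Proof.
move=> of_ g.
rewrite (_ : mkset _ = \bigcup_i [set u | f i (g * hnn_base u)]).
  by apply: bigcup_open => i _; exact: (of_ i g).
by apply/seteqP; split=> u /= [i _ fi]; exists i.
Qed.

HB.instance Definition _ :=
  isOpenTopological.Build hnn hnn_openT hnn_openI hnn_open_bigU.

Lemma hnn_openE (W : set hnn) :
  open W = forall g, open [set u | W (g * hnn_base u)].
Proof. by []. Qed.

Lemma open_local (T : topologicalType) (W : set T) :
  (forall x, W x -> exists V, [/\ open V, V x & V `<=` W]) -> open W.
Proof.
move=> h; rewrite openE => x /h [V [oV Vx VW]].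
by rewrite /interior nbhsE; exists V.
Qed.

Lemma hnn_base_translate_open g (V : set U) :
  open V -> open [set g * hnn_base u | u in V].
Proof.
move=> oV; rewrite hnn_openE => g'; apply: open_local => u0 /= [v0 Vv0 e].
exists ((fun u => (v0 * u0^-1) * u) @^-1` V); split.
- by apply: open_comp => // u _; exact: lmul_continuous.
- by rewrite /= -mulgA mulVg mulg1.
- move=> u /= Vu; exists (v0 * u0^-1 * u) => //.
  by rewrite !hnn_baseM !mulgA e hnn_baseV -(mulgA g') mulgV mulg1.
Qed.

Lemma hnn_base_open (V : set U) : open V -> open (hnn_base @` V).
Proof.
move=> /(@hnn_base_translate_open 1); congr open.
by apply/seteqP; split=> x /= [u Vu <-]; exists u; rewrite ?mul1g.
Qed.

Lemma hnn_base_continuous : continuous hnn_base.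
Proof.
apply/continuousP => W; rewrite hnn_openE => /(_ 1); congr open.
by apply/seteqP; split=> u /=; rewrite mul1g.
Qed.

Definition hnn_conj_ok (b : hnn) := forall P : set U, open P -> P 1 ->
  exists Q : set U, [/\ open Q, Q 1 & forall q, Q q ->
    exists2 p, P p & b * hnn_base q * b^-1 = hnn_base p].

Lemma hnn_conj_okM a b : hnn_conj_ok a -> hnn_conj_ok b -> hnn_conj_ok (a * b).
Proof.
move=> ha hb P oP P1; have [Q [oQ Q1 hQ]] := ha P oP P1.
have [Q' [oQ' Q'1 hQ']] := hb Q oQ Q1.
exists Q'; split=> // q /hQ' [p /hQ [p' Pp' e'] e]; exists p' => //.
by rewrite -e' -e invgM !mulgA.
Qed.

Lemma hnn_conj_ok_base u : hnn_conj_ok (hnn_base u).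
Proof.
move=> P oP P1; exists ((fun x => u * x) @^-1` ((fun x => x * u^-1) @^-1` P)).
split.
- apply: open_comp; first by move=> x _; exact: lmul_continuous.
  by apply: open_comp => // x _; exact: rmul_continuous.
- by rewrite /= mulg1 mulgV.
- by move=> q /= Pq; exists (u * q * u^-1) => //; rewrite !hnn_baseM hnn_baseV.
Qed.

Lemma om1 : phi 1 = 1.
Proof.
by apply: (mulgI (phi 1)); rewrite -omM ?mulg1//; exact: sg1.
Qed.

Lemma hnn_conj_ok_gen t : hnn_conj_ok (hnn_gen t).
Proof.
move=> P oP P1; exists ((O : set U) `&` phi @^-1` P); split.
- rewrite open_setSI; last exact: os_open.
  by have /continuousP := @om_continuous _ _ phi; apply.
- by split; [exact: sg1|rewrite /= om1].
- by move=> q [Oq Pq]; exists (phi q) => //; exact: hnn_relE.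
Qed.

Lemma hnn_conj_ok_genV t : hnn_conj_ok (hnn_gen t)^-1.
Proof.
move=> P oP P1; exists (phi @` ((O : set U) `&` P)); split.
- apply: om_open; first by move=> x [].
  by apply: openI => //; exact: os_open.
- by exists 1; [split=> //; exact: sg1|exact: om1].
- move=> _ [p [Op Pp] <-]; exists p => //.
  by rewrite -(hnn_relE t Op) invgK !mulgA mulVg mul1g mulgVK.
Qed.

Lemma hnn_ind (K : hnn -> Prop) :
  (forall a b, K a -> K b -> K (a * b)) -> (forall u, K (hnn_base u)) ->
  (forall t, K (hnn_gen t)) -> (forall t, K (hnn_gen t)^-1) ->
  forall g, K g.
Proof.
move=> KM Kb Kg KV g; rewrite -(reprK g).
have piM (a b : UFS) : \pi_hnn (a * b) = \pi_hnn a * \pi_hnn b.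
  exact: qg_piMg.
have piV (a : UFS) : \pi_hnn a^-1 = (\pi_hnn a)^-1 by exact: qg_piVg.
have K1 : K 1 by rewrite -hnn_base1.
elim/quotW: (repr g); elim=> [|[u|f] w IH]; first exact: K1.
  rewrite -cat1s wg_piMg piM; apply: (KM) => //; exact: Kb.
rewrite -cat1s wg_piMg piM; apply: (KM) => // {w IH}.
pose inrF (f : free_group S) : UFS := fprod_inr U f.
have inrM (a b : free_group S) : inrF (a * b) = inrF a * inrF b.
  rewrite /inrF /fprod_inr -[RHS]wg_piMg; apply/word_groupP/word_sym.
  exact: (@word_step _ _ [::] [::] _ _ (FprodMr _ a b)).
have inr1 : inrF 1 = 1 by apply: (mulgI (inrF 1)); rewrite -inrM !mulg1.
have inrV (a : free_group S) : inrF a^-1 = (inrF a)^-1.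
  by apply: (mulgI (inrF a)); rewrite -inrM !mulgV inr1.
rewrite -[X in K X]/(\pi_hnn (inrF f)).
elim/quotW: f; elim=> [|[s b] w IH].
  by rewrite -[\pi_(_) [::]]/(1 : free_group S) inr1; exact: K1.
rewrite -cat1s wg_piMg inrM piM; apply: (KM) => // {w IH}.
case: b; first exact: Kg.
have -> : \pi_(free_group S) [:: (s, false)] = (free_gen s)^-1.
  exact: esym (@wg_piV (free_presentation S) [:: (s, true)]).
by rewrite inrV piV; exact: KV.
Qed.

Lemma hnn_conj_okT g : hnn_conj_ok g.
Proof.
elim/hnn_ind: g => [a b||t|t].
- exact: hnn_conj_okM.
- exact: hnn_conj_ok_base.
- exact: hnn_conj_ok_gen.
- exact: hnn_conj_ok_genV.
Qed.

Lemma hnn_mul_continuous : continuous (fun p : hnn * hnn => p.1 * p.2).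
Proof.
move=> [a b]; rewrite /continuous_at /= => W.
rewrite nbhsE => -[W' [oW' W'ab] W'W].
pose P := [set u | W' (a * b * hnn_base u)].
have oP : open P by exact: oW'.
have : nbhs ((1 : U) * 1) P.
  by rewrite mulg1 nbhsE; exists P => //; split=> //; rewrite /P /= hnn_base1 mulg1.
move=> /(@mulg_continuous U (1, 1)) [[A B] /= [nA nB] AB].
rewrite nbhsE in nA; rewrite nbhsE in nB.
case: nA nB => A' [oA' A'1] A'A [B' [oB' B'1] B'B].
have [Q [oQ Q1 hQ]] := @hnn_conj_okT b^-1 A' oA' A'1.
suff : filter_prod (nbhs a) (nbhs b) ((fun p : hnn * hnn => p.1 * p.2) @^-1` W) by [].
exists ([set a * hnn_base u | u in Q], [set b * hnn_base u | u in B']).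
  split; apply: open_nbhs_nbhs; split; try exact: hnn_base_translate_open.
    by exists 1 => //; rewrite hnn_base1 mulg1.
  by exists 1 => //; rewrite hnn_base1 mulg1.
case=> _ _ /= [[q /hQ [p A'p e] <-] [p' B'p' <-]]; apply: W'W.
have := AB (p, p') (conj (A'A _ A'p) (B'B _ B'p')).
rewrite /P /= hnn_baseM -e invgK.
by rewrite !mulgA mulgK.
Qed.

Lemma hnn_inv_continuous : continuous (fun x : hnn => x^-1).
Proof.
apply/continuousP => W oW; rewrite hnn_openE => g.
apply: open_local => u0 /= Wu0.
pose c := (g * hnn_base u0)^-1.
have oP : open [set u | W (c * hnn_base u)] by exact: oW.
have [|Q [oQ Q1 hQ]] := @hnn_conj_okT c^-1 _ oP; first by rewrite /= hnn_base1 mulg1.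
exists ((fun u => u0^-1 * u) @^-1` ((fun u => u^-1) @^-1` Q)); split.
- apply: open_comp; first by move=> x _; exact: lmul_continuous.
  by apply: open_comp => // x _; exact: invg_continuous.
- by rewrite /= mulVg invg1.
- move=> u /= /hQ [p /= Wp e].
  suff -> : (g * hnn_base u)^-1 = c * hnn_base p by [].
  rewrite -e /c invgK -(mulgA (g * hnn_base u0)) mulKg (invgM u0^-1) invgK.
  by rewrite hnn_baseM hnn_baseV !invgM -mulgA mulVKg.
Qed.

HB.instance Definition _ :=
  isTopologicalGroup.Build hnn hnn_mul_continuous hnn_inv_continuous.

Lemma hnn_topology_unique (T : topologicalGroupType) (f : hnn -> T) :
  bijective f -> (forall a b, f (a * b) = f a * f b) ->
  continuous (f \o hnn_base) ->
  (forall V : set U, open V -> open ((f \o hnn_base) @` V)) ->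
  forall W : set T, open W <-> open (f @^-1` W).
Proof.
move=> [f' fK f'K] fM cf of_ W; split=> [oW|oW].
  rewrite hnn_openE => g.
  rewrite (_ : mkset _ = (f \o hnn_base) @^-1` ((fun x => f g * x) @^-1` W)).
    apply: open_comp; first by move=> x _; exact: cf.
    by apply: open_comp => // x _; exact: lmul_continuous.
  by apply/seteqP; split=> u /=; rewrite fM.
apply: open_local => w Ww; pose g := f' w.
exists ((fun x => (f g)^-1 * x) @^-1` ((f \o hnn_base) @`
  [set u | W (f (g * hnn_base u))])); split.
- apply: open_comp; first by move=> x _; exact: lmul_continuous.
  exact/of_/oW.
- exists 1; first by rewrite /= hnn_base1 mulg1 f'K.
  rewrite /= hnn_base1 f'K mulVg.
  by apply: (mulgI (f 1)); rewrite -fM !mulg1.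
- by move=> x /= [u Wu /(congr1 (fun y => f g * y))]; rewrite -fM mulVKg => <-.
Qed.

End HNN.

Section RAAG.
Variables (S : finType) (E : rel S) (U : topologicalGroupType).
Variables (O : openSubgroup U) (phi : openMono O).

Definition raag_relators : set (hnn S phi) :=
  [set r | exists s t, E s t /\
    r = hnn_gen phi s * hnn_gen phi t * (hnn_gen phi s)^-1 * (hnn_gen phi t)^-1].

Definition raag := quotient_group raag_relators.
HB.instance Definition _ := EqQuotient.on raag.
HB.instance Definition _ := TopologicalGroup.on raag.

Definition raag_base (u : U) : raag := \pi_raag (hnn_base S phi u).
Definition raag_gen (t : S) : raag := \pi_raag (hnn_gen phi t).

End RAAG.

Section WeakContractibility.
Variable R : realType.

Definition unit_cube (I : Type) : set {ptws I -> R} :=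
  [set x | forall i, (0 <= x i <= 1)%R].

(* The pair (n-disc, sphere) is modelled by ([0,1]^n, its boundary). *)
Definition disc (n : nat) : topologicalType := set_type (@unit_cube 'I_n).

Definition disc_boundary (n : nat) (d : disc n) : Prop :=
  exists i, \val d i = 0%R \/ \val d i = 1%R.

Definition unit_interval : topologicalType :=
  set_type [set t : R | (0 <= t <= 1)%R].

(* [Y] is non-empty and pi_n(Y, y) is trivial for every n >= 0 and y; elements
   of pi_n are represented by maps of the cube sending its boundary to y, and
   homotopies are relative to the boundary.  For n = 0 the boundary is empty
   and this is path-connectedness. *)
Definition weakly_contractible (Y : topologicalType) : Prop :=
  (exists y : Y, True) /\
  forall (n : nat) (y : Y) (f : disc n -> Y), continuous f ->
    (forall d, disc_boundary d -> f d = y) ->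
    exists h : disc n * unit_interval -> Y,
      [/\ continuous h,
          forall d t, \val t = 0%R -> h (d, t) = f d,
          forall d t, \val t = 1%R -> h (d, t) = y &
          forall d t, disc_boundary d -> h (d, t) = y].

End WeakContractibility.

Section GCW.
Variables (R : realType) (G : topologicalGroupType) (X : topologicalType).
Variable act : G -> X -> X.

Definition coset_space (H : subgroup G) : topologicalType :=
  quotient_topology (coset_quot H).

Definition to_coset (H : subgroup G) (g : G) : coset_space H :=
  \pi_(coset_quot H) g.

(* [skel n] is the (n-1)-skeleton: [skel n.+1] is the pushout of [skel n] and
   the equivariant n-cells G/H x D^n along the restrictions of the
   characteristic maps [char] to G/H x S^(n-1), and X carries the colimit
   topology. *)
Record gcw := GCW {
  skel : nat -> set X ;
  gcell : nat -> Type ;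
  stab : forall n, gcell n -> subgroup G ;
  char : forall n (c : gcell n), coset_space (stab c) * disc R n -> X ;
  gcw_act1 : forall x, act 1 x = x ;
  gcw_actM : forall g h x, act (g * h) x = act g (act h x) ;
  gcw_act_continuous : continuous (fun p : G * X => act p.1 p.2) ;
  gcw_stab_closed : forall n (c : gcell n), closed (stab c : set G) ;
  gcw_skel0 : skel 0 = set0 ;
  gcw_skelS : forall n, skel n `<=` skel n.+1 ;
  gcw_skel_cover : \bigcup_n skel n = setT ;
  gcw_skel_colim : forall W : set X,
    (forall n, open (W : set (subspace (skel n)))) -> open W ;
  gcw_char_continuous : forall n (c : gcell n), continuous (@char n c) ;
  gcw_char_equivariant : forall n (c : gcell n) g a d,
    @char n c (to_coset (stab c) (g * a), d) = act g (@char n c (to_coset (stab c) a, d)) ;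
  gcw_char_skel : forall n (c : gcell n) p, skel n.+1 (@char n c p) ;
  gcw_char_boundary : forall n (c : gcell n) a d,
    skel n (@char n c (a, d)) <-> disc_boundary d ;
  gcw_char_inj : forall n (c c' : gcell n) a a' d d',
    ~ disc_boundary d -> ~ disc_boundary d' -> @char n c (a, d) = @char n c' (a', d') ->
    existT (fun c => coset_space (stab c)) c a = existT _ c' a' /\ d = d' ;
  gcw_char_surj : forall n x, skel n.+1 x -> ~ skel n x ->
    exists (c : gcell n) p, @char n c p = x ;
  gcw_pushout : forall n (W : set X), open (W : set (subspace (skel n))) ->
    (forall c : gcell n, open (@char n c @^-1` W)) ->
    open (W : set (subspace (skel n.+1))) }.

Definition closed_cells (C : gcw) (n : nat) : set (set X) :=
  [set K | exists (c : gcell C n) a, K = [set @char C n c (a, d) | d in setT]].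

Definition pointwise_stabiliser (K : set X) : set G :=
  [set g | forall x, K x -> act g x = x].

Definition fixed_points (H : set G) : set X :=
  [set x | forall h, H h -> act h x = x].

Record is_family (F : set (set G)) : Prop := {
  family_nonempty : F !=set0 ;
  family_closed_subgroup : forall H, F H ->
    exists2 K : subgroup G, closed (K : set G) & H = K ;
  family_conj : forall H g, F H -> F (conjs g H) ;
  family_setI : forall H K, F H -> F K -> F (H `&` K) }.

(* [X], with [cells n] as set of closed n-cells, is a model for E_F G. *)
Definition is_classifying_complex (cells : nat -> set (set X))
    (F : set (set G)) : Prop :=
  exists C : gcw, [/\ closed_cells C = cells,
    forall n K, cells n K -> F (pointwise_stabiliser K) &
    forall H, F H -> weakly_contractible R (set_type (fixed_points H))].

End GCW.

Section Salvetti.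
Variables (R : realType) (S : finType) (E : rel S) (U : topologicalGroupType).
Variables (O : openSubgroup U) (phi : openMono O).
Local Notation A := (raag E phi).

Definition salvetti_vertex (g : A) : set A := lcoset g (range (raag_base E phi)).

Definition is_clique (T : {set S}) : bool :=
  [forall s in T, forall t in T, (s != t) ==> E s t].

Definition clique := {T : {set S} | is_clique T}.

(* The generators in a clique commute, so the order of the factors, here that
   of [enum S], is irrelevant for the subsets [B] of a clique. *)
Definition gen_prod (B : {set S}) : A := \prod_(t in B) raag_gen E phi t.

(* The corner of gQ_T whose coordinates are 1 on [B] and 0 on [T :\: B] is the
   vertex [g * gen_prod B] U. *)
Definition cube_vertices (g : A) (T : {set S}) : set (set A) :=
  [set salvetti_vertex (g * gen_prod B) | B in [set B : {set S} | B \subset T]].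

(* [0,1]^T, as the set of functions on [S] that vanish outside [T] *)
Definition cube (T : {set S}) : set {ptws S -> R} :=
  [set x | (forall s, 0 <= x s <= 1)%R /\ forall s, s \notin T -> x s = 0%R].

Definition cube_space (i : A * clique) : topologicalType :=
  set_type (cube (\val i.2)).

Definition cubes_union : topologicalType := {i : A * clique & cube_space i}.

Definition cube_pt (g : A) (T : clique) (x : cube_space (g, T)) : cubes_union :=
  existT cube_space (g, T) x.

Inductive cube_glue : cubes_union -> cubes_union -> Prop :=
(* Cubes with the same vertex set are identified.  In that case [T = T'] and
   corners with the same coordinates are the same vertex, because the exponent
   sums of the generators are well defined on A / U. *)
| GlueCell g g' (T T' : clique) (x : cube_space (g, T)) (x' : cube_space (g', T')) :
    cube_vertices g (\val T) = cube_vertices g' (\val T') -> \val x = \val x' ->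
    cube_glue (cube_pt x) (cube_pt x')
(* The face of gQ_T on which the coordinates in [B] are 1 and those in
   [T :\: (T' :|: B)] are 0 is the cube (g * gen_prod B)Q_T'. *)
| GlueFace g (T T' : clique) (B : {set S})
    (x : cube_space (g, T)) (x' : cube_space (g * gen_prod B, T')) :
    \val T' \subset \val T -> B \subset \val T :\: \val T' ->
    (forall s, s \in B -> \val x s = 1%R) ->
    (forall s, s \in \val T' -> \val x s = \val x' s) ->
    (forall s, s \in \val T :\: (\val T' :|: B) -> \val x s = 0%R) ->
    cube_glue (cube_pt x) (cube_pt x').

Definition salvetti_rel : rel cubes_union :=
  fun p q => `[< clos_refl_sym_trans cubes_union cube_glue p q >].

Lemma salvetti_rel_equiv : equiv_class_of salvetti_rel.
Proof.
split=> [p|p q|q p r].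
- by apply/asboolP; exact: rst_refl.
- by apply/asboolP/asboolP; exact: rst_sym.
- by move=> /asboolP pq /asboolP qr; apply/asboolP; exact: rst_trans pq qr.
Qed.

Canonical salvetti_equiv := EquivRelPack salvetti_rel_equiv.

Definition salvetti : topologicalType :=
  quotient_topology {eq_quot salvetti_rel}.

Definition salvetti_pt (g : A) (T : clique) (x : cube_space (g, T)) : salvetti :=
  \pi_{eq_quot salvetti_rel} (cube_pt x).

Definition translate (a : A) (p : cubes_union) : cubes_union :=
  let: existT i x := p in @cube_pt (a * i.1) i.2 x.

Definition salvetti_act (a : A) (p : salvetti) : salvetti :=
  \pi_{eq_quot salvetti_rel} (translate a (repr (p : {eq_quot salvetti_rel}))).

Lemma cube_vertices_translate (a g : A) T :
  cube_vertices (a * g) T = [set lcoset a K | K in cube_vertices g T].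
Proof.
have E1 (h : A) : salvetti_vertex (a * h) = lcoset a (salvetti_vertex h).
  apply/seteqP; split=> y /=.
    by move=> [k Uk <-]; exists (h * k); [exists k|rewrite mulgA].
  by move=> [_ [k Uk <-] <-]; exists k => //; rewrite mulgA.
apply/seteqP; split=> K /=.
  move=> [B BT <-]; exists (salvetti_vertex (g * gen_prod B)).
    by exists B.
  by rewrite -E1 mulgA.
by move=> [_ [B BT <-] <-]; exists B => //; rewrite -mulgA E1.
Qed.

Lemma translate_glue a p q :
  cube_glue p q -> cube_glue (translate a p) (translate a q).
Proof.
case=> [g g' T T' x x' e ex|g T T' B x x' sT sB x1 xx' x0] /=.
  by apply: GlueCell => //; rewrite !cube_vertices_translate e.
have := @GlueFace (a * g) T T' B x.
by rewrite -mulgA; move=> /(_ x'); exact.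
Qed.

Lemma salvetti_actE a g (T : clique) (x : cube_space (g, T)) :
  salvetti_act a (salvetti_pt x) = @salvetti_pt (a * g) T x.
Proof.
have tr p q : clos_refl_sym_trans _ cube_glue p q ->
    clos_refl_sym_trans _ cube_glue (translate a p) (translate a q).
  elim=> {p q} [p q pq|p|p q _|p q r _ IH1 _ IH2].
  - exact/rst_step/translate_glue.
  - exact: rst_refl.
  - exact: rst_sym.
  - exact: rst_trans IH1 IH2.
rewrite /salvetti_act; apply/eqquotP/asboolP.
apply: (tr _ (cube_pt x)).
have /eqquotP/asboolP := @reprK _ {eq_quot salvetti_rel} (salvetti_pt x).
exact.
Qed.

(* The closed cubes gQ_T with [T] of cardinality [n]. *)
Definition salvetti_cubes (n : nat) : set (set salvetti) :=
  [set K | exists (g : A) (T : clique), #|\val T| = n /\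
    K = [set salvetti_pt x | x in [set: cube_space (g, T)]]].

End Salvetti.

Arguments salvetti R {S} E {U O} phi.
Arguments salvetti_act R {S} E {U O} phi a p.
Arguments salvetti_cubes R {S} E {U O} phi n.

(* Main.v *)
(* An edge of the complex crosses a wall, namely a coset of the subgroup
   generated by [O] and the generators adjacent to the label of the edge.
   Crossing numbers modulo 2 form a cocycle on the group, obtained from its
   presentation as a homomorphism into a semidirect product; since
   [phi O = O], two letters of a word that cross the same wall can be cancelled,
   so the distance between two vertices is the number of walls separating them.

   A subgroup [H] with a finite orbit of vertices fixes a vertex: choose [x]
   minimising the sum of the distances from [x] to the translates [h x]; if [H]
   moves [x], then some wall next to [x] faces its translates, and crossing it
   makes the sum smaller.

   At each vertex the descending edges towards the base vertex [U] span a cube,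
   so the ball of radius [n] retracts onto that of radius [n - 1] by pushing
   each such cube along its diagonal.  Performing these retractions
   successively contracts the complex to [U] through [U]-equivariant maps, and
   by translation the fixed points of any subgroup fixing a vertex are
   contractible. *)
From HB Require Import structures.
Require Import Defs.
From mathcomp Require Import all_boot all_order all_algebra.
From mathcomp Require Import generic_quotient.
From Stdlib Require Import Relation_Operators.
From mathcomp Require Import all_classical all_reals all_analysis.
From mathcomp Require Import lra.
Import Order.TTheory GRing.Theory Num.Theory.
Import numFieldNormedType.Exports.

Set Implicit Arguments.
Unset Strict Implicit.
Unset Printing Implicit Defensive.

Local Open Scope classical_set_scope.
Local Open Scope quotient_scope.
Local Open Scope group_scope.

(** * Homomorphisms out of the group *)

(** Walls take the place of a CAT(0) metric. Letters carry a sign which the group preserves, so no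
    element exchanges the two sides of a wall; this is why a finite orbit of vertices yields a fixed
    vertex and not merely a fixed point inside a cube. Moreover two walls with the same label never
    cross, because moving along a wall crosses only walls with adjacent labels.

    The contraction must fit infinitely many retractions into a bounded time, on a complex that need
    not be locally compact. The retraction of level [n] takes place for [s] in [[n - 1, n]],
    traversed downwards, where [s = (1 - t) / t]; a point of level [N] rests while
    [t <= 1 / (N + 1)]. Continuity is tested cube by cube, which is legitimate on the product with a
    locally compact factor, the group for the action and the real line for the contraction. Since a
    point lies in many cubes, the retractions are defined through one canonical description of it,
    [toprep]. *)

Lemma morph_one (G K : groupType) (f : G -> K) :
  {morph f : x y / x * y} -> f 1 = 1.
Proof. by move=> fM; apply: (mulgI (f 1)); rewrite -fM !mulg1. Qed.

Lemma morph_inv (G K : groupType) (f : G -> K) :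
  {morph f : x y / x * y} -> {morph f : x / x^-1}.
Proof.
by move=> fM x; apply: (mulgI (f x)); rewrite -fM !mulgV (morph_one fM).
Qed.

(* [A] is the group generated by [U] and [S] with the defining relations of
   [raag E phi]; stating this abstractly keeps unification away from the
   iterated quotients. *)
Record raag_spec (S : finType) (E : rel S) (U A : groupType) (O : set U)
    (phi : U -> U) (base : U -> A) (gen : S -> A) : Prop := {
  spec_baseM : {morph base : x y / x * y} ;
  spec_rel : forall t w, O w -> gen t * base w = base (phi w) * gen t ;
  spec_commute : forall s t, E s t -> commute (gen s) (gen t) ;
  spec_ind : forall P : A -> Prop,
    (forall a b, P a -> P b -> P (a * b)) -> (forall u, P (base u)) ->
    (forall t, P (gen t)) -> (forall t, P (gen t)^-1) -> forall g, P g ;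
  spec_lift : forall (K : groupType) (f : U -> K) (h : S -> K),
    {morph f : x y / x * y} ->
    (forall t w, O w -> h t * f w = f (phi w) * h t) ->
    (forall s t, E s t -> commute (h s) (h t)) ->
    exists F : A -> K, [/\ {morph F : x y / x * y},
      forall u, F (base u) = f u & forall s, F (gen s) = h s] }.

Section Lifting.

Lemma word_group_lift (P : presentation) (K : groupType) (h : letter P -> K) :
  (forall u v, @relation P u v -> \prod_(a <- u) h a = \prod_(a <- v) h a) ->
  exists2 f : word_group P -> K, {morph f : x y / x * y} &
    forall u, f (\pi u) = \prod_(a <- u) h a.
Proof.
move=> hr; have hW u v : word_eq (@relation P) u v ->
    \prod_(a <- u) h a = \prod_(a <- v) h a.
  elim=> {u v} [p q u v /hr e|//|u v _ ->//|v u w _ -> _ ->//].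
  by rewrite !big_cat /= e.
have fE u : \prod_(a <- repr (\pi_(word_group P) u)) h a = \prod_(a <- u) h a.
  exact/hW/wg_reprE.
exists (fun x => \prod_(a <- repr x) h a) => //.
elim/quotW=> u; elim/quotW=> v.
by rewrite -wg_piMg !fE big_cat.
Qed.

Lemma quotient_group_lift (G K : groupType) (Rel : set G) (h : G -> K) :
  {morph h : x y / x * y} -> (forall r, Rel r -> h r = 1) ->
  exists2 f : quotient_group Rel -> K, {morph f : x y / x * y} &
    forall x, f (\pi x) = h x.
Proof.
move=> hM hr.
have ker1 : [set x | h x = 1] 1 by exact: morph_one.
have kerM x y : [set x | h x = 1] x -> [set x | h x = 1] y ->
  [set x | h x = 1] (x * y) by move=> /= ex ey; rewrite hM ex ey mulg1.
have kerV x : [set x | h x = 1] x -> [set x | h x = 1] x^-1.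
  by move=> /= ex; rewrite (morph_inv hM) ex invg1.
have NE x : sg_set (normal_closure Rel) x -> h x = 1.
  move=> /(_ (Subgroup ker1 kerM kerV)); apply => //= g y /= ey.
  by rewrite !hM ey mulg1 (morph_inv hM) mulgV.
have fE x : h (repr (\pi_(quotient_group Rel) x)) = h x.
  apply: (mulgI (h x)^-1); rewrite -(morph_inv hM) -hM NE ?hM; last exact: qg_reprE.
  by rewrite (morph_inv hM) mulVg.
exists (fun x => h (repr x)) => //.
by elim/quotW=> x; elim/quotW=> y; rewrite -qg_piMg !fE hM.
Qed.

Lemma free_group_lift (S : choiceType) (K : groupType) (h : S -> K) :
  exists2 f : free_group S -> K, {morph f : x y / x * y} &
    forall s, f (free_gen s) = h s.
Proof.
have [|f fM fE] := @word_group_lift (free_presentation S) K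
  (fun a : S * bool => if a.2 then h a.1 else (h a.1)^-1).
  move=> _ _ [s b]; rewrite !big_cons !big_nil /= mulg1.
  by case: b => /=; rewrite ?mulgV ?mulVg.
exists f => // s.
by have := fE [:: (s, true)]; rewrite big_seq1 /=.
Qed.

Lemma free_product_lift (G H K : groupType) (f : G -> K) (g : H -> K) :
  {morph f : x y / x * y} -> {morph g : x y / x * y} ->
  exists h : free_product G H -> K, [/\ {morph h : x y / x * y},
    forall x, h (fprod_inl H x) = f x & forall y, h (fprod_inr G y) = g y].
Proof.
move=> fM gM.
have [|h hM hE] := @word_group_lift (fprod_presentation G H) K
  (fun a : G + H => match a with inl x => f x | inr y => g y end).
  move=> _ _ [a b|a b||]; rewrite ?big_cons !big_nil /= ?mulg1 ?fM ?gM //;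
  exact: morph_one.
exists h; split=> // x.
  by have := hE [:: inl x]; rewrite big_seq1 /=.
by have := hE [:: inr x]; rewrite big_seq1 /=.
Qed.

Variables (S : finType) (E : rel S) (U : topologicalGroupType).
Variables (O : openSubgroup U) (phi : openMono O).

Lemma raag_lift (K : groupType) (f : U -> K) (h : S -> K) :
  {morph f : x y / x * y} ->
  (forall t w, sg_set O w -> h t * f w = f (phi w) * h t) ->
  (forall s t, E s t -> commute (h s) (h t)) ->
  exists F : raag E phi -> K, [/\ {morph F : x y / x * y},
    forall u, F (raag_base E phi u) = f u &
    forall s, F (raag_gen E phi s) = h s].
Proof.
move=> fM hf hh.
have [g gM gE] := free_group_lift h.
have [f1 [f1M f1l f1r]] := free_product_lift fM gM.
have [|f2 f2M f2E] := @quotient_group_lift _ _ (hnn_relators phi) f1 f1M.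
  move=> _ [t [w [Ow ->]]]; rewrite !f1M !(morph_inv f1M) !f1l f1r gE hf //.
  by rewrite mulgK mulgV.
have f2b u : f2 (hnn_base S phi u) = f u by rewrite f2E f1l.
have f2g s : f2 (hnn_gen phi s) = h s by rewrite f2E f1r gE.
have [|f3 f3M f3E] := @quotient_group_lift _ _ (@raag_relators _ E _ _ phi) f2 f2M.
  move=> _ [s [t [Est ->]]]; rewrite !f2M !(morph_inv f2M) !f2g (hh _ _ Est).
  by rewrite mulgK mulgV.
by exists f3; split=> // x; rewrite f3E.
Qed.

Lemma raag_ind (P : raag E phi -> Prop) :
  (forall a b, P a -> P b -> P (a * b)) -> (forall u, P (raag_base E phi u)) ->
  (forall t, P (raag_gen E phi t)) -> (forall t, P (raag_gen E phi t)^-1) ->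
  forall g, P g.
Proof.
move=> PM Pb Pg PV; elim/quotW.
elim/hnn_ind=> [a b Pa Pb'|//|//|t].
  by have := PM _ _ Pa Pb'; rewrite -qg_piMg.
by have := PV t; rewrite -qg_piVg.
Qed.

Lemma raag_baseM : {morph raag_base E phi : x y / x * y}.
Proof. by move=> u v; rewrite /raag_base hnn_baseM; exact: qg_piMg. Qed.

Lemma raag_base_continuous : continuous (raag_base E phi).
Proof.
move=> u; apply: continuous_comp; first exact: hnn_base_continuous.
exact: qg_pi_continuous.
Qed.

Lemma raag_base_open (V : set U) : open V -> open (raag_base E phi @` V).
Proof.
move=> /(@hnn_base_open S _ _ phi) /(@qg_pi_open _ (@raag_relators _ E _ _ phi)).
congr open; apply/seteqP; split=> [_ [_ [u Vu <-] <-]|_ [u Vu <-]].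
  by exists u.
by exists (hnn_base S phi u) => //; exists u.
Qed.

Let pr : hnn S phi -> raag E phi := fun x => \pi x.

Lemma raag_piM : {morph pr : x y / x * y}.
Proof. by move=> x y; exact: qg_piMg. Qed.

Lemma raag_piV : {morph pr : x / x^-1}.
Proof. exact: morph_inv raag_piM. Qed.

Lemma raag_relE t w : sg_set O w ->
  raag_gen E phi t * raag_base E phi w = raag_base E phi (phi w) * raag_gen E phi t.
Proof.
move=> Ow; apply: (mulIg (raag_gen E phi t)^-1); rewrite mulgK.
by rewrite -[raag_base E phi (phi w)]/(pr _) -(hnn_relE phi t Ow) !raag_piM raag_piV.
Qed.

Lemma raag_gen_commute s t : E s t -> commute (raag_gen E phi s) (raag_gen E phi t).
Proof.
move=> Est; set x := raag_gen _ _ _; set y := raag_gen _ _ _.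
have /divg1_eq e : x * y * x^-1 * y^-1 = 1.
  rewrite -[x]/(pr _) -[y]/(pr _) -!raag_piV -!raag_piM.
  apply/esym/coset_quotP.
  by rewrite invg1 mul1g; apply: normal_closure_sub; exists s, t.
by rewrite /commute -[in RHS]e mulgVK.
Qed.

Lemma raag_specP :
  raag_spec E (O : set U) phi (raag_base E phi) (raag_gen E phi).
Proof.
split; [exact: raag_baseM|exact: raag_relE|exact: raag_gen_commute|..].
  exact: raag_ind.
exact: raag_lift.
Qed.

End Lifting.

(** * Walls and the combinatorial distance *)

Section CocycleGroup.
Variables (G : groupType) (X : Type) (act : G -> X -> X).
Hypothesis act1 : forall x, act 1 x = x.
Hypothesis actM : forall g h x, act (g * h) x = act g (act h x).

(* The semidirect product of the functions [X -> bool], under pointwise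
   exclusive or, with [G]: a homomorphism into it that lifts the identity of
   [G] is a cocycle. *)
Definition cocycle_group of (forall x, act 1 x = x)
  & (forall g h x, act (g * h) x = act g (act h x)) : Type := ((X -> bool) * G)%type.
Local Notation C := (cocycle_group act1 actM).

HB.instance Definition _ := Choice.on C.

Definition cg_mul (a b : C) : C :=
  (fun x => a.1 x (+) b.1 (act a.2^-1 x), a.2 * b.2).
Definition cg_one : C := (fun=> false, 1).
Definition cg_inv (a : C) : C := (fun x => a.1 (act a.2 x), a.2^-1).

Lemma cg_mulA : associative cg_mul.
Proof.
move=> a b c; congr pair; last by rewrite /= mulgA.
by apply/funext => x /=; rewrite addbA invgM actM.
Qed.
Lemma cg_mul1 : left_id cg_one cg_mul.
Proof.
move=> [f g]; rewrite /cg_mul /= mul1g; congr pair.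
by apply/funext => x; rewrite invg1 act1.
Qed.
Lemma cg_mulr1 : right_id cg_one cg_mul.
Proof.
move=> [f g]; rewrite /cg_mul /= mulg1; congr pair.
by apply/funext => x; rewrite addbF.
Qed.
Lemma cg_mulV : left_inverse cg_one cg_inv cg_mul.
Proof.
move=> [f g]; rewrite /cg_mul /cg_one /= mulVg; congr pair.
by apply/funext => x; rewrite invgK addbb.
Qed.
Lemma cg_mulrV : right_inverse cg_one cg_inv cg_mul.
Proof.
move=> [f g]; rewrite /cg_mul /cg_one /= mulgV; congr pair.
by apply/funext => x; rewrite -actM mulgV act1 addbb.
Qed.

HB.instance Definition _ := isGroup.Build C cg_mulA cg_mul1 cg_mulr1 cg_mulV cg_mulrV.

Lemma cg_mulE (a b : C) :
  a * b = (fun x => a.1 x (+) b.1 (act a.2^-1 x), a.2 * b.2).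
Proof. by []. Qed.

End CocycleGroup.

Section Walls.
Variables (S : finType) (E : rel S) (U A : groupType) (O : subgroup U).
Variables (phi : U -> U) (bs : U -> A) (gn : S -> A).
Hypothesis E_sym : symmetric E.
Hypothesis E_irr : irreflexive E.
Hypothesis phiO : phi @` (O : set U) = (O : set U).
Hypothesis HA : raag_spec E (O : set U) phi bs gn.

Implicit Types (g h p q : A) (s t : S) (a b : S * bool) (l : seq (S * bool)).

Definition letter a : A := if a.2 then gn a.1 else (gn a.1)^-1.
Definition letter_inv a : S * bool := (a.1, ~~ a.2).
Definition ev l : A := \prod_(a <- l) letter a.
Definition inO : set A := bs @` (O : set U).
Definition inU : set A := range bs.

Lemma letter_invK : involutive letter_inv. Proof. by case=> s b; rewrite /letter_inv /= negbK. Qed.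

Lemma gl_inv a : letter (letter_inv a) = (letter a)^-1.
Proof. by case: a => s []; rewrite /letter /= ?invgK. Qed.

Lemma bsM : {morph bs : x y / x * y}. Proof. exact: spec_baseM HA. Qed.
Lemma bs1 : bs 1 = 1. Proof. exact: morph_one bsM. Qed.
Lemma bsV : {morph bs : x / x^-1}. Proof. exact: morph_inv bsM. Qed.

Lemma inU1 : inU 1. Proof. by exists 1; rewrite ?bs1. Qed.
Lemma inUM g h : inU g -> inU h -> inU (g * h).
Proof. by move=> [u _ <-] [v _ <-]; exists (u * v); rewrite ?bsM. Qed.
Lemma inUV g : inU g -> inU g^-1.
Proof. by move=> [u _ <-]; exists u^-1; rewrite ?bsV. Qed.

Lemma inO1 : inO 1. Proof. by exists 1; rewrite ?bs1 //; exact: sg1. Qed.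
Lemma inOM g h : inO g -> inO h -> inO (g * h).
Proof. by move=> [u Ou <-] [v Ov <-]; exists (u * v); rewrite ?bsM //; exact: sgM. Qed.
Lemma inOV g : inO g -> inO g^-1.
Proof. by move=> [u Ou <-]; exists u^-1; rewrite ?bsV //; exact: sgV. Qed.
Lemma inOU g : inO g -> inU g. Proof. by move=> [u Ou <-]; exists u. Qed.

(** This is where [phi O = O] enters: conjugation by a generator needs that [phi O] contains [O], by
    its inverse that [O] contains [phi O]. *)
Lemma inO_gl g a : inO g -> inO (g ^ letter a).
Proof.
move=> [w Ow <-]; case: a => s []; rewrite /letter /=.
  have : (phi @` (O : set U)) w by rewrite phiO.
  move=> [w' Ow' <-]; exists w' => //.
  by rewrite conjgE -(spec_rel HA) // mulKg.
exists (phi w); first by rewrite -phiO; exists w.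
by rewrite conjgE invgK mulgA (spec_rel HA) // mulgK.
Qed.

Lemma evS a l : ev (a :: l) = letter a * ev l.
Proof. by rewrite /ev big_cons. Qed.
Lemma ev0 : ev [::] = 1. Proof. by rewrite /ev big_nil. Qed.
Lemma ev_cat l l' : ev (l ++ l') = ev l * ev l'.
Proof. by rewrite /ev big_cat. Qed.
Lemma evV l : (ev l)^-1 = ev (map letter_inv (rev l)).
Proof.
elim: l => [|a l IH]; first by rewrite ev0 invg1.
by rewrite evS invgM IH rev_cons map_rcons -cats1 ev_cat evS ev0 mulg1 gl_inv.
Qed.

Lemma inO_ev g l : inO g -> inO (g ^ ev l).
Proof.
elim: l g => [|a l IH] g Og; first by rewrite ev0 conjg1.
by rewrite evS conjgM; exact/IH/inO_gl.
Qed.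

Lemma inO_evV g l : inO g -> inO (ev l * g * (ev l)^-1).
Proof.
by move=> Og; rewrite -mulgA -{1}(invgK (ev l)) -conjgE evV; exact: inO_ev.
Qed.

(** * Wall stabilisers and the action on walls *)

Definition lk s l : bool := all (fun a => E s a.1) l.

(** All letters normalise [inO], so the subgroup generated by [inO] and the generators adjacent to
    [s] consists of these products. *)
Definition wall_stab s : set A :=
  [set x | exists w l, [/\ inO w, lk s l & x = w * ev l]].

Lemma wall_stab1 s : wall_stab s 1.
Proof. by exists 1, [::]; rewrite ev0 mulg1; split=> //; exact: inO1. Qed.

Lemma wall_stabM s g h : wall_stab s g -> wall_stab s h -> wall_stab s (g * h).
Proof.
move=> [w [l [Ow sl ->]]] [w' [l' [Ow' sl' ->]]].
exists (w * (ev l * w' * (ev l)^-1)), (l ++ l'); split.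
- exact/inOM/inO_evV.
- by rewrite /lk all_cat; apply/andP.
- by rewrite ev_cat !mulgA mulgVK.
Qed.

Lemma wall_stabV s g : wall_stab s g -> wall_stab s g^-1.
Proof.
move=> [w [l [Ow sl ->]]]; exists (w^-1 ^ ev l), (map letter_inv (rev l)); split.
- exact/inO_ev/inOV.
- by rewrite /lk all_map -[all _ _]/(all (fun a => E s a.1) _) all_rev.
- by rewrite conjgE -evV -!mulgA mulgV mulg1 invgM.
Qed.

Lemma gl_gl_commute a b : E a.1 b.1 -> commute (letter a) (letter b).
Proof.
move=> Eab; have c : commute (gn a.1) (letter b).
  rewrite /letter; case: b.2; first exact: (spec_commute HA).
  exact/commuteV/(spec_commute HA).
by rewrite {1}/letter; case: a.2 => //; exact/commute_sym/commuteV/commute_sym.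
Qed.

Lemma gl_ev_commute a l : lk a.1 l -> commute (letter a) (ev l).
Proof.
elim: l => [|b l IH] /=; first by rewrite ev0 => _; exact: commute1.
by rewrite evS => /andP[Eab /IH]; apply: commuteM; exact: gl_gl_commute.
Qed.

Lemma commute_conjg (G : groupType) (x y : G) : commute x y -> x ^ y = x.
Proof. by move=> e; rewrite conjgE e mulKg. Qed.

Lemma wall_stab_gl a g : wall_stab a.1 g -> wall_stab a.1 (g ^ letter a).
Proof.
move=> [w [l [Ow sl ->]]]; exists (w ^ letter a), l; split=> //.
  exact: inO_gl.
by rewrite conjMg (commute_conjg (commute_sym (gl_ev_commute sl))).
Qed.

Lemma wall_stab_glV a g : wall_stab a.1 (g ^ letter a) -> wall_stab a.1 g.
Proof.
by move=> /(@wall_stab_gl (letter_inv a)); rewrite gl_inv conjgK.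
Qed.

(** The tail of the positively oriented version of the edge, so that an edge and its reverse get the
    same wall. *)
Definition wall_base p a := if a.2 then p else p * (gn a.1)^-1.

(* The wall crossed by the edge from the vertex [p U] to [p * letter a * U]. *)
Definition wl p a : (S * set A)%type := (a.1, lcoset (wall_base p a) (wall_stab a.1)).

Definition tw g (k : S * set A) : (S * set A)%type := (k.1, lcoset g k.2).

Lemma lcosetM (G : groupType) (x y : G) K : lcoset (x * y) K = lcoset x (lcoset y K).
Proof.
apply/seteqP; split=> [_ [z Kz <-]|_ [_ [z Kz <-] <-]].
  by exists (y * z); [exists z|rewrite mulgA].
by exists z; rewrite ?mulgA.
Qed.

Lemma lcoset1 (G : groupType) (K : set G) : lcoset 1 K = K.
Proof.
apply/seteqP; split=> [_ [z Kz <-]|z Kz]; first by rewrite mul1g.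
by exists z; rewrite ?mul1g.
Qed.

Lemma twM g h k : tw (g * h) k = tw g (tw h k).
Proof. by rewrite /tw lcosetM. Qed.

Lemma tw1 k : tw 1 k = k.
Proof. by case: k => s K; rewrite /tw lcoset1. Qed.

Lemma twK g : cancel (tw g) (tw g^-1).
Proof. by move=> k; rewrite -twM mulVg tw1. Qed.

Lemma twKV g : cancel (tw g^-1) (tw g).
Proof. by move=> k; rewrite -twM mulgV tw1. Qed.

Lemma tw_inj g : injective (tw g). Proof. exact: can_inj (twK g). Qed.

Lemma tw_wl g p a : tw g (wl p a) = wl (g * p) a.
Proof. by rewrite /tw /wl /wall_base /= -lcosetM; case: a.2; rewrite ?mulgA. Qed.

Lemma wl_inv p a : wl (p * letter a) (letter_inv a) = wl p a.
Proof.
by case: a => s []; rewrite /wl /wall_base /letter /letter_inv /= ?mulgK.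
Qed.

Lemma wlP p q a b : wl p a = wl q b <->
  a.1 = b.1 /\ wall_stab a.1 ((wall_base p a)^-1 * wall_base q b).
Proof.
rewrite /wl; case: a b => s e [t f] /=.
set x := wall_base _ _; set y := wall_base _ _; split=> [[st]|[<- xy]].
  rewrite -{}st => eK; split=> //.
  have : lcoset y (wall_stab s) y by exists 1; rewrite ?mulg1//; exact: wall_stab1.
  by rewrite -eK => -[z Kz <-]; rewrite mulKg.
congr pair; apply/seteqP; split=> [_ [z Kz <-]|_ [z Kz <-]].
  exists (y^-1 * x * z); last by rewrite !mulgA mulgV mul1g.
  by apply: wall_stabM => //; move: (wall_stabV xy); rewrite invgM invgK.
by exists (x^-1 * y * z); [exact: wall_stabM|rewrite !mulgA mulgV mul1g].
Qed.

(* Same sign: the tails of the two edges differ by an element of [wall_stab]. *)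
Lemma wl_eq_same p q a : wl p a = wl q a <-> wall_stab a.1 (p^-1 * q).
Proof.
rewrite wlP /wall_base; case: a => s [] /=; first by split=> // -[].
have -> : (p * (gn s)^-1)^-1 * (q * (gn s)^-1) = (p^-1 * q) ^ letter (s, false).
  by rewrite conjgE /letter /= invgM invgK !mulgA.
split=> [[_]|pq]; first exact: (@wall_stab_glV (s, false)).
by split=> //; exact: (@wall_stab_gl (s, false)).
Qed.

Lemma wl_eq_inv p q a : wl p a = wl q (letter_inv a) <-> wall_stab a.1 ((p * letter a)^-1 * q).
Proof. by rewrite -(wl_inv p a) wl_eq_same. Qed.

Lemma wl_bs p w a : inO w -> wl (p * w) a = wl p a.
Proof.
move=> Ow; apply/wl_eq_same; rewrite invgM mulgVK.
by apply: wall_stabV; exists w, [::]; rewrite ev0 mulg1.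
Qed.

(** Opposite edges of a square cross the same wall. *)
Lemma wl_gl p a b : E b.1 a.1 -> wl (p * letter a) b = wl p b.
Proof.
move=> Eba; apply/wl_eq_same; rewrite invgM mulgVK.
apply: wall_stabV; exists 1, [:: a]; rewrite evS ev0 mulg1 mul1g /=; split=> //.
  exact: inO1.
by rewrite /lk /= Eba.
Qed.

Lemma crossing_ex : exists N : A -> S * set A -> bool,
  [/\ forall g h k, N (g * h) k = N g k (+) N h (tw g^-1 k),
      forall u k, N (bs u) k = false &
      forall s k, N (gn s) k = (k == wl 1 (s, true))].
Proof.
pose f (u : U) : cocycle_group tw1 twM := (fun=> false, bs u).
pose h s : cocycle_group tw1 twM := (fun k => k == wl 1 (s, true), gn s).
have [|||F [FM Fb Fg]] := @spec_lift _ _ _ _ _ _ _ _ HA _ f h.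
- by move=> u v; rewrite cg_mulE /f /= bsM.
(* The first components agree because [bs (phi w)], being in [inO], preserves the wall of the edge
   labelled [t] at [U]. *)
- move=> t w Ow; rewrite !cg_mulE /f /h /= (spec_rel HA) //; congr pair.
  apply/funext => k; rewrite addbF /=.
  rewrite -[in RHS](inj_eq (@tw_inj (bs (phi w)))) twKV tw_wl mulg1.
  rewrite -[X in _ = (_ == wl X _)]mul1g wl_bs //.
  by exists (phi w) => //; rewrite -phiO; exists w.
(* By [wl_gl] each of the two generators preserves the wall of the other, so both products have the
   sum of the two indicators as first component. *)
- move=> s t Est; rewrite /commute !cg_mulE /h /= (spec_commute HA) //; congr pair.
  have aux (x y : S) k : E x y ->
      (tw (gn x)^-1 k == wl 1 (y, true)) = (k == wl 1 (y, true)).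
    move=> Exy; rewrite -[in LHS](inj_eq (@tw_inj (gn x))) twKV tw_wl mulg1.
    rewrite E_sym in Exy.
    have wE := @wl_gl 1 (x, true) (y, true) Exy.
    rewrite mul1g in wE.
    rewrite -[in RHS]wE.
    by [].
  have Ets : E t s by rewrite E_sym.
  by apply/funext => k; rewrite (aux _ _ _ Est) (aux _ _ _ Ets) addbC.
have F2 g : (F g).2 = g.
  elim/(spec_ind HA): g => [a b ea eb||t|t].
  - by rewrite FM cg_mulE /= ea eb.
  - by move=> u; rewrite Fb.
  - by rewrite Fg.
  - have := FM (gn t) (gn t)^-1; rewrite mulgV (morph_one FM) => /(congr1 snd) /=.
    by rewrite Fg /= => e; apply/esym/mulg1_eq.
exists (fun g => (F g).1); split=> [g g' k|u k|s k].
- by rewrite FM cg_mulE /= F2.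
- by rewrite Fb.
- by rewrite Fg.
Qed.

(* [crosses g k]: the wall [k] separates the vertices [U] and [g U]. *)
Definition crosses : A -> S * set A -> bool := sval (cid crossing_ex).
Local Notation N := crosses.

Lemma crosses_mul g h k : N (g * h) k = N g k (+) N h (tw g^-1 k).
Proof. by rewrite /N; case: cid => ? []. Qed.

Lemma crosses_base u k : N (bs u) k = false.
Proof. by rewrite /N; case: cid => ? []. Qed.

Lemma crosses_gen s k : N (gn s) k = (k == wl 1 (s, true)).
Proof. by rewrite /N; case: cid => ? []. Qed.

Lemma crosses1 k : N 1 k = false. Proof. by rewrite -bs1 crosses_base. Qed.

Lemma crossesV g k : N g^-1 k = N g (tw g k).
Proof.
have := crosses_mul g g^-1 (tw g k).
by rewrite mulgV crosses1 twK; case: (N g _); case: (N _ _).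
Qed.

Lemma crosses_gl a k : N (letter a) k = (k == wl 1 a).
Proof.
case: a => s []; rewrite /letter /= ?crosses_gen // crossesV crosses_gen.
rewrite -[in RHS](inj_eq (@tw_inj (gn s))) tw_wl mulg1; congr (_ == _).
by have := wl_inv 1 (s, true); rewrite mul1g /letter /letter_inv /= => ->.
Qed.

Lemma crosses_glr g a k : N (g * letter a) k = N g k (+) (k == wl g a).
Proof.
rewrite crosses_mul crosses_gl -(inj_eq (@tw_inj g)) twKV tw_wl mulg1 //.
Qed.

Lemma crosses_inU g u k : inU u -> N (g * u) k = N g k.
Proof. by move=> [v _ <-]; rewrite crosses_mul crosses_base addbF. Qed.

Lemma crosses_inUl g u k : inU u -> N (u * g) (tw u k) = N g k.
Proof. by move=> [v _ <-]; rewrite crosses_mul crosses_base twK. Qed.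

Lemma crosses_rel g x y k : N (g * x) (tw g k) (+) N (g * y) (tw g k) = N x k (+) N y k.
Proof. by rewrite !crosses_mul !twK addbACA addbb. Qed.

(** With [E] irreflexive, this means that moving by an element of [wall_stab s] crosses no wall
    labelled [s]. *)
Lemma crosses_wall_stab s g k : wall_stab s g -> N g k -> E s k.1.
Proof.
move=> [_ [l [[u _ <-] sl ->]]]; rewrite crosses_mul crosses_base /=.
have -> : k.1 = (tw (bs u)^-1 k).1 by [].
move: (tw _ _) => {}k; elim: l sl k => [|a l IH] /=.
  by move=> _ k; rewrite ev0 crosses1.
move=> /andP[Ea sl] k; rewrite evS crosses_mul crosses_gl.
by case: eqP => [-> //|_ /= /(IH sl)].
Qed.

(** Each letter is preceded by an element of [U], so that the size of the word counts edges and
    elements of [U] cost nothing; a last factor in [U] is kept apart in [is_word]. *)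
Definition wv (w : seq (U * (S * bool))) : A := \prod_(x <- w) (bs x.1 * letter x.2).

Lemma wvS x w : wv (x :: w) = bs x.1 * letter x.2 * wv w.
Proof. by rewrite /wv big_cons. Qed.
Lemma wv0 : wv [::] = 1. Proof. by rewrite /wv big_nil. Qed.
Lemma wv_cat w w' : wv (w ++ w') = wv w * wv w'.
Proof. by rewrite /wv big_cat. Qed.
Lemma wv_rcons w x : wv (rcons w x) = wv w * bs x.1 * letter x.2.
Proof. by rewrite -cats1 wv_cat wvS wv0 mulg1 mulgA. Qed.

Fixpoint walls g (w : seq (U * (S * bool))) : seq (S * set A) :=
  if w is x :: w' then wl (g * bs x.1) x.2 :: walls (g * bs x.1 * letter x.2) w'
  else [::].

Lemma size_walls g w : size (walls g w) = size w.
Proof. by elim: w g => //= x w IH g; rewrite IH. Qed.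

Lemma walls_cat g w w' : walls g (w ++ w') = walls g w ++ walls (g * wv w) w'.
Proof.
elim: w g => [|x w IH] g /=; first by rewrite wv0 mulg1.
by rewrite IH wvS !mulgA.
Qed.

Lemma walls_rcons g w x :
  walls g (rcons w x) = rcons (walls g w) (wl (g * wv w * bs x.1) x.2).
Proof. by rewrite -cats1 walls_cat /= cats1. Qed.

Lemma map_tw_walls h g w : map (tw h) (walls g w) = walls (h * g) w.
Proof. by elim: w g => //= x w IH g; rewrite IH tw_wl !mulgA. Qed.

Lemma in_walls g w k : k \in walls g w ->
  exists w1 x w2, w = w1 ++ x :: w2 /\ k = wl (g * wv w1 * bs x.1) x.2.
Proof.
elim: w g => //= x w IH g; rewrite inE => /orP[/eqP->|/IH].
  by exists [::], x, w; rewrite wv0 mulg1.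
move=> [w1 [y [w2 [-> ->]]]]; exists (x :: w1), y, w2; split=> //.
by rewrite wvS !mulgA.
Qed.

Lemma map_fst_walls g w : map fst (walls g w) = map (fun x => x.2.1) w.
Proof. by elim: w g => //= x w IH g; rewrite IH. Qed.

Lemma crosses_wv g w k : N (g * wv w) k = N g k (+) odd (count_mem k (walls g w)).
Proof.
elim: w g => [|x w IH] g /=; first by rewrite wv0 mulg1 addbF.
rewrite wvS !mulgA IH crosses_glr crosses_inU; last by exists x.1.
by rewrite oddD oddb addbA (eq_sym k).
Qed.

Lemma crosses_uniq w k : uniq (walls 1 w) -> N (wv w) k = (k \in walls 1 w).
Proof.
move=> uw; rewrite -[wv w]mul1g crosses_wv crosses1 /=.
by rewrite count_uniq_mem // oddb.
Qed.

(** The retraction onto the subgroup generated by the [gn s]; it compares words once their factors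
    from [U] are erased. *)
Lemma kill_base_ex : exists f : A -> A,
  [/\ {morph f : x y / x * y}, forall u, f (bs u) = 1 & forall s, f (gn s) = gn s].
Proof.
apply: (spec_lift HA) => [x y|t w _|s t]; rewrite ?mulg1 ?mul1g //.
exact: (spec_commute HA).
Qed.

Definition kill_base : A -> A := sval (cid kill_base_ex).

Lemma kill_baseM : {morph kill_base : x y / x * y}.
Proof. by rewrite /kill_base; case: cid => ? []. Qed.

Lemma kill_base_inU u : inU u -> kill_base u = 1.
Proof. by move=> [v _ <-]; rewrite /kill_base; case: cid => ? []. Qed.

Lemma kill_base_gl a : kill_base (letter a) = letter a.
Proof.
have g1 s : kill_base (gn s) = gn s by rewrite /kill_base; case: cid => ? [].
by case: a => s []; rewrite /letter /= ?(morph_inv kill_baseM) g1.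
Qed.

Lemma kill_base_ev l : kill_base (ev l) = ev l.
Proof.
elim: l => [|a l IH]; first by rewrite ev0 (morph_one kill_baseM).
by rewrite evS kill_baseM kill_base_gl IH.
Qed.

Lemma kill_base_wv w : kill_base (wv w) = ev (map snd w).
Proof.
elim: w => [|x w IH]; first by rewrite wv0 ev0 (morph_one kill_baseM).
rewrite wvS /= evS !kill_baseM IH kill_base_gl kill_base_inU ?mul1g //.
by exists x.1.
Qed.

(** The analogue of the exchange condition for Coxeter groups. Edges crossing the same wall differ
    by an element of [wall_stab], so the stretch between the two crossings lies in that subgroup:
    its letters are adjacent to the label of [a], and its factors from [U] can be collected into one
    element of [inO]. *)
Lemma exchange w u a : uniq (walls 1 w) -> inU u -> wl (wv w * u) a \in walls 1 w ->
  exists w1 u1 w2, [/\ w = w1 ++ (u1, letter_inv a) :: w2, lk a.1 (map snd w2) &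
    exists2 o, inO o & wv w2 * u = o * ev (map snd w2)].
Proof.
move=> uw Uu /in_walls [w1 [[u1 b] [w2 [ew]]]].
rewrite mul1g /= => ek; pose p := wv w1 * bs u1; pose m := wv w2 * u.
have e : wv w * u = p * letter b * m by rewrite ew wv_cat wvS /p /m /= !mulgA.
rewrite e -/p in ek; have mE : m = wv w2 * u by [].
move: uw; rewrite ew walls_cat /= mul1g -/p cat_uniq => /and3P[_ _ /andP[nk uw2]].
clearbody p m.
have wE : walls (p * letter b) w2 = map (tw (p * letter b)) (walls 1 w2).
  by rewrite map_tw_walls mulg1.
have uw2' : uniq (walls 1 w2) by move: uw2; rewrite wE; exact: map_uniq.
have Nm k : N m k = (k \in walls 1 w2) by rewrite mE crosses_inU // crosses_uniq.
(* If both edges crossed the wall in the same direction, the stretch [m] between them would have to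
   cross it back, and the wall would occur twice in [w]. *)
have [ba|nba] := eqVneq b a.
  subst b.
  have := esym ek; rewrite wl_eq_same -!mulgA mulKg => Wm.
  have : N m (wl 1 (letter_inv a)).
    rewrite -(mulKg (letter a) m) crosses_mul -gl_inv crosses_gl eqxx /=.
    apply/negP => /(crosses_wall_stab Wm) /=.
    by rewrite /= E_irr.
  rewrite Nm => /(map_f (tw (p * letter a))); rewrite -wE tw_wl mulg1 wl_inv.
  by move/negPf: nk => ->.
have ab1 : a.1 = b.1 by move: ek => /(congr1 fst).
have bE : b = letter_inv a.
  case: (a) (b) nba ab1 => s [] [t []] /= nba st; rewrite /letter_inv st //=;
  by rewrite st eqxx in nba.
rewrite {nba ab1}bE {b} in e ek ew nk uw2 wE *.
have := esym ek; rewrite -[X in _ = wl _ X]letter_invK wl_eq_inv mulKg => Wm.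
have lkw : lk a.1 (map snd w2).
  apply/allP => c /mapP[x xw2 ->].
  have : x.2.1 \in map fst (walls 1 w2).
    by rewrite map_fst_walls; apply/mapP; exists x.
  move=> /mapP[k]; rewrite -Nm => /(crosses_wall_stab Wm) /= Ek ->.
  exact: Ek.
exists w1, u1, w2; split=> //.
(* [Wm] only provides some word in the link; [kill_base] shows that its value is that of the letters
   of [w2]. *)
case: Wm => w' [l [Ow' _ em]]; exists w' => //.
rewrite -mE em; congr (_ * _).
have := congr1 kill_base em; rewrite mE !kill_baseM kill_base_wv kill_base_ev.
by rewrite !kill_base_inU ?mulg1 ?mul1g //; exact: inOU.
Qed.

(** * Word length and shortest words *)

Definition is_word g w := exists2 u, inU u & g = wv w * u.

Lemma inU_wv u w : inU u -> exists2 w', size w' = size w & is_word (u * wv w) w'.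
Proof.
move=> Uu; case: w => [|x w].
  by exists [::] => //; exists u; rewrite ?wv0 // mulg1 mul1g.
case: Uu => v _ <-; exists ((v * x.1, x.2) :: w) => //.
by exists 1; rewrite ?mulg1 ?wvS ?bsM ?mulgA //; exact: inU1.
Qed.

Lemma is_wordM g h w w' : is_word g w -> is_word h w' ->
  exists2 w'', size w'' = (size w + size w')%N & is_word (g * h) w''.
Proof.
move=> [u Uu ->] [v Uv ->]; have [w'' sw [v' Uv' e]] := inU_wv w' Uu.
exists (w ++ w''); first by rewrite size_cat sw.
by exists (v' * v); [exact: inUM|rewrite wv_cat !mulgA -(mulgA _ u) e !mulgA].
Qed.

Lemma is_word_inU u : inU u -> is_word u [::].
Proof. by exists u; rewrite ?wv0 ?mul1g. Qed.

Lemma is_word_gl a : is_word (letter a) [:: (1, a)].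
Proof. by exists 1; [exact: inU1|rewrite wvS wv0 bs1 !mulg1 mul1g]. Qed.

Lemma word_ex g : exists w, is_word g w.
Proof.
elim/(spec_ind HA): g => [g h [w gw] [w' hw']|u|t|t].
- by have [w'' _] := is_wordM gw hw'; exists w''.
- by exists [::]; apply: is_word_inU; exists u.
- by exists [:: (1, (t, true))]; exact: (is_word_gl (t, true)).
- by exists [:: (1, (t, false))]; exact: (is_word_gl (t, false)).
Qed.

Lemma len_ex g : exists n, `[< exists2 w, is_word g w & size w = n >].
Proof. by have [w gw] := word_ex g; exists (size w); apply/asboolP; exists w. Qed.

(* The combinatorial distance between the vertices [U] and [g U]. *)
Definition len g := ex_minn (len_ex g).

Lemma lenP g : exists2 w, is_word g w & size w = len g.
Proof. by rewrite /len; case: ex_minnP => n /asboolP. Qed.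

Lemma len_le g w : is_word g w -> (len g <= size w)%N.
Proof.
by rewrite /len; case: ex_minnP => n _ h gw; apply: h; apply/asboolP; exists w.
Qed.

Lemma len_mul g h : (len (g * h) <= len g + len h)%N.
Proof.
have [w gw <-] := lenP g; have [w' hw <-] := lenP h.
by have [w'' <-] := is_wordM gw hw; exact: len_le.
Qed.

Lemma len_inU u : inU u -> len u = 0%N.
Proof. by move=> /is_word_inU /len_le; rewrite leqn0 => /eqP. Qed.

Lemma len0 g : len g = 0%N -> inU g.
Proof.
move=> g0; have [w [u Uu eg] sw] := lenP g.
by move: sw; rewrite g0 eg => /size0nil ->; rewrite wv0 mul1g.
Qed.

Lemma len_inUr g u : inU u -> len (g * u) = len g.
Proof.
move=> Uu; have Uu' := inUV Uu; apply/eqP; rewrite eqn_leq; apply/andP; split.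
  by have := len_mul g u; rewrite (len_inU Uu) addn0.
by have := len_mul (g * u) u^-1; rewrite mulgK (len_inU Uu') addn0.
Qed.

Lemma len_inUl g u : inU u -> len (u * g) = len g.
Proof.
move=> Uu; have Uu' := inUV Uu; apply/eqP; rewrite eqn_leq; apply/andP; split.
  by have := len_mul u g; rewrite (len_inU Uu) add0n.
by have := len_mul u^-1 (u * g); rewrite mulKg (len_inU Uu') add0n.
Qed.

Lemma len_gl_le a : (len (letter a) <= 1)%N.
Proof. exact: (len_le (is_word_gl a)). Qed.

Lemma len_ev_le l : (len (ev l) <= size l)%N.
Proof.
elim: l => [|a l IH]; first by rewrite ev0 (len_inU inU1).
rewrite evS; apply: leq_trans (len_mul _ _) _.
by rewrite /= -add1n leq_add // len_gl_le.
Qed.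

Lemma len_wv_le w : (len (wv w) <= size w)%N.
Proof. by apply: len_le; exists 1; rewrite ?mulg1 //; exact: inU1. Qed.

(** The letter [a] commutes with the letters since the first crossing, so it can be moved back to
    cancel [letter_inv a]; the element of [inO] met on the way is merely conjugated. *)
Lemma exchange_len w u a : uniq (walls 1 w) -> inU u ->
  wl (wv w * u) a \in walls 1 w -> (len (wv w * u * letter a) < size w)%N.
Proof.
move=> uw Uu /(exchange uw Uu) [w1 [u1 [w2 [-> lw2 [x Ox e]]]]].
set l := map snd w2 in lw2 e.
have -> : wv (w1 ++ (u1, letter_inv a) :: w2) * u * letter a =
    wv w1 * (bs u1 * (x ^ letter a)) * ev l.
  rewrite wv_cat wvS gl_inv conjgE -!mulgA (mulgA _ u) e -!mulgA.
  by rewrite (gl_ev_commute lw2).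
apply: (@leq_ltn_trans (size w1 + size w2)); last by rewrite size_cat /= addnS.
apply: leq_trans (len_mul _ _) _; apply: leq_add.
  rewrite len_inUr ?len_wv_le //; apply: inUM; first by exists u1.
  exact/inOU/inO_gl.
by rewrite -(size_map snd) len_ev_le.
Qed.

(** Prefixes of a shortest word are shortest, and a last edge recrossing a wall would allow
    shortening by [exchange_len]. *)
Lemma min_uniq g w : is_word g w -> size w = len g -> uniq (walls 1 w).
Proof.
elim/last_ind: w g => // w x IH g [u Uu ->].
rewrite len_inUr // wv_rcons size_rcons => sg.
have Ux : inU (bs x.1) by exists x.1.
have lw : len (wv w) = size w.
  apply/eqP; rewrite eqn_leq len_wv_le /= -ltnS sg.
  apply: leq_trans (len_mul _ _) _.
  by rewrite len_inUr // -addn1 leq_add2l len_gl_le.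
have uw : uniq (walls 1 w).
  by apply: (IH (wv w)) => //; exists 1; rewrite ?mulg1 //; exact: inU1.
rewrite walls_rcons mul1g rcons_uniq uw andbT; apply/negP.
by move=> /(exchange_len uw Ux); rewrite -sg ltnNge leqnSn.
Qed.

(** A word without repeated walls lists exactly the walls separating [U] from [g U], so all such
    words have the same size. *)
Lemma len_uniq g w : uniq (walls 1 w) -> is_word g w -> len g = size w.
Proof.
move=> uw gw; have [w' gw' sw'] := lenP g; have uw' := min_uniq gw' sw'.
rewrite -sw' -!(size_walls 1); apply/perm_size/uniq_perm => // k.
rewrite -!crosses_uniq //.
case: gw gw' => u Uu -> [v Vv] /(congr1 (crosses^~ k)).
by rewrite !crosses_inU.
Qed.

(* The edge from [g U] to [g * letter a * U] decreases the distance to [U]. *)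
Definition descends g a := N g (wl g a).

Lemma crosses_len_gt0 g k : N g k -> (0 < len g)%N.
Proof.
move=> gk; rewrite lt0n; apply: contraTneq gk => /len0 Ug.
by rewrite -[g]mul1g crosses_inU // crosses1.
Qed.

Lemma len_gl g a : len (g * letter a) = if descends g a then (len g).-1 else (len g).+1.
Proof.
have [w [u Uu eg] sw] := lenP g.
have uw : uniq (walls 1 w) by apply: min_uniq sw; exists u.
have lg : (len g <= (len (g * letter a)).+1)%N.
  rewrite -{1}(mulgK (letter a) g) -gl_inv -addn1.
  by apply: leq_trans (len_mul _ _) _; rewrite leq_add2l len_gl_le.
have dE : descends g a = (wl (wv w * u) a \in walls 1 w).
  by rewrite /descends {1}eg crosses_inU // crosses_uniq // eg.
case: ifP; rewrite dE => kw.
  have := exchange_len uw Uu kw; rewrite -eg sw => lt.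
  move: lt lg; case: (len g) => [|n] //= lt lg.
  by apply/eqP; rewrite eqn_leq -ltnS lt.
case: Uu => v _ uE; rewrite -uE in eg kw.
rewrite (@len_uniq _ (rcons w (v, a))) ?size_rcons ?sw //.
  by rewrite walls_rcons mul1g rcons_uniq kw uw.
by exists 1; rewrite ?wv_rcons ?mulg1 -?eg //; exact: inU1.
Qed.

Lemma desc_lt g a : descends g a = (len (g * letter a) < len g)%N.
Proof.
rewrite len_gl; case: (boolP (descends g a)) => [/crosses_len_gt0|_].
  by case: (len g) => //= n _; rewrite ltnS leqnn.
by rewrite ltnNge leqnSn.
Qed.

Lemma desc_len g a : descends g a -> len g = (len (g * letter a)).+1.
Proof. by move=> ga; rewrite len_gl ga prednK // (crosses_len_gt0 ga). Qed.

Lemma desc_inO g w a : inO w -> descends (g * w) a = descends g a.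
Proof. by move=> Ow; rewrite /descends wl_bs // crosses_inU //; exact: inOU. Qed.

Lemma desc_inUl g u a : inU u -> descends (u * g) a = descends g a.
Proof. by move=> Uu; rewrite /descends -tw_wl crosses_inUl. Qed.

Lemma wl_neq p q a b : E a.1 b.1 -> (wl p a == wl q b) = false.
Proof. by move=> Eab; apply/negP => /eqP/(congr1 fst) /= e; rewrite e E_irr in Eab. Qed.

Lemma desc_glr g a b : E a.1 b.1 -> descends (g * letter a) b = descends g b.
Proof.
move=> Eab; have Eba : E b.1 a.1 by rewrite E_sym.
by rewrite /descends wl_gl // crosses_glr wl_neq // addbF.
Qed.

(** A descending edge is the reverse of the last edge of some shortest word. *)
Lemma desc_word g a : descends g a ->
  exists w u, [/\ uniq (walls 1 (rcons w (u, letter_inv a))), g = wv (rcons w (u, letter_inv a)) &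
    size w = (len g).-1].
Proof.
move=> ga; have [w [_ [u _ <-] e] sw] := lenP (g * letter a).
have eg : g = wv (rcons w (u, letter_inv a)) by rewrite wv_rcons /= -e gl_inv mulgK.
exists w, u; split=> //; last by rewrite sw len_gl ga.
apply: (@min_uniq g); last by rewrite size_rcons sw -desc_len.
by exists 1; rewrite ?mulg1 //; exact: inU1.
Qed.

(** Up to [inO], at most one edge with letter [a] descends from the vertex [g U]. In [exchange], a
    non-empty stretch [w2] would end with [letter_inv a], whose label is not adjacent to itself. *)
Lemma desc_same_inO g u a : descends g a -> inU u -> descends (g * u) a -> inO u.
Proof.
move=> /desc_word [w [v [uw -> _]]] Uu; rewrite /descends crosses_inU // crosses_uniq //.
move=> /(exchange uw Uu) [w1 [u1 [w2 [ew lw2 [x Ox e]]]]].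
case/lastP: w2 ew lw2 e => [|w2 y] ew lw2; first by rewrite wv0 ev0 mul1g mulg1 => ->.
move: ew; rewrite -cat_rcons -rcons_cat => /rcons_inj [_ yE].
by move: lw2; rewrite -yE map_rcons /lk all_rcons /= E_irr.
Qed.

(** The flag condition for descending edges: up to [inO] they leave from a common representative of
    the vertex, and distinct ones have adjacent labels, so they span a cube. *)
Lemma desc_clique g u a b : descends g a -> inU u -> descends (g * u) b ->
  inO u /\ (a = b \/ E a.1 b.1).
Proof.
move=> ga Uu gb; have [w [v [uw eg sw]]] := desc_word ga.
have := gb; rewrite /descends crosses_inU // {1}eg crosses_uniq // eg.
move=> /(exchange uw Uu) [w1 [u1 [w2 [ew lw2 [x Ox e]]]]].
case/lastP: w2 ew lw2 e => [|w2 y] ew lw2.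
  rewrite wv0 ev0 mul1g mulg1 => ->; split=> //; left.
  by move: ew; rewrite cats1 => /rcons_inj/(congr1 (fun z => z.2.2))/(can_inj letter_invK).
move: ew; rewrite -cat_rcons -rcons_cat => /rcons_inj [ew yE].
move: lw2; rewrite -yE map_rcons /lk all_rcons /= => /andP[Eba _] e.
split; last by right; rewrite E_sym.
(* It remains to see that [a] descends from [g * u] as well: by [e], the final [letter_inv a]
   cancels in [g * u * letter a], leaving fewer than [len g] letters. *)
apply: (desc_same_inO ga Uu); rewrite desc_lt (len_inUr g Uu).
have -> : g * u * letter a = wv (rcons w1 (u1, letter_inv b)) * x * ev (map snd w2).
  move: e; rewrite wv_rcons -cats1 ev_cat evS ev0 mulg1 /= => e.
  rewrite eg wv_rcons ew wv_cat /=; move: e; rewrite gl_inv.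
  move: (letter a) (wv w2) (ev _) (bs v) (wv (rcons _ _)) => G1 G2 G3 G4 G5 e.
  transitivity (G5 * (G2 * G4 * G1^-1 * u) * G1); first by rewrite !mulgA.
  by rewrite e !mulgA mulgVK.
rewrite (desc_len ga) ltnS.
have -> : len (g * letter a) = (size (rcons w1 (u1, letter_inv b)) + size w2)%N.
  by rewrite -size_cat -ew sw len_gl ga.
apply: leq_trans (len_mul _ _) _; apply: leq_add.
  by rewrite len_inUr ?len_wv_le //; exact: inOU.
by rewrite -(size_map snd) len_ev_le.
Qed.

End Walls.

(** * Fixed vertices *)

Lemma ltn_sum_seq (T : eqType) (r : seq T) (f g : T -> nat) (x : T) :
  {in r, forall i, f i <= g i}%N -> x \in r -> (f x < g x)%N ->
  (\sum_(i <- r) f i < \sum_(i <- r) g i)%N.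
Proof.
move=> fg xr fgx; rewrite !(big_rem x xr) /= -addSn leq_add //.
rewrite big_seq [X in (_ <= X)%N]big_seq leq_sum // => i /mem_rem; exact: fg.
Qed.

Section FixedVertex.
Variables (S : finType) (E : rel S) (U A : groupType) (O : subgroup U).
Variables (phi : U -> U) (bs : U -> A) (gn : S -> A).
Hypothesis E_sym : symmetric E.
Hypothesis E_irr : irreflexive E.
Hypothesis phiO : phi @` (O : set U) = (O : set U).
Hypothesis HA : raag_spec E (O : set U) phi bs gn.

Local Notation gl := (letter gn).
Local Notation inU := (inU bs).
Local Notation wl := (wl E O bs gn).
Local Notation N := (crosses E_sym phiO HA).
Local Notation len := (len HA).
Local Notation wall_stab := (wall_stab E O bs gn).
Implicit Types (g h p q y : A) (a b : S * bool).

Lemma lenV g : len g^-1 = len g.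
Proof.
have le h : (len h^-1 <= len h)%N.
  have [w [u Uu eh] <-] := lenP HA h.
  rewrite eh invgM len_inUl; last exact: (inUV HA).
  elim: w {eh} => [|[v a] w IH]; first by rewrite wv0 invg1 (len_inU HA (inU1 HA)).
  rewrite wvS invgM invgM -gl_inv mulgA len_inUr /=; last by by apply: (inUV HA); exists v.
  apply: leq_trans (len_mul _ _ _) _; rewrite -addn1; apply: leq_add => //.
  exact: len_gl_le.
by apply/eqP; rewrite eqn_leq le -{1}(invgK g) le.
Qed.

Lemma desc_rel p q b :
  descends E_sym phiO HA (p^-1 * q) b = N q (wl q b) (+) N p (wl q b).
Proof.
have := crosses_mul E_sym phiO HA p (p^-1 * q) (wl q b).
by rewrite mulVKg tw_wl /descends => ->; rewrite addbC addbA addbb.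
Qed.

Lemma same_side g h k : wall_stab k.1 (g^-1 * h) -> N h k = N g k.
Proof.
move=> Wgh; rewrite -(mulVKg g h) crosses_mul.
case: (boolP (N (g^-1 * h) _)) => [/(crosses_wall_stab Wgh)|]; last by rewrite addbF.
by rewrite /= E_irr.
Qed.

Lemma same_label a b : b.1 = a.1 -> b = a \/ b = letter_inv a.
Proof. by case: a b => s [] [t []] /= ->; [left|right|right|left]. Qed.

(** * Half-spaces bounded by the translates of a wall *)

Section Sides.
Variables (y : A) (a : S * bool).
Local Notation W i := (wl (i * y) a).

(** True on the half-space of the translated wall [W i] that does not contain [i * y]. *)
Definition side i p := N p (W i) (+) N (i * y) (W i).

Lemma side_mul k i p : side (k * i) (k * p) = side i p.
Proof. by rewrite /side -!(mulgA k) -[wl (k * (i * y)) a]tw_wl crosses_rel. Qed.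

Lemma side_self i : side i (i * y) = false.
Proof. by rewrite /side addbb. Qed.

Lemma side1_self : side 1 y = false.
Proof. by rewrite /side mul1g addbb. Qed.

Lemma side_inU i p u : inU u -> side i (p * u) = side i p.
Proof. by move=> Uu; rewrite /side crosses_inU. Qed.

Lemma side_glr i p b : side i (p * gl b) = side i p (+) (W i == wl p b).
Proof. by rewrite /side crosses_glr addbAC. Qed.

Lemma side_next i : side i (i * y * gl a) = true.
Proof. by rewrite side_glr side_self eqxx. Qed.

(** Edges carry a sign, so an element preserving a wall preserves both of its sides. *)
Lemma side_orient i j : W i = W j -> side i (j * y) = false.
Proof.
by rewrite (wl_eq_same phiO HA) => Wij; rewrite /side (@same_side (i * y)) ?addbb.
Qed.

(** Distinct translates do not cross: the edges of [W i] differ by [wall_stab], which crosses no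
    wall with the label of [W j], so they all lie on one side of [W j]. *)
Lemma side_carrier i j q b : W i != W j -> wl q b = W i -> side j q = side j (i * y).
Proof.
move=> ij eq; rewrite /side; congr (_ (+) _).
have ba : b.1 = a.1 by move: eq => /(congr1 fst).
case: (same_label ba) => ?.
  subst b; move/esym: eq; rewrite (wl_eq_same phiO HA) => ?; exact: same_side.
subst b; move/esym: eq; rewrite (wl_eq_inv phiO HA) => Wij.
rewrite (@same_side (i * y * gl a)) // crosses_glr.
by rewrite eq_sym (negPf ij) addbF.
Qed.

(** One of the four quadrants is empty: a path could leave it only across one of the two walls, but
    by [side_carrier] the edges crossing that wall lie on the other side of the second one. *)
Lemma side_noncrossing i j p : W i != W j ->
  side i p = ~~ side i (j * y) -> side j p = ~~ side j (i * y) -> False.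
Proof.
move=> ij ip jp; have ji : W j != W i by rewrite eq_sym.
have step w q : side i q = ~~ side i (j * y) -> side j q = ~~ side j (i * y) ->
    side i (q * wv bs gn w) = ~~ side i (j * y) /\
    side j (q * wv bs gn w) = ~~ side j (i * y).
  elim: w q => [|x w IH] q iq jq; first by rewrite wv0 mulg1.
  have Ux : inU (bs x.1) by exists x.1.
  rewrite wvS !mulgA; apply: IH; rewrite side_glr (side_inU _ _ Ux).
    case: eqP => [e|_]; last by rewrite addbF.
    have := @side_carrier i j (q * bs x.1) x.2 ij (esym e).
    by rewrite side_inU // jq; case: (side j (i * y)).
  case: eqP => [e|_]; last by rewrite addbF.
  have := @side_carrier j i (q * bs x.1) x.2 ji (esym e).
  by rewrite side_inU // iq; case: (side i (j * y)).
have [w [u Uu e]] := word_ex HA (p^-1 * (j * y)).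
have [+ _] := step w p ip jp.
have -> : p * wv bs gn w = j * y * u^-1.
  by apply: (mulIg u); rewrite mulgVK -mulgA -e mulVKg.
rewrite side_inU; [by case: (side i (j * y))|exact: (inUV HA)].
Qed.

Variable H : subgroup A.
Hypothesis H_fin : forall k, sg_set H k -> exists2 n, (0 < n)%N & inU (y^-1 * k ^+ n * y).

(** The element [i^-1 * j] maps a half-space onto one containing it. Some positive power of it fixes
    the vertex [y U], so the increasing chain of images must be constant. *)
Lemma side_nested i j : sg_set H i -> sg_set H j ->
  (forall p, ~~ side i p -> ~~ side j p) -> W i = W j.
Proof.
move=> Hi Hj ij; pose k := i^-1 * j.
have Hk : sg_set H k by apply: sgM => //; exact: sgV.
have k1 p : ~~ side 1 p -> ~~ side k p.
  by rewrite -(side_mul i 1) -(side_mul i k) mulg1 mulVKg; exact: ij.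
have km m p : ~~ side (k ^+ m) p -> ~~ side (k ^+ m.+1) p.
  rewrite -(mulVKg (k ^+ m) p) expgSr side_mul -[X in side X _]mulg1 side_mul.
  exact: k1.
have k1n n p : (0 < n)%N -> ~~ side k p -> ~~ side (k ^+ n) p.
  by case: n => // n _ kp; elim: n => // n IH; exact: km.
have [n n0 Un] := H_fin Hk.
have ky1 : side 1 (k ^+ n * y) = false.
  have -> : k ^+ n * y = y * (y^-1 * k ^+ n * y) by rewrite -mulgA mulVKg.
  by rewrite (side_inU _ _ Un) side1_self.
have Wn : W 1 = W (k ^+ n).
  apply/eqP; have := side_glr 1 (k ^+ n * y) a; rewrite ky1 /= => <-.
  apply: contraT => /k1 /(k1n _ _ n0); by rewrite side_next.
have kn p : side (k ^+ n) p = side 1 p.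
  rewrite /side -Wn; congr (_ (+) _).
  by move: ky1; rewrite /side; case: (N _ (W 1)); case: (N _ (W 1)).
have y1 : ~~ side k y by apply: k1; rewrite side1_self.
have W1k : W k = W 1.
  apply/eqP; have := side_glr k y a; rewrite (negPf y1) /= mul1g => <-.
  apply: contraT => /(k1n _ _ n0); rewrite kn.
  by have := side_next 1; rewrite mul1g => ->.
have ik : i * k = j by rewrite mulVKg.
by have := congr1 (tw i) W1k; rewrite !tw_wl mul1g mulgA ik => ->.
Qed.

(** In a mixed case the empty quadrant of [side_noncrossing] would nest the half-spaces, which
    [side_nested] excludes. *)
Lemma side_sym i j : sg_set H i -> sg_set H j -> W i != W j ->
  side i (j * y) = side j (i * y).
Proof.
move=> Hi Hj ij; have ji : W j != W i by rewrite eq_sym.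
case Eij: (side i (j * y)); case Eji: (side j (i * y)) => //; exfalso.
  apply: (elimN eqP ij); apply: side_nested => // p ip; apply/negP => jp.
  by apply: (side_noncrossing (p := p) ij); rewrite ?Eij ?Eji ?jp ?(negPf ip).
apply: (elimN eqP ji); apply: side_nested => // p jp; apply/negP => ip.
by apply: (side_noncrossing (p := p) ij); rewrite ?Eij ?Eji ?ip ?(negPf jp).
Qed.

(* The translates of a wall that separates [y] from a point of its orbit all
   face each other. *)
Lemma side_facing h k : sg_set H h -> sg_set H k -> side 1 (h * y) ->
  W k != W 1 -> side 1 (k * y).
Proof.
move=> Hh Hk sh kW; apply: contraT => sk.
have hW : W h != W 1.
  by apply: contraTneq sh => /esym /side_orient ->.
have H1 : sg_set H 1 by exact: sg1.
have kW' : W 1 != W k by rewrite eq_sym.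
have hW' : W 1 != W h by rewrite eq_sym.
have sk' := side_sym H1 Hk kW'; have sh' := side_sym H1 Hh hW'.
(* Suppose that [k * y] is on the side of [y]. The empty quadrants of the pairs [(1, h)] and
   [(1, k)] then nest the half-spaces of [h] and [k], so [W h = W k]; but [side_carrier] puts
   [h * y] and [k * y] on the same side of [W 1]. *)
suff hk : W h = W k.
  have := @side_carrier h 1 (k * y) a hW (esym hk).
  by rewrite sh (negPf sk).
apply: side_nested => // p hp; apply/negP => kp.
have p1 : side 1 p.
  apply: contraT => p1; exfalso; apply: (side_noncrossing (p := p) hW').
    by rewrite sh (negPf p1).
  by rewrite -sh' sh (negPf hp).
by apply: (side_noncrossing (p := p) kW'); rewrite -?sk' (negPf sk) ?p1 ?kp.
Qed.

(** Here [y^-1 * k * y] is in [wall_stab]; conjugation by the letter changes only its factor in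
    [inO], which does not affect [len]. *)
Lemma len_same_wall k : W k = W 1 ->
  len ((y * gl a)^-1 * (k * (y * gl a))) = len (y^-1 * (k * y)).
Proof.
move=> /esym; rewrite (wl_eq_same phiO HA) mul1g => -[w [l [Ow al e]]].
have -> : (y * gl a)^-1 * (k * (y * gl a)) = (y^-1 * (k * y)) ^ gl a.
  by rewrite conjgE invgM !mulgA.
rewrite e conjMg; have -> : ev gn l ^ gl a = ev gn l.
  exact/commute_conjg/commute_sym/(gl_ev_commute HA).
have Uw := inOU Ow; have Uw' := inOU (inO_gl phiO HA a Ow).
by rewrite (len_inUl _ _ Uw) (len_inUl _ _ Uw').
Qed.

(** Both walls separate [y] from [k * y], so moving first one end and then the other across its own
    wall shortens the distance each time. *)
Lemma len_other_wall k : sg_set H k -> W k != W 1 -> side 1 (k * y) ->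
  (len ((y * gl a)^-1 * (k * (y * gl a))) < len (y^-1 * (k * y)))%N.
Proof.
move=> Hk kW sk; have H1 : sg_set H 1 by exact: sg1.
have kW' : W 1 != W k by rewrite eq_sym.
have d1 : descends E_sym phiO HA (y^-1 * (k * y)) a.
  rewrite desc_rel; have := side_sym H1 Hk kW'; rewrite sk /side mul1g.
  by rewrite [X in _ = X]addbC => <-.
have d2 : descends E_sym phiO HA ((k * y * gl a)^-1 * y) a.
  have := side_glr 1 (k * y) a; rewrite sk eq_sym (negPf kW) /side mul1g desc_rel.
  by rewrite addbC => ->.
rewrite (desc_len E_irr d1) ltnS.
have -> : len ((y * gl a)^-1 * (k * (y * gl a))) = len ((k * y * gl a)^-1 * y * gl a).
  by rewrite -[LHS]lenV; congr len; rewrite !invgM !invgK !mulgA.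
have -> : len (y^-1 * (k * y) * gl a) = len ((k * y * gl a)^-1 * y).
  by rewrite -[LHS]lenV; congr len; rewrite !invgM !invgK !mulgA.
by move: d2; rewrite (desc_lt E_sym E_irr phiO HA) => /ltnW.
Qed.

End Sides.

(** Pigeonhole: two of the first [(size L).+1] powers of [k] lie in the same coset of the stabiliser
    of [y U]. *)
Lemma orbit_power (H : subgroup A) y (L : seq A) k :
  (forall h, sg_set H h -> exists2 i, i \in L & inU (y^-1 * (i^-1 * h) * y)) ->
  sg_set H k -> exists2 n, (0 < n)%N & inU (y^-1 * k ^+ n * y).
Proof.
move=> HL Hk.
have Hkn n : sg_set H (k ^+ n).
  by elim: n => [|n IH]; [rewrite expg0; exact: sg1|rewrite expgS; exact: sgM].
have /choice[f fP] n : exists i, i \in L /\ inU (y^-1 * (i^-1 * k ^+ n) * y).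
  by have [i iL iU] := HL _ (Hkn n); exists i.
have : ~~ uniq (mkseq f (size L).+1).
  apply/negP => /uniq_leq_size le; have := le L; rewrite size_mkseq ltnn => h.
  by apply: notF; apply: h => _ /mapP[n _ ->]; case: (fP n).
move=> /(uniqPn 1) [i [j [ij jL]]]; rewrite size_mkseq in jL.
rewrite !nth_mkseq ?(ltn_trans ij) // => fij.
exists (j - i)%N; first by rewrite subn_gt0.
have [_ iU] := fP i; have [_ jU] := fP j.
have -> : y^-1 * k ^+ (j - i) * y =
    (y^-1 * ((f i)^-1 * k ^+ i) * y)^-1 * (y^-1 * ((f j)^-1 * k ^+ j) * y).
  have -> : k ^+ j = k ^+ i * k ^+ (j - i) by rewrite -expgnDr subnKC // ltnW.
  rewrite fij !invgM !invgK; move: (k ^+ i) (k ^+ (j - i)) (f j) => ki kd F.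
  by rewrite !mulgA !mulgK mulgVK.
by exact: (inUM HA (inUV HA iU) jU).
Qed.

(** [L] represents the cosets of the stabiliser of [y U] in [H], which makes the sum of distances
    finite; the same list serves for all vertices met in the descent. *)
Lemma fixed_vertex_bounded (H : subgroup A) n y (L : seq A) :
  {in L, forall i, sg_set H i} ->
  (forall h, sg_set H h -> exists2 i, i \in L & inU (y^-1 * (i^-1 * h) * y)) ->
  (\sum_(i <- L) len (y^-1 * (i * y)) <= n)%N ->
  exists x, forall h, sg_set H h -> inU (x^-1 * h * x).
Proof.
elim/ltn_ind: n y => n IH y LH HL Ln.
have [L0|] := pselect (forall i, i \in L -> len (y^-1 * (i * y)) = 0%N).
  exists y => h /HL [i iL iU].
  have -> : y^-1 * h * y = (y^-1 * (i * y)) * (y^-1 * (i^-1 * h) * y).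
    by rewrite !mulgA mulgK mulgK.
  by apply: (inUM HA) => //; exact: (len0 (L0 _ iL)).
move=> /existsNP [i /not_implyP [iL /eqP li]].
have [w [u Uu e] sw] := lenP HA (y^-1 * (i * y)).
have uw : uniq (walls E O bs gn 1 w).
  by apply: (min_uniq E_sym E_irr phiO _ sw); exists u.
case: w e sw uw => [|[v a] w] e sw uw; first by rewrite -sw in li.
have Uv : inU (bs v) by exists v.
(* Another representative of the same vertex, from which the first edge of the path towards [i * y]
   has the bare letter [a]. *)
pose z := y * bs v.
have lz k : len (z^-1 * (k * z)) = len (y^-1 * (k * y)).
  have -> : z^-1 * (k * z) = (bs v)^-1 * (y^-1 * (k * y)) * bs v.
    by rewrite /z invgM !mulgA.
  by rewrite (len_inUr _ _ Uv) (len_inUl _ _ (inUV HA Uv)).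
have zU k : inU (y^-1 * k * y) -> inU (z^-1 * k * z).
  have -> : z^-1 * k * z = (bs v)^-1 * (y^-1 * k * y) * bs v.
    by rewrite /z invgM !mulgA.
  by move=> Uk; exact: (inUM HA (inUM HA (inUV HA Uv) Uk) Uv).
have zL h : sg_set H h -> exists2 j, j \in L & inU (z^-1 * (j^-1 * h) * z).
  by move=> /HL [j jL jU]; exists j => //; exact: zU.
have zfin := orbit_power zL.
have zi : side z a 1 (i * z).
  have ez k : N (i * z) k = N (i * y) k by rewrite /z mulgA (crosses_inU _ _ _ _ _ Uv).
  have ey k : N z k = N y k by rewrite (crosses_inU _ _ _ _ _ Uv).
  rewrite /side mul1g ez ey.
  have := crosses_rel E_sym phiO HA y (y^-1 * (i * y)) 1 (wl (bs v) a).
  rewrite mulVKg mulg1 tw_wl => ->; rewrite crosses1 addbF.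
  by rewrite e crosses_inU // crosses_uniq //= mul1g inE eqxx.
have Hi : sg_set H i by exact: LH.
have [iW kW] : wl (i * z) a != wl (1 * z) a /\
    forall k, sg_set H k -> wl (k * z) a != wl (1 * z) a -> side z a 1 (k * z).
  split; last by move=> k Hk; exact: (side_facing zfin Hi).
  by apply: contraTneq zi => /esym /side_orient ->.
have dec k : sg_set H k -> wl (k * z) a != wl (1 * z) a ->
    (len ((z * gl a)^-1 * (k * (z * gl a))) < len (y^-1 * (k * y)))%N.
  by move=> Hk kW'; rewrite -(lz k); apply: (len_other_wall zfin) => //; exact: kW.
have same k : wl (k * z) a = wl (1 * z) a ->
    len ((z * gl a)^-1 * (k * (z * gl a))) = len (y^-1 * (k * y)).
  by move=> /len_same_wall ->.
have lt : (\sum_(k <- L) len ((z * gl a)^-1 * (k * (z * gl a))) < n)%N.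
  apply: leq_trans Ln; apply: (ltn_sum_seq _ iL); last exact: dec.
  move=> k /LH Hk; have [/same ->//|/(dec _ Hk)/ltnW//] := eqVneq (wl (k * z) a) (wl (1 * z) a).
apply: (IH _ lt (z * gl a) LH _ (leqnn _)) => h Hh.
(* [L] still works at the new vertex: an element of [H] fixing the old vertex preserves the wall,
   since otherwise [kW] would separate [z] from itself, and then [len_same_wall] shows that it fixes
   the new vertex. *)
have [j jL jU] := zL h Hh; exists j => //.
have Hk : sg_set H (j^-1 * h) by apply: sgM => //; apply: sgV; exact: LH.
rewrite -mulgA; apply: (@len0 _ _ _ _ _ _ _ _ HA); rewrite same.
  by rewrite -lz mulgA len_inU.
apply/eqP; apply: contraT => /(kW _ Hk).
have -> : j^-1 * h * z = z * (z^-1 * (j^-1 * h) * z) by rewrite !mulgA mulgV mul1g.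
by rewrite side_inU // side1_self.
Qed.

Lemma fixed_vertex (H : subgroup A) g :
  finite_index H ((H : set A) `&` conjs g inU) ->
  exists x, (H : set A) `<=` conjs x inU.
Proof.
move=> /finite_seqP [s sE].
have /choice[f fP] K : exists h, K \in s ->
    sg_set H h /\ lcoset h ((H : set A) `&` conjs g inU) = K.
  case: (boolP (K \in s)) => [Ks|_]; last by exists 1.
  have : [set` s] K by [].
  by rewrite -sE => -[h Hh hK]; exists h.
have [||x xP] := @fixed_vertex_bounded H _ g (map f s) _ _ (leqnn _).
- by move=> _ /mapP[K /fP [HK _] ->].
- move=> h Hh; set K := lcoset h ((H : set A) `&` conjs g inU).
  have Ks : K \in s.
    suff : [set` s] K by [].
    by rewrite -sE; exists h.
  have [Hf fK] := fP _ Ks; exists (f K); first exact: map_f.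
  have Kh : K h.
    exists 1; rewrite ?mulg1 //; split; first exact: sg1.
    by exists 1; [exact: (inU1 HA)|rewrite mulg1 mulgV].
  have : lcoset (f K) ((H : set A) `&` conjs g inU) h by rewrite fK.
  by case=> _ [_ [u Uu <-]] <-; rewrite mulKg !mulgA mulVg mul1g mulgVK.
exists x => h /xP Uh; exists (x^-1 * h * x) => //.
by rewrite !mulgA mulgV mul1g mulgK.
Qed.

End FixedVertex.

(** * Cubes and their top corners *)

Section Cubes.
Variables (S : finType) (E : rel S) (U A : groupType) (O : subgroup U).
Variables (phi : U -> U) (bs : U -> A) (gn : S -> A).
Hypothesis E_sym : symmetric E.
Hypothesis E_irr : irreflexive E.
Hypothesis phiO : phi @` (O : set U) = (O : set U).
Hypothesis HA : raag_spec E (O : set U) phi bs gn.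

Local Notation gl := (letter gn).
Local Notation inU := (inU bs).
Local Notation inO := (inO O bs).
Local Notation wl := (wl E O bs gn).
Local Notation N := (crosses E_sym phiO HA).
Local Notation len := (len HA).
Local Notation desc := (descends E_sym phiO HA).
Implicit Types (g h p q y : A) (a b : S * bool) (s t : S) (B C T : {set S}).

Local Notation disj B C := (fintype.disjoint (mem B) (mem C)).

(** The exponent sum of [s], constant on the cosets of [U]; it serves as a coordinate on the
    vertices that tells the corners of a cube apart. *)
Lemma exponent_ex s : exists f : A -> int,
  [/\ forall g h, f (g * h) = (f g + f h)%R, forall u, f (bs u) = 0%R &
      forall t, f (gn t) = (s == t)%:R%R].
Proof.
have [|||f [fM fb fg]] := @spec_lift _ _ _ _ _ _ _ _ HA (Algebra.to_multiplicative int)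
  (fun=> 1) (fun t => ((s == t)%:R%R : int)).
- by move=> u v; rewrite mulg1.
- by move=> t w _; rewrite mulg1 mul1g.
- by move=> t t' _; exact: Algebra.commuteT.
by exists f.
Qed.

Definition exponent s : A -> int := sval (cid (exponent_ex s)).

Lemma exponentM s g h : exponent s (g * h) = (exponent s g + exponent s h)%R.
Proof. by rewrite /exponent; case: cid => ? []. Qed.

Lemma exponent_inU s u : inU u -> exponent s u = 0%R.
Proof. by move=> [v _ <-]; rewrite /exponent; case: cid => ? []. Qed.

Lemma exponent_gen s t : exponent s (gn t) = (s == t)%:R%R.
Proof. by rewrite /exponent; case: cid => ? []. Qed.

Definition gp B : A := \prod_(t in B) gn t.

Lemma gpE B : gp B = \prod_(t <- enum B) gn t.
Proof. by rewrite /gp -big_filter; congr bigop; rewrite /index_enum unlock enumT; exact: eq_filter. Qed.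

Lemma gp0 : gp finset.set0 = 1. Proof. by rewrite gpE enum_set0 big_nil. Qed.

Lemma gp1 t : gp [set t]%SET = gn t. Proof. by rewrite gpE enum_set1 big_seq1. Qed.

Lemma cliqueP T s t : is_clique E T -> s \in T -> t \in T -> s != t -> E s t.
Proof. by move=> /'forall_implyP cT /cT /'forall_implyP tT /tT /implyP; apply. Qed.

Lemma clique_sub T T' : T' \subset T -> is_clique E T -> is_clique E T'.
Proof.
move=> /fintype.subsetP sT cT; apply/'forall_implyP => s /sT sT1.
by apply/'forall_implyP => t /sT tT; apply/implyP; exact: (cliqueP cT).
Qed.

Lemma gn_commute T s t : is_clique E T -> s \in T -> t \in T -> commute (gn s) (gn t).
Proof.
move=> cT sT tT; have [->|st] := eqVneq s t; first exact: commute_refl.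
exact/(spec_commute HA)/(cliqueP cT).
Qed.

Lemma gpU T B C : is_clique E T -> B \subset T -> C \subset T -> disj B C ->
  gp (B :|: C) = gp B * gp C.
Proof.
move=> cT /fintype.subsetP BT /fintype.subsetP CT dBC; rewrite /gp big_mkcond /=.
rewrite [X in _ = X * _]big_mkcond [X in _ = _ * X]big_mkcond /=.
rewrite -prodgM_commute => [|i j _ _].
  apply: eq_bigr => i _; rewrite inE; case: (boolP (i \in B)) => [iB|_] /=.
    by rewrite (disjointFr dBC iB) mulg1.
  by rewrite mul1g.
case: ifPn => [/BT iT|_]; last exact/commute_sym/commute1.
by case: ifPn => [/CT jT|_]; [exact: gn_commute jT|exact: commute1].
Qed.

Lemma gpD1 T B t : is_clique E T -> B \subset T -> t \in B -> gp B = gp (B :\ t) * gn t.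
Proof.
move=> cT BT tB; rewrite -gp1 -(@gpU T) //.
- by rewrite finset.setUC finset.setD1K.
- by apply: fintype.subset_trans BT; exact: finset.subD1set.
- by rewrite finset.sub1set; move/fintype.subsetP: BT; apply.
- by rewrite disjoint_sym disjoints1 !inE eqxx.
Qed.

Lemma exponent_gp s B : exponent s (gp B) = (s \in B)%:R%R.
Proof.
have e1 : exponent s 1 = 0%R by apply: exponent_inU; exact: (inU1 HA).
rewrite gpE -mem_enum; have := enum_uniq B.
elim: (enum B) => [|t r IH] /=; first by rewrite big_nil e1.
move=> /andP[tr ur]; rewrite big_cons exponentM exponent_gen IH // inE.
by have [->|] := eqVneq s t; rewrite ?(negPf tr) /= ?GRing.addr0 ?GRing.add0r.
Qed.

Lemma inO_gp g B : inO g -> inO (g ^ gp B).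
Proof.
rewrite /gp; move: g; apply: (@big_ind _ (fun h => forall g, inO g -> inO (g ^ h))).
- by move=> g; rewrite conjg1.
- by move=> x y hx hy g /hx /hy; rewrite conjgM.
- by move=> t _ g; exact: (inO_gl phiO HA (t, true)).
Qed.

Lemma inO_gpV g B : inO g -> inO (gp B * g * (gp B)^-1).
Proof.
move=> Og; rewrite -mulgA -{1}(invgK (gp B)) -conjgE.
have -> : gp B = ev gn [seq (t, true) | t <- enum B].
  by rewrite gpE /ev big_map.
by rewrite (evV gn); exact: (inO_ev phiO HA).
Qed.

(** Corners with equal coordinates coincide. By [cube_cornersP] this is equivalent to equality of
    the vertex sets, and it is the form preserved under passage to faces. *)
Definition same_cube T g g' := forall C, C \subset T -> inU ((g * gp C)^-1 * (g' * gp C)).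

Definition cube_corners g T : set (set A) :=
  [set lcoset (g * gp B) inU | B in [set B : {set S} | B \subset T]].

Lemma lcoset_inU g h : lcoset g inU = lcoset h inU <-> inU (g^-1 * h).
Proof.
split=> [e|Ugh].
  have : lcoset h inU h by exists 1; rewrite ?mulg1 //; exact: (inU1 HA).
  by rewrite -e => -[u Uu <-]; rewrite mulKg.
apply/seteqP; split=> [_ [u Uu <-]|_ [u Uu <-]].
  exists (h^-1 * g * u); last by rewrite !mulgA mulgV mul1g.
  by apply: (inUM HA) => //; move: (inUV HA Ugh); rewrite invgM invgK.
by exists (g^-1 * h * u); [exact: (inUM HA)|rewrite !mulgA mulgV mul1g].
Qed.

Lemma exponent_coset s g h : inU (g^-1 * h) -> exponent s h = exponent s g.
Proof.
by move=> /(exponent_inU s) e; rewrite -(mulVKg g h) exponentM e GRing.addr0.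
Qed.

Lemma same_cube_sym T g g' : same_cube T g g' -> same_cube T g' g.
Proof. by move=> h C /h /(inUV HA); rewrite invgM invgK. Qed.

Lemma same_cube_trans T g1 g2 g3 : same_cube T g1 g2 -> same_cube T g2 g3 -> same_cube T g1 g3.
Proof.
move=> h1 h2 C CT; have := inUM HA (h1 C CT) (h2 C CT).
by rewrite mulgA -(mulgA _ (g2 * _)) mulgV mulg1.
Qed.

Lemma same_cube_refl T g : same_cube T g g.
Proof. by move=> C _; rewrite mulVg; exact: (inU1 HA). Qed.

Lemma same_cube_inO T g x : inO x -> same_cube T g (g * x).
Proof.
move=> Ox C _; have := inOU (inO_gp C Ox).
by rewrite conjgE invgM !mulgA mulgVK.
Qed.

Lemma same_cube_mul T k g g' : same_cube T g g' -> same_cube T (k * g) (k * g').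
Proof.
move=> h C CT; rewrite -!(mulgA k) (invgM k) -(mulgA (_ * _)^-1) mulKg.
exact: h.
Qed.

Lemma same_cube0 g g' : same_cube finset.set0 g g' <-> inU (g^-1 * g').
Proof.
split=> [/(_ finset.set0 (subxx _))|Ug C]; first by rewrite gp0 !mulg1.
by rewrite finset.subset0 => /eqP ->; rewrite gp0 !mulg1.
Qed.

Lemma same_cube_face T g g' B T' : is_clique E T -> B \subset T -> T' \subset T ->
  disj B T' -> same_cube T g g' -> same_cube T' (g * gp B) (g' * gp B).
Proof.
move=> cT BT TT dB h C CT'; rewrite -!mulgA -(@gpU T) //; first last.
- by rewrite (disjointWr CT').
- exact: fintype.subset_trans TT.
by apply: h; rewrite finset.subUset BT (fintype.subset_trans CT' TT).
Qed.

(** Each base corner is a corner of the other cube, so the exponent vectors of [g] and [g'] differ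
    by a 0-1 vector in both directions and are equal; hence coinciding corners have the same index
    set. *)
Lemma cube_cornersP g T g' T' :
  cube_corners g T = cube_corners g' T' <-> T = T' /\ same_cube T g g'.
Proof.
split=> [e|[<- h]].
  have sub h h' X X' : cube_corners h X = cube_corners h' X' -> forall C, C \subset X ->
      exists2 C' : {set S}, C' \subset X' & inU ((h * gp C)^-1 * (h' * gp C')).
    move=> e' C CX; have : cube_corners h X (lcoset (h * gp C) inU) by exists C.
    by rewrite e' => -[C' C'X /esym /lcoset_inU]; exists C'.
  have [B BT gB] := sub _ _ _ _ e _ (finset.sub0set _).
  have [B' B'T gB'] := sub _ _ _ _ (esym e) _ (finset.sub0set _).
  have eg s : exponent s g = exponent s g'.
    have := exponent_coset s gB; have := exponent_coset s gB'.
    rewrite !gp0 !mulg1 !exponentM !exponent_gp => <- /eqP.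
    rewrite -GRing.addrA -GRing.subr_eq0 GRing.addrAC GRing.subrr GRing.add0r.
    by case: (s \in B); case: (s \in B') => /=; rewrite ?GRing.mulr1n ?GRing.mulr0n ?GRing.addr0.
  have sub' h h' X X' : cube_corners h X = cube_corners h' X' ->
      (forall s, exponent s h = exponent s h') -> X \subset X' /\ same_cube X h h'.
    move=> e' eh; have C1 C : C \subset X ->
        C \subset X' /\ inU ((h * gp C)^-1 * (h' * gp C)).
      move=> /(sub _ _ _ _ e') [C' C'X hC]; suff eC : C = C' by subst C'; split.
      apply/finset.setP => s; have := exponent_coset s hC.
      rewrite !exponentM !exponent_gp eh => /GRing.addrI.
      by case: (s \in C); case: (s \in C').
    by split=> [|C /C1[]//]; case: (C1 X (subxx _)).
  have [TT h] := sub' _ _ _ _ e eg.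
  have [T'T _] := sub' _ _ _ _ (esym e) (fun s => esym (eg s)).
  by split=> //; apply/eqP; rewrite finset.eqEsubset TT.
apply/seteqP; split=> _ [C CT <-]; exists C => //; apply/lcoset_inU; last exact: h.
exact: (same_cube_sym h).
Qed.

Lemma desc_inv g a : desc (g * gl a) (letter_inv a) = ~~ desc g a.
Proof. by rewrite /descends wl_inv crosses_glr eqxx addbT. Qed.

(** Parallel edges of a cube descend together. *)
Lemma desc_gp T g B a : is_clique E T -> B \subset T -> a.1 \in T -> a.1 \notin B ->
  desc (g * gp B) a = desc g a.
Proof.
move=> cT /fintype.subsetP BT aT aB; rewrite gpE.
have : {subset enum B <= T} by move=> s; rewrite mem_enum; exact: BT.
have : a.1 \notin enum B by rewrite mem_enum.
elim: (enum B) g => [|s r IH] g; first by rewrite big_nil mulg1.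
rewrite inE negb_or => /andP[as_ ar] sT; rewrite big_cons mulgA IH //; last first.
  by move=> x xr; apply: sT; rewrite inE xr orbT.
apply: (@desc_glr _ _ _ _ _ _ _ _ E_sym E_irr phiO HA g (s, true)).
by apply: (cliqueP cT) => //=; [apply: sT; rewrite inE eqxx|rewrite eq_sym].
Qed.

(* The directions of [T] in which the cube on [T] at [g] leads away from the
   vertex [U], and its corner farthest from [U]. *)
Definition tops g T := [set t in T | ~~ desc g (t, true)]%SET.
Definition top_corner g T := g * gp (tops g T).

Lemma tops_sub g T : tops g T \subset T.
Proof. by apply/fintype.subsetP => t; rewrite inE => /andP[]. Qed.

Lemma tops0 g : tops g finset.set0 = finset.set0.
Proof. by apply/eqP; rewrite -finset.subset0 tops_sub. Qed.

Lemma desc_top g T t : is_clique E T -> t \in T ->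
  desc (top_corner g T) (t, t \notin tops g T).
Proof.
move=> cT tT; have sT := tops_sub g T; rewrite /top_corner.
case: (boolP (t \in tops g T)) => tt /=; last first.
  rewrite (@desc_gp T) //=.
  by move: tt; rewrite inE tT /= negbK.
rewrite (gpD1 cT sT tt) mulgA (@desc_inv _ (t, true)) (@desc_gp T) //=.
- by move: tt; rewrite inE => /andP[].
- by apply: fintype.subset_trans sT; exact: finset.subD1set.
- by rewrite !inE eqxx.
Qed.

Lemma desc_both g t : desc g (t, true) -> desc g (t, false) -> False.
Proof.
move=> d1 d2; have U1 := inU1 HA.
have := desc_clique E_irr d1 U1; rewrite mulg1 => /(_ _ d2) [_ [//|]].
by rewrite /= E_irr.
Qed.

Lemma desc_top_sign g T t (b : bool) : is_clique E T -> t \in T -> desc (top_corner g T) (t, b) ->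
  b = (t \notin tops g T).
Proof.
move=> cT tT; have := @desc_top g T t cT tT.
by case: b; case: (t \notin _) => // d1 d2; exfalso; exact: (@desc_both (top_corner g T) t).
Qed.

Lemma desc_same_cube T g g' t : same_cube T g g' -> t \in T ->
  desc g (t, true) = desc g' (t, true).
Proof.
move=> h tT; have h0 := h _ (finset.sub0set T).
have h1 : inU ((g * gn t)^-1 * (g' * gn t)) by rewrite -gp1; apply: h; rewrite finset.sub1set.
rewrite gp0 !mulg1 in h0.
rewrite !(desc_lt E_sym E_irr phiO HA) /letter /=.
have -> : len g' = len g by rewrite -(mulVKg g g') (len_inUr _ _ h0).
by have -> : len (g' * gn t) = len (g * gn t)
  by rewrite -(mulVKg (g * gn t) (g' * gn t)) (len_inUr _ _ h1).
Qed.

Lemma tops_same_cube T g g' : same_cube T g g' -> tops g T = tops g' T.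
Proof.
move=> h; apply/finset.setP => t; rewrite !inE; case: (boolP (t \in T)) => //= tT.
by rewrite (desc_same_cube h tT).
Qed.

Lemma top_same_cube T g g' : same_cube T g g' -> inU ((top_corner g T)^-1 * top_corner g' T).
Proof. by move=> h; rewrite /top_corner -(tops_same_cube h); apply: h; exact: tops_sub. Qed.

Lemma tops_face T g B T' : is_clique E T -> B \subset T -> T' \subset T ->
  disj B T' -> tops (g * gp B) T' = tops g T :&: T'.
Proof.
move=> cT BT T'T dB; apply/finset.setP => t; rewrite !inE.
case: (boolP (t \in T')) => tT' /=; last by rewrite andbF.
have tT := fintype.subsetP T'T _ tT'.
by rewrite (@desc_gp T) ?tT ?andbT //= (disjointFl dB tT').
Qed.

(** The left-hand cube is the face on [T'] through the top corner. *)
Lemma top_face T g T' : is_clique E T -> T' \subset T ->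
  top_corner (g * gp (tops g T :\: T')) T' = top_corner g T.
Proof.
move=> cT T'T; rewrite /top_corner (@tops_face T) //; first last.
- by rewrite -finset.setI_eq0 finset.setDE -finset.setIA [~: _ :&: _]finset.setIC finset.setICr finset.setI0.
- by apply: fintype.subset_trans (tops_sub g T); exact: finset.subsetDl.
rewrite -mulgA -(@gpU T) //.
- by rewrite finset.setUC finset.setID.
- by apply: fintype.subset_trans (tops_sub g T); exact: finset.subsetDl.
- by apply: fintype.subset_trans T'T; exact: finset.subsetIr.
- by rewrite -finset.setI_eq0 finset.setDE -finset.setIA [~: _ :&: _]finset.setIC -finset.setIA finset.setICr !finset.setI0.
Qed.

(* The bottom face of the cube in direction [t], towards the vertex [U]. *)
Lemma len_top_face g T t : is_clique E T -> t \in T ->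
  (len (top_corner (g * gp ([set t]%SET :\: tops g T)) (T :\ t))).+1 = len (top_corner g T).
Proof.
move=> cT tT; set B := (_ :\: _).
have BT : B \subset T.
  by apply: fintype.subset_trans (finset.subsetDl _ _) _; rewrite finset.sub1set.
have dB : disj B (T :\ t).
  rewrite fintype.disjoint_subset; apply/fintype.subsetP => s.
  by rewrite !inE => /andP[_ /eqP->]; rewrite eqxx.
rewrite (desc_len E_irr (desc_top g cT tT)); congr (len _).+1.
rewrite /top_corner (@tops_face T) //; last exact: finset.subD1set.
have sT := tops_sub g T.
have -> : tops g T :&: (T :\ t) = tops g T :\ t.
  apply/finset.setP => s; rewrite !inE; by case: (s \in T); case: (s == t); case: desc.
case: (boolP (t \in tops g T)) => tt; rewrite /letter /=.
  have -> : B = finset.set0.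
    apply/finset.setP => s; rewrite finset.in_setD finset.in_set1 finset.in_set0.
    by case: eqP => [->|_]; rewrite ?tt ?andbF.
  by rewrite gp0 mulg1 [in RHS](gpD1 cT sT tt) mulgA mulgK.
have -> : B = [set t]%SET.
  apply/finset.setP => s; rewrite finset.in_setD finset.in_set1.
  by case: eqP => [->|_]; rewrite ?andbF ?andbT ?tt.
have -> : tops g T :\ t = tops g T.
  apply/finset.setP => s; rewrite finset.in_setD1.
  by case: eqP => [->|//]; rewrite (negPf tt).
rewrite gp1 -!mulgA; congr (_ * _); apply: commute_prod => s ss.
exact: (gn_commute cT tT (fintype.subsetP sT _ ss)).
Qed.

(** All edges descending from the top vertex have their labels in [T]; [u] runs over [U] because
    edges leave a vertex from every representative of its coset. *)
Definition full g T := forall u a, inU u -> desc (top_corner g T * u) a -> a.1 \in T.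

(** The top vertex determines [T] as the labels of its descending edges and [tops] by their signs.
    The two representatives of the top differ by some [v] in [U], which lies in [inO] as soon as
    there is a descending edge; otherwise the cube is a vertex. *)
Lemma full_unique g T g' T' : is_clique E T -> is_clique E T' -> full g T -> full g' T' ->
  inU ((top_corner g T)^-1 * top_corner g' T') ->
  [/\ T = T', tops g T = tops g' T' & same_cube T g g'].
Proof.
move=> cT cT' fT fT' Uv; set v := _^-1 * _ in Uv.
have ev : top_corner g' T' = top_corner g T * v by rewrite /v mulVKg.
have eT : T = T'.
  apply/finset.setP => t; apply/idP/idP => tT.
    have := desc_top g cT tT; rewrite -[top_corner g T](mulgK v) -ev.
    by move=> /(fT' _ _ (inUV HA Uv)).
  have := desc_top g' cT' tT; rewrite ev => /(fT _ _ Uv); exact.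
subst T'.
have signs t : t \in T -> inO v /\ (t \notin tops g T) = (t \notin tops g' T).
  move=> tT; have d := desc_top g cT tT; have d' := desc_top g' cT tT.
  rewrite ev in d'; have [Ov [[->//]|]] := desc_clique E_irr d Uv d'.
  by rewrite /= E_irr.
have et : tops g T = tops g' T.
  apply/finset.setP => t; case: (boolP (t \in T)) => tT.
    by apply: negb_inj; case: (signs t tT).
  by rewrite !inE (negPf tT).
split=> //; have [T0|[t tT]] := set_0Vmem T.
  have t0 h : tops h T = finset.set0.
    by rewrite T0 tops0.
  by move: Uv; rewrite /v /top_corner !t0 gp0 !mulg1 T0 => /same_cube0.
have [Ov _] := signs t tT.
have -> : g' = g * (gp (tops g T) * v * (gp (tops g T))^-1).
  by move: ev; rewrite /top_corner -et !mulgA => <-; rewrite mulgK.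
exact/same_cube_inO/inO_gpV.
Qed.

Lemma full_ex g T : is_clique E T -> exists g' T',
  [/\ is_clique E T', full g' T', T \subset T' & same_cube T g (g' * gp (tops g' T' :\: T))].
Proof.
move=> cT.
(* If [T] is empty, the representative of the vertex must first be moved to the class modulo [inO]
   from which the descending edges leave; otherwise it is already there. *)
have [v [Uv vT vO]] : exists v, [/\ inU v, T != finset.set0 -> v = 1 &
    forall u a, inU u -> desc (top_corner g T * v * u) a -> inO u].
  have [T0|[t tT]] := set_0Vmem T.
    have [[w [b [Uw wb]]]|nd] := pselect (exists w b, inU w /\ desc (top_corner g T * w) b).
      exists w; split=> // [|u a Uu ua]; first by rewrite T0 eqxx.
      by have [] := desc_clique E_irr wb Uu ua.
    exists 1; split=> // [|u a Uu]; first exact: (inU1 HA).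
    by rewrite mulg1 => ua; case: nd; exists u, a.
  exists 1; split=> // [|u a Uu]; first exact: (inU1 HA).
  rewrite mulg1 => ua.
  by have [] := desc_clique E_irr (desc_top g cT tT) Uu ua.
set h := top_corner g T * v in vO.
have dc a b : desc h a -> desc h b -> a = b \/ E a.1 b.1.
  move=> ha hb; have := desc_clique E_irr ha (inU1 HA); rewrite mulg1.
  by move=> /(_ _ hb) [].
(* [D] collects the descending labels at [h]. Those in [M] descend along an inverse generator, so
   [h] has coordinate 1 there and the base corner is [h * (gp M)^-1]. *)
pose D := [set t | desc h (t, true) || desc h (t, false)]%SET.
pose M := [set t | desc h (t, false)]%SET.
have cD : is_clique E D.
  apply/'forall_implyP => s; rewrite inE => sD; apply/'forall_implyP => t.
  rewrite inE => tD; apply/implyP => st.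
  have {}sD : exists b : bool, desc h (s, b) by case/orP: sD; [exists true|exists false].
  have {}tD : exists b : bool, desc h (t, b) by case/orP: tD; [exists true|exists false].
  have [[b sb] [c tc]] := (sD, tD).
  by have [[e]|//] := dc _ _ sb tc; rewrite e eqxx in st.
have MD : M \subset D by apply/fintype.subsetP => t; rewrite !inE => ->; rewrite orbT.
have TD : T \subset D.
  apply/fintype.subsetP => t tT; rewrite inE.
  have v1 : v = 1 by apply: vT; apply/set0Pn; exists t.
  rewrite /h v1 mulg1; have := desc_top g cT tT.
  by case: (_ \notin _) => ->; rewrite ?orbT.
pose g' := h * (gp M)^-1.
have g'M : g' * gp M = h by rewrite mulgVK.
have tM : tops g' D = M.
  apply/finset.setP => t; rewrite !inE.
  have [tDD|] := boolP (t \in D); last first.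
    by rewrite inE negb_or => /andP[/negPf-> /negPf->].
  have tD := tDD; rewrite inE in tD; rewrite tD /=.
  have [tm|tm] := boolP (t \in M).
    have hf : desc h (t, false) by move: tm; rewrite inE.
    rewrite hf; have := hf; rewrite -g'M (gpD1 cD MD tm) mulgA.
    rewrite (@desc_inv _ (t, true)) (@desc_gp D) //.
    - by apply: fintype.subset_trans MD; exact: finset.subD1set.
    - by rewrite !inE eqxx.
  have hf : desc h (t, false) = false by apply/negbTE; move: tm; rewrite inE.
  rewrite hf; move: tD; rewrite hf orbF -g'M (@desc_gp D) //.
  by move=> ->.
exists g', D; split=> //.
  move=> u a Uu; rewrite /top_corner tM g'M => ua; have Ou := vO _ _ Uu ua.
  move: ua; rewrite (desc_inO E_sym phiO HA _ _ Ou) inE.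
  by case: a => t [] /= ->; rewrite ?orbT.
rewrite tM; have [T0|[t tT]] := set_0Vmem T.
  rewrite T0 finset.setD0 g'M; apply/same_cube0; rewrite /h /top_corner.
  have -> : tops g T = finset.set0.
    by rewrite T0 tops0.
  by rewrite gp0 mulg1 mulKg.
have v1 : v = 1 by apply: vT; apply/set0Pn; exists t.
have hE : h = top_corner g T by rewrite /h v1 mulg1.
have MT : M :&: T = tops g T.
  apply/finset.setP => s; rewrite inE andbC.
  case: (boolP (s \in T)) => sT /=; last first.
    by rewrite [RHS]inE (negPf sT).
  rewrite inE hE; have := desc_top g cT sT.
  case: (boolP (s \in tops g T)) => //= st ds.
  by apply/negP => /(@desc_top_sign g T s false cT sT); rewrite st.
have -> : g' * gp (M :\: T) = g; last exact: same_cube_refl.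
apply: (mulIg (gp (M :&: T))); rewrite -mulgA -(@gpU D) //.
- by rewrite finset.setUC finset.setID g'M hE MT.
- by apply: fintype.subset_trans MD; exact: finset.subsetDl.
- by apply: fintype.subset_trans MD; exact: finset.subsetIl.
- rewrite -finset.setI_eq0 finset.setDE -finset.setIA [~: _ :&: _]finset.setIC -finset.setIA.
  by rewrite finset.setICr !finset.setI0.
Qed.

Lemma tops_inUl u g T : inU u -> tops (u * g) T = tops g T.
Proof. by move=> Uu; apply/finset.setP => t; rewrite !inE desc_inUl. Qed.

Lemma top_inUl u g T : inU u -> top_corner (u * g) T = u * top_corner g T.
Proof. by move=> Uu; rewrite /top_corner tops_inUl // mulgA. Qed.

Lemma full_inUl u g T : inU u -> full g T -> full (u * g) T.
Proof.
move=> Uu fT v a Uv; rewrite top_inUl // -mulgA desc_inUl //; exact: fT.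
Qed.

End Cubes.

(** * General topology *)

Local Open Scope ring_scope.

Section Continuity.
Implicit Types X Y Z : topologicalType.

Lemma comp_cont X Y Z (f : X -> Y) (g : Y -> Z) :
  continuous f -> continuous g -> continuous (fun x => g (f x)).
Proof. by move=> cf cg x; apply: (@continuous_comp _ _ _ f g); [exact: cf|exact: cg]. Qed.

Lemma pair_cont X Y Z (f : X -> Y) (g : X -> Z) :
  continuous f -> continuous g -> continuous (fun x => (f x, g x)).
Proof. by move=> cf cg x; apply: cvg_pair; [exact: cf|exact: cg]. Qed.

Lemma fst_cont X Y : continuous (fun p : X * Y => p.1).
Proof. by move=> p; exact: cvg_fst. Qed.

Lemma snd_cont X Y : continuous (fun p : X * Y => p.2).
Proof. by move=> p; exact: cvg_snd. Qed.

Lemma ptws_cont X (I : Type) (K : topologicalType) (f : X -> {ptws I -> K}) :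
  (forall i, continuous (fun x => f x i)) -> continuous f.
Proof.
move=> cf x; apply/cvg_sup => i.
by apply: (@continuous_comp_initial _ X K (fun g : forall i : I, K => g i) f); exact: cf.
Qed.

Lemma eval_cont (I : Type) (K : topologicalType) (i : I) :
  continuous (fun f : {ptws I -> K} => f i).
Proof.
by move=> f; exact: (@proj_continuous {classic I} (fun=> K) i f).
Qed.

Lemma val_cont X (D : set X) : continuous (fun x : set_type D => \val x).
Proof. exact: (@initial_continuous _ _ (@set_val X D)). Qed.

Lemma into_set_type_cont X Y (D : set Y) (f : X -> set_type D) :
  continuous (fun x => \val (f x)) -> continuous f.
Proof. by move=> cf; apply: (@continuous_comp_initial _ X Y (@set_val Y D) f). Qed.

Lemma open_forall_closed X (I : finType) (D W : I -> set X) :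
  (forall i, closed (D i)) -> (forall i, open (W i)) ->
  open [set x | forall i, D i x -> W i x].
Proof.
move=> cD oW; have -> : [set x | forall i, D i x -> W i x] =
    ~` \bigcup_(i in [set: I]) (D i `&` ~` W i).
  apply/seteqP; split=> x /= h.
    by move=> [i _ [Di /= nWi]]; exact/nWi/h.
  by move=> i Di; apply: contrapT => nW; apply: h; exists i.
rewrite openC; apply: closed_bigcup => [|i _]; first exact: finite_finset.
by apply: closedI => //; exact: open_closedC.
Qed.

Lemma closed_cover_cont X Y (I : finType) (D : I -> set X) (F : I -> X -> Y) (f : X -> Y) :
  (forall i, closed (D i)) -> (forall x, exists i, D i x) ->
  (forall i, continuous (F i)) -> (forall i x, D i x -> f x = F i x) ->
  continuous f.
Proof.
move=> cD cov cF fF; apply/continuousP => W oW.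
have -> : f @^-1` W = [set x | forall i, D i x -> (F i @^-1` W) x].
  apply/seteqP; split=> x /= h.
    by move=> i Di; rewrite -fF.
  by have [i Di] := cov x; rewrite /preimage /= (fF i x Di); exact: h.
by apply: open_forall_closed => // i; move/continuousP: (cF i); apply.
Qed.

(* A quotient map remains a quotient map after taking the product with a
   locally compact space; local compactness is only needed inside the
   preimages under the maps [p |-> f (x, p)]. *)
Lemma quotient_prod_cont X Y (P : topologicalType) (I : Type) (Z : I -> topologicalType)
    (q : forall i, Z i -> X) (f : X * P -> Y) :
  (forall x, exists i z, @q i z = x) ->
  (forall W : set X, (forall i, open (@q i @^-1` W)) -> open W) ->
  (forall x p (W : set Y), open W -> W (f (x, p)) ->
    exists C : set P, [/\ compact C, nbhs p C & forall c, C c -> W (f (x, c))]) ->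
  (forall i, continuous (fun zp : Z i * P => f (@q i zp.1, zp.2))) ->
  continuous f.
Proof.
move=> qsurj qopen lc cf [x0 p0] N /=; rewrite nbhsE => -[W [oW Wf] WN].
have [C [cC nC hC]] := lc _ _ _ oW Wf.
pose V := [set x | forall c, C c -> W (f (x, c))].
(* The tube lemma along the compact set [C], applied in each [Z i]. *)
have oV : open V.
  apply: qopen => i; rewrite openE => z /= Vz.
  have := compact_near_coveringP C; move=> [+ _] => /(_ cC).
  apply => c Cc.
  have Wzc : nbhs (f (@q i z, c)) W by apply: open_nbhs_nbhs; split=> //; exact: Vz.
  have := cf i (z, c) W Wzc; rewrite /= nbhs_simpl /=.
  move=> [[A B] /= [nA nB] AB].
  exists (B, A) => //= -[c' z'] /= [Bc Az].
  exact: (AB (z', c')).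
suff : filter_prod (nbhs x0) (nbhs p0) (f @^-1` N) by [].
exists (V, C) => /=; first by split=> //; apply: open_nbhs_nbhs.
by move=> [x p] /= [Vx Cp]; apply: WN; exact: Vx.
Qed.

End Continuity.

Section RealContinuity.
Variables (R : realType) (X : topologicalType).
Implicit Types f g : X -> R.

Lemma add_cont f g : continuous f -> continuous g -> continuous (fun x => f x + g x).
Proof. by move=> cf cg x; apply: cvgD; [exact: cf|exact: cg]. Qed.

Lemma opp_cont f : continuous f -> continuous (fun x => - f x).
Proof. by move=> cf x; apply: cvgN; exact: cf. Qed.

Lemma mul_cont f g : continuous f -> continuous g -> continuous (fun x => f x * g x).
Proof. by move=> cf cg x; apply: cvgM; [exact: cf|exact: cg]. Qed.

Lemma inv_cont f : (forall x, f x != 0) -> continuous f -> continuous (fun x => (f x)^-1).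
Proof. by move=> f0 cf x; apply: cvgV; [exact: f0|exact: cf]. Qed.

Lemma const_cont (Y : topologicalType) (y : Y) : continuous (fun _ : X => y).
Proof. by move=> x; exact: cvg_cst. Qed.

Lemma max_cont f g : continuous f -> continuous g -> continuous (fun x => Order.max (f x) (g x)).
Proof. exact: max_fun_continuous. Qed.

Lemma min_cont f g : continuous f -> continuous g -> continuous (fun x => Order.min (f x) (g x)).
Proof. exact: min_fun_continuous. Qed.

Lemma prod_cont (I : Type) (r : seq I) (F : I -> X -> R) :
  (forall i, continuous (F i)) -> continuous (fun x => \prod_(i <- r) F i x).
Proof.
move=> cF; elim: r => [|i r IH].
  by under eq_fun do rewrite big_nil; exact: const_cont.
by under eq_fun do rewrite big_cons; exact: mul_cont.
Qed.

Lemma closed_le_cont f g : continuous f -> continuous g -> closed [set x | f x <= g x].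
Proof.
move=> cf cg.
have -> : [set x | f x <= g x] = (fun x => g x - f x) @^-1` [set y | 0 <= y].
  by apply/seteqP; split=> x /=; rewrite subr_ge0.
apply: preimage_closed; last exact: closed_ge.
by move=> x _; apply: add_cont => //; exact: opp_cont.
Qed.

Lemma closed_eq_cont f g : continuous f -> continuous g -> closed [set x | f x = g x].
Proof.
move=> cf cg; have -> : [set x | f x = g x] = [set x | f x <= g x] `&` [set x | g x <= f x].
  apply/seteqP; split=> x /=; first by move=> ->.
  by move=> [h1 h2]; apply/eqP; rewrite eq_le h1 h2.
by apply: closedI; exact: closed_le_cont.
Qed.

End RealContinuity.

Section Clamp.
Variable R : realType.

Definition clamp (r : R) : R := Order.max 0 (Order.min 1 r).

Lemma clamp_itv r : 0 <= clamp r <= 1.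
Proof. by rewrite /clamp le_max lexx ge_max ler01 ge_min lexx. Qed.

Lemma clamp_id r : 0 <= r <= 1 -> clamp r = r.
Proof. by move=> /andP[r0 r1]; rewrite /clamp (min_idPr r1) (max_idPr r0). Qed.

Lemma clamp_le0 r : r <= 0 -> clamp r = 0.
Proof.
move=> r0; rewrite /clamp; apply/max_idPl.
by rewrite ge_min r0 orbT.
Qed.

Lemma clamp_ge1 r : 1 <= r -> clamp r = 1.
Proof. by move=> r1; rewrite /clamp (min_idPl r1); apply/max_idPr/ler01. Qed.

Lemma clamp_cont (X : topologicalType) (f : X -> R) :
  continuous f -> continuous (fun x => clamp (f x)).
Proof.
by move=> cf; apply: max_cont; [exact: const_cont|apply: min_cont => //; exact: const_cont].
Qed.

End Clamp.

(** * Contractible spaces are weakly contractible *)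

Section Contractible.
Variables (R : realType) (Y : topologicalType) (y0 : Y) (h : Y * R -> Y).
Hypothesis h_cont : continuous h.
Hypothesis h0 : forall y, h (y, 0) = y.
Hypothesis h1 : forall y, h (y, 1) = y0.

Section Disc.
Variable n : nat.
Local Notation D := (disc R n).
Implicit Types (d : D) (s : R).

Lemma disc_itv d i : 0 <= (\val d : {ptws 'I_n -> R}) i <= 1.
Proof. by have := set_mem (valP d); apply. Qed.

Lemma coord_cont (X : topologicalType) (f : X -> D) i :
  continuous f -> continuous (fun x => (\val (f x) : {ptws 'I_n -> R}) i).
Proof.
move=> cf; apply: (@comp_cont _ {ptws 'I_n -> R} R (fun x => \val (f x)) (fun z => z i)).
  by apply: (@comp_cont _ D {ptws 'I_n -> R} f (fun z => \val z)) => //; exact: val_cont.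
exact: eval_cont.
Qed.

(** The clamped dilation by [1 + p.2] from the centre of the cube; with factor 2, everything outside
    the open cube with sides from 1/4 to 3/4 reaches the boundary. *)
Definition shrink_fun (p : D * R) : {ptws 'I_n -> R} :=
  fun i => clamp (((\val p.1 : {ptws 'I_n -> R}) i - 2^-1) * (1 + p.2) + 2^-1).

Lemma shrink_fun_cube p : unit_cube (shrink_fun p).
Proof. by move=> i; exact: clamp_itv. Qed.

Definition shrink (p : D * R) : D := SigSub (mem_set (shrink_fun_cube p)).

Lemma shrink_cont : continuous shrink.
Proof.
apply: into_set_type_cont; apply: ptws_cont => i /=; apply: clamp_cont.
apply: add_cont; last exact: const_cont.
apply: mul_cont; apply: add_cont; try exact: const_cont; last exact: snd_cont.
by apply: coord_cont; exact: fst_cont.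
Qed.

Lemma shrink0 d : shrink (d, 0) = d.
Proof.
apply: val_inj => /=; apply/funext => i; rewrite /shrink_fun /= addr0 mulr1 subrK.
exact/clamp_id/disc_itv.
Qed.

Lemma shrink_boundary d s : 0 <= s -> disc_boundary d -> disc_boundary (shrink (d, s)).
Proof.
move=> s0 [i di]; exists i; case: di => di; [left|right]; rewrite /= /shrink_fun /= di.
  by apply: clamp_le0; lra.
by apply: clamp_ge1; lra.
Qed.

Definition bump d : R := \prod_i (clamp (4 * (\val d : {ptws 'I_n -> R}) i) *
  clamp (4 * (1 - (\val d : {ptws 'I_n -> R}) i))).

Lemma bump_cont : continuous bump.
Proof.
apply: prod_cont => i; apply: mul_cont; apply: clamp_cont; apply: mul_cont;
  try exact: const_cont.
  exact: (@coord_cont D id i (fun x => cvg_id)).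
apply: add_cont; first exact: const_cont.
by apply: opp_cont; exact: (@coord_cont D id i (fun x => cvg_id)).
Qed.

Lemma bump_boundary d : disc_boundary d -> bump d = 0.
Proof.
move=> [i di]; rewrite /bump (bigD1 i) //=.
by case: di => ->; rewrite ?mulr0 ?subrr ?mulr0 (clamp_le0 (lexx 0)) ?mul0r ?mulr0 ?mul0r.
Qed.

Lemma bump_inner d : ~ disc_boundary (shrink (d, 1)) -> bump d = 1.
Proof.
move=> nb; rewrite /bump big1 // => i _.
have := disc_itv d i; set x := (\val d : {ptws 'I_n -> R}) i => /andP[x0 x1].
have l4 : 4^-1 < x.
  rewrite ltNge; apply/negP => hx; apply: nb; exists i; left.
  by rewrite /= /shrink_fun /= -/x; apply: clamp_le0; lra.
have r4 : x < 3 / 4.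
  rewrite ltNge; apply/negP => hx; apply: nb; exists i; right.
  by rewrite /= /shrink_fun /= -/x; apply: clamp_ge1; lra.
by rewrite !clamp_ge1 ?mulr1 //; lra.
Qed.

End Disc.

(* A map [f] of the disc is first made constant on a collar of the boundary,
   then contracted on the inner disc with the speed [bump], and finally the
   resulting path from [y] to [y0] is unwound. *)
Lemma contractible_weakly : weakly_contractible R Y.
Proof.
split=> [|n y f fc fb]; first by exists y0.
(* Thirds of the time: [F] dilates up to 1/3 and contracts up to 2/3, then [G] unwinds. *)
pose F (p : disc R n * unit_interval R) : Y :=
  h (f (shrink (p.1, clamp (3 * (\val p.2 : R)))),
     clamp (3 * (\val p.2 : R) - 1) * bump p.1).
pose G (p : disc R n * unit_interval R) : Y :=
  h (y, bump p.1 * clamp (3 - 3 * (\val p.2 : R))).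
have tc : continuous (fun p : disc R n * unit_interval R => (\val p.2 : R)).
  apply: (comp_cont (f := fun p : disc R n * unit_interval R => p.2)).
    exact: snd_cont.
  exact: val_cont.
have t3c : continuous (fun p : disc R n * unit_interval R => 3 * (\val p.2 : R)).
  by apply: mul_cont => //; exact: const_cont.
have bc : continuous (fun p : disc R n * unit_interval R => bump p.1).
  by apply: (comp_cont (f := fun p : disc R n * unit_interval R => p.1));
    [exact: fst_cont|exact: bump_cont].
have Fc : continuous F.
  apply: (comp_cont (g := h)) => //; apply: pair_cont.
    apply: (comp_cont (g := f)) => //.
    apply: (comp_cont (g := @shrink n)); last exact: shrink_cont.
    by apply: pair_cont; [exact: fst_cont|exact: clamp_cont].
  apply: mul_cont => //; apply: clamp_cont; apply: add_cont => //.
  exact: const_cont.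
have Gc : continuous G.
  apply: (comp_cont (g := h)) => //; apply: pair_cont; first exact: const_cont.
  apply: mul_cont => //; apply: clamp_cont; apply: add_cont.
    exact: const_cont.
  exact: opp_cont.
exists (fun p => if (\val p.2 : R) <= 2 / 3 then F p else G p); split.
- pose C (b : bool) : set (disc R n * unit_interval R) :=
    if b then [set p | (\val p.2 : R) <= 2 / 3] else [set p | 2 / 3 <= (\val p.2 : R)].
  apply: (@closed_cover_cont _ _ bool C (fun b => if b then F else G)).
  + by case; apply: closed_le_cont => //; exact: const_cont.
  + move=> p; have [le|/ltW le] := leP (\val p.2 : R) (2 / 3).
      by exists true.
    by exists false.
  + by case.
  + case=> p /=; first by move=> ->.
    move=> le; case: ifP => // le'; have {le le'} tE : (\val p.2 : R) = 2 / 3.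
      by apply/eqP; rewrite eq_le le' le.
    rewrite /F /G tE; have -> : 3 * (2 / 3) - 1 = 1 :> R by lra.
    have -> : 3 * (2 / 3) = 2 :> R by lra.
    have -> : 3 - 2 = 1 :> R by lra.
    rewrite (clamp_ge1 (lexx 1)) (@clamp_ge1 _ 2) ?ler1n // mul1r mulr1.
    (* At time 2/3 both maps agree: on the collar [f] already takes the value [y], and inside it
       [bump] is 1 and both maps give [y0]. *)
    have [/fb ->//|/bump_inner ->] := pselect (disc_boundary (shrink (p.1, 1))).
    by rewrite !h1.
- move=> d t t0; rewrite ifT /=; last by rewrite t0; lra.
  by rewrite /F /= t0 mulr0 (clamp_le0 (lexx 0)) clamp_le0 ?mul0r ?h0 ?shrink0 //; lra.
- move=> d t t1; rewrite ifF /=; last by apply/negbTE; rewrite t1 -ltNge; lra.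
  rewrite /G /= t1; have -> : 3 - 3 * 1 = 0 :> R by lra.
  by rewrite (clamp_le0 (lexx 0)) mulr0 h0.
- move=> d t db; case: ifP => _; rewrite /F /G /= bump_boundary // ?mulr0 ?mul0r h0 //.
  apply: fb; apply: shrink_boundary => //.
  by case/andP: (clamp_itv (3 * (\val t : R))).
Qed.

End Contractible.

Local Close Scope ring_scope.

(** * Points of the complex *)

Section Points.
Variables (R : realType) (S : finType) (E : rel S) (U : topologicalGroupType).
Variables (O : openSubgroup U) (phi : openMono O).
Hypothesis E_sym : symmetric E.
Hypothesis E_irr : irreflexive E.
Hypothesis phiO : phi @` (O : set U) = (O : set U).

Local Notation A := (raag E phi).
Local Notation bs := (raag_base E phi).
Local Notation gn := (raag_gen E phi).
Local Notation HA := (raag_specP E phi).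
Local Notation inU := (inU bs).
Local Notation gp := (gp gn).
Local Notation same_cube := (same_cube bs gn).
Local Notation X := (salvetti R E phi).
Local Notation fn := ({ptws S -> R}).
Local Notation disj B C := (fintype.disjoint (mem B) (mem C)).
Implicit Types (g h : A) (f : fn) (T : clique E) (s t : S) (B C : {set S}).

Definition tocube (D : {set S}) f : fn := fun s => if s \in D then clamp (f s) else 0%R.

Lemma tocubeP D f : cube D (tocube D f).
Proof.
split=> s; rewrite /tocube; first by case: ifP => _; rewrite ?lexx ?ler01 ?clamp_itv.
by move/negPf => ->.
Qed.

Lemma tocube_id D f : cube D f -> tocube D f = f.
Proof.
move=> [f01 f0]; apply/funext => s; rewrite /tocube; case: ifPn => [_|/f0//].
exact/clamp_id/f01.
Qed.

(* The point of the cube [gQ_T] with coordinates [f], clamped to [0, 1]. *)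
Definition spt g T f : X := salvetti_pt (SigSub (mem_set (tocubeP (\val T) f)) : cube_space R (g, T)).

Lemma tocube_cont D : continuous (tocube D).
Proof.
apply: ptws_cont => s; rewrite /tocube; case: (s \in D); last exact: const_cont.
exact/clamp_cont/eval_cont.
Qed.

Lemma spt_cont g T : continuous (spt g T).
Proof.
apply: (@comp_cont _ (cube_space R (g, T)) X (fun f => SigSub (mem_set (tocubeP (\val T) f)))).
  by apply: into_set_type_cont; exact: tocube_cont.
apply: (@comp_cont _ (cubes_union R E phi) X (fun x => cube_pt x)).
  exact: existT_continuous.
exact: pi_continuous.
Qed.

Lemma spt_val g T (x : cube_space R (g, T)) : salvetti_pt x = spt g T (\val x).
Proof.
rewrite /spt; congr salvetti_pt; apply: val_inj => /=.
by rewrite tocube_id //; exact: set_mem (valP x).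
Qed.

Lemma spt_surj (p : X) : exists g T f, cube (\val T) f /\ p = spt g T f.
Proof.
elim/quotW: p => -[[g T] x]; exists g, T, (\val x).
by split; [exact: set_mem (valP x)|exact: (@spt_val g T x)].
Qed.

Lemma spt_open (W : set X) : (forall g T, open (spt g T @^-1` W)) -> open W.
Proof.
move=> oW; rewrite /open /= /quotient_open; apply/sigT_openP => -[g T].
have -> : existT (cube_space R (phi:=phi)) (g, T) @^-1` (\pi_X @^-1` W) =
    (fun x => \val x : fn) @^-1` (spt g T @^-1` W).
  by apply/seteqP; split=> x /=; rewrite -spt_val.
by apply: open_comp => // x _; exact: val_cont.
Qed.

Lemma spt_ext g T f f' : (forall s, s \in \val T -> f s = f' s) -> spt g T f = spt g T f'.
Proof.
move=> ff; rewrite /spt; congr salvetti_pt; apply: val_inj => /=.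
by apply/funext => s; rewrite /tocube; case: ifP => // /ff ->.
Qed.

Lemma spt_clamp g T f : spt g T (tocube (\val T) f) = spt g T f.
Proof.
rewrite /spt; congr salvetti_pt; apply: val_inj => /=.
exact/tocube_id/tocubeP.
Qed.

Lemma glue_eq (p q : cubes_union R E phi) : cube_glue p q -> \pi_X p = \pi_X q :> X.
Proof. by move=> pq; apply/eqquotP/asboolP; exact: rst_step. Qed.

Lemma cube_verticesE g D : cube_vertices g D = cube_corners bs gn g D.
Proof. by []. Qed.

Lemma spt_glue g g' T f : same_cube (\val T) g g' -> spt g T f = spt g' T f.
Proof.
move=> gg; apply/glue_eq/GlueCell => //.
by rewrite !cube_verticesE; apply/(cube_cornersP HA).
Qed.

Lemma spt_face g T T' B f : \val T' \subset \val T -> B \subset \val T :\: \val T' ->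
  (forall s, s \in B -> f s = 1%R) ->
  (forall s, s \in \val T :\: (\val T' :|: B) -> f s = 0%R) ->
  spt g T f = spt (g * gp B) T' f.
Proof.
move=> TT BT f1 f0; apply/glue_eq/(@GlueFace _ _ _ _ _ _ g T T' B) => //= s.
- move=> sB; rewrite /tocube; have := fintype.subsetP BT _ sB.
  by rewrite inE => /andP[_ ->]; rewrite f1 // clamp_id // lexx ler01.
- by move=> sT; rewrite /tocube sT (fintype.subsetP TT _ sT).
- move=> sT; rewrite /tocube f0 //; case: ifP => // _.
  by rewrite clamp_le0.
Qed.

Lemma spt_act a g T f : salvetti_act R E phi a (spt g T f) = spt (a * g) T f.
Proof. by rewrite /spt salvetti_actE. Qed.

Definition interior_dirs f : {set S} := [set s | (0 < f s < 1)%R]%SET.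
Definition one_dirs f : {set S} := [set s | f s == 1%R]%SET.
Definition interior_part f : S -> R := fun s => if s \in interior_dirs f then f s else 0%R.

Lemma interior_dirs_sub D f : cube D f -> interior_dirs f \subset D.
Proof.
move=> [_ f0]; apply/fintype.subsetP => s; rewrite inE.
by apply: contraTT => /f0 ->; rewrite ltxx.
Qed.

Lemma one_dirs_sub D f : cube D f -> one_dirs f \subset D.
Proof.
move=> [_ f0]; apply/fintype.subsetP => s; rewrite inE.
by apply: contraTT => /f0 ->; rewrite eq_sym oner_eq0.
Qed.

Lemma one_interior f : disj (one_dirs f) (interior_dirs f).
Proof.
rewrite fintype.disjoint_subset; apply/fintype.subsetP => s; rewrite !inE => /eqP ->.
by rewrite ltxx andbF.
Qed.

(* The open cell that contains a point, and its coordinates there. *)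
Definition carrier (p : cubes_union R E phi) : set (set A) * (S -> R) :=
  let: existT i x := p in
  (cube_vertices (i.1 * gp (one_dirs (\val x))) (interior_dirs (\val x)),
   interior_part (\val x)).

(** An invariant of the gluing, which bounds the identifications from above. *)
Lemma carrier_glue p q : cube_glue p q -> carrier p = carrier q.
Proof.
case=> {p q} [g g' T T' x x' e ex|g T T' B x x' sT sB x1 xx' x0] /=.
  rewrite -ex; congr pair; rewrite !cube_verticesE.
  move: e; rewrite !cube_verticesE => /(cube_cornersP HA) [eT gg].
  apply/(cube_cornersP HA); split=> //.
  have cx := set_mem (valP x).
  apply: (same_cube_face HA (valP T)) gg; first exact: one_dirs_sub.
    exact: interior_dirs_sub.
  exact: one_interior.
have cx := set_mem (valP x); have cx' := set_mem (valP x').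
have B1 s : s \in B -> (s \in \val T) && (s \notin \val T').
  by move=> /(fintype.subsetP sB); rewrite inE andbC.
have xE s : \val x s = if s \in B then 1%R else \val x' s.
  case: ifPn => [/x1//|sNB]; case: (boolP (s \in \val T')) => [/xx'//|sNT'].
  rewrite [RHS](proj2 cx') //; case: (boolP (s \in \val T)) => [sTT|]; last exact: (proj2 cx).
  by apply: x0; rewrite !inE negb_or sNB sNT' sTT.
have iE : interior_dirs (\val x) = interior_dirs (\val x').
  apply/finset.setP => s; rewrite !inE xE; case: ifP => // /B1 /andP[_ sNT'].
  by rewrite ltxx andbF (proj2 cx') // ltxx.
have oE : one_dirs (\val x) = B :|: one_dirs (\val x').
  apply/finset.setP => s; rewrite !inE xE; case: ifP => //= _.
  by rewrite eqxx.
congr pair; last first.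
  apply/funext => s; rewrite /interior_part iE; case: ifP => // si.
  have sT' : s \in \val T' := fintype.subsetP (interior_dirs_sub cx') _ si.
  by rewrite xE; case: ifP => // /B1 /andP[_]; rewrite sT'.
rewrite iE oE; congr (cube_vertices _ _); rewrite -mulgA; congr (_ * _).
rewrite (gpU HA (valP T)) //.
- by apply: fintype.subset_trans sB _; exact: finset.subsetDl.
- by apply: fintype.subset_trans sT; exact: one_dirs_sub.
- rewrite fintype.disjoint_subset; apply/fintype.subsetP => s /B1 /andP[_].
  by rewrite inE; apply: contra => /(fintype.subsetP (one_dirs_sub cx')).
Qed.

Lemma carrier_pi p q : \pi_X p = \pi_X q :> X -> carrier p = carrier q.
Proof.
move=> /eqquotP /asboolP; elim=> {p q} [p q|//|p q _ ->//|p q r _ -> _ ->//].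
exact: carrier_glue.
Qed.

Lemma spt_carrier g T f g' T' f' : spt g T f = spt g' T' f' ->
  cube (\val T) f -> cube (\val T') f' ->
  [/\ interior_dirs f = interior_dirs f',
      same_cube (interior_dirs f) (g * gp (one_dirs f)) (g' * gp (one_dirs f')) &
      interior_part f = interior_part f'].
Proof.
move=> /carrier_pi /= e cf cf'; move: e; rewrite !tocube_id // !cube_verticesE.
by move=> [/(cube_cornersP HA) []].
Qed.

Lemma spt_decomp g T f : cube (\val T) f -> exists T',
  \val T' = interior_dirs f /\ spt g T f = spt (g * gp (one_dirs f)) T' f.
Proof.
move=> cf; have ci : is_clique E (interior_dirs f).
  exact: clique_sub (interior_dirs_sub cf) (valP T).
exists (Sub (interior_dirs f) ci); split=> //; apply: spt_face; rewrite ?SubK.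
- exact: interior_dirs_sub.
- by rewrite finset.subsetD one_dirs_sub //=; exact: one_interior.
- by move=> s; rewrite inE => /eqP.
- move=> s; rewrite !inE negb_or => /andP[/andP[ni n1] _].
  case: cf => f01 _; have /andP[f0 f1] := f01 s.
  have [//|fs0] := eqVneq (f s) 0%R.
  by move: ni; rewrite lt_neqAle eq_sym fs0 f0 lt_neqAle n1 f1.
Qed.

End Points.

(** * The cell structure *)

Lemma local_cont (X Y : topologicalType) (f : X -> Y) :
  (forall x, exists V F, [/\ open V, V x, continuous F & forall y, V y -> f y = F y]) ->
  continuous f.
Proof.
move=> h x; have [V [F [oV Vx cF fF]]] := h x; move=> W /=; rewrite fF // => /cF FW.
have nV : nbhs x V by exact: open_nbhs_nbhs.
suff : nbhs x (f @^-1` W) by [].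
by apply: filterS (filterI nV FW) => y [/fF e Wy]; rewrite /preimage /= e.
Qed.

Lemma eq_on_trace (T : Type) (V W K : set T) (x : T) :
  V `&` K = W `&` K -> K x -> V x <-> W x.
Proof.
move=> VW Kx; have := congr1 (@^~ x) VW; rewrite /= /setI /= => e; split=> h.
  by have [] : W x /\ K x by rewrite -e.
by have [] : V x /\ K x by rewrite e.
Qed.

Lemma open_subgroup_closed (G : topologicalGroupType) (H : subgroup G) :
  open (H : set G) -> closed (H : set G).
Proof.
move=> oH; rewrite -(setCK (H : set G)); apply: open_closedC; apply: open_local => g nHg.
exists ((fun x => g^-1 * x) @^-1` (H : set G)); split.
- by apply: open_comp => // x _; exact: lmul_continuous.
- by rewrite /= mulVg; exact: sg1.
- move=> x /= Hx Hx'; apply: nHg.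
  have := sgM Hx' (sgV Hx); by rewrite invgM invgK mulgA mulgV mul1g.
Qed.

Section Complex.
Variables (R : realType) (S : finType) (E : rel S) (U : topologicalGroupType).
Variables (O : openSubgroup U) (phi : openMono O) (s0 : S).
Hypothesis E_sym : symmetric E.
Hypothesis E_irr : irreflexive E.
Hypothesis phiO : phi @` (O : set U) = (O : set U).
Hypothesis U_lc : locally_compact [set: U].

Local Notation A := (raag E phi).
Local Notation bs := (raag_base E phi).
Local Notation gn := (raag_gen E phi).
Local Notation HA := (raag_specP E phi).
Local Notation inU := (inU bs).
Local Notation gp := (gp gn).
Local Notation same_cube := (same_cube bs gn).
Local Notation X := (salvetti R E phi).
Local Notation fn := ({ptws S -> R}).
Local Notation spt := (@spt R S E U O phi).
Local Notation act := (salvetti_act R E phi).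
Implicit Types (g h a : A) (f : fn) (T : clique E) (s t : S) (B C D : {set S}).

(** By [cube_cornersP], an element preserving the corners of a cube as a set fixes each of them. *)
Definition cube_stab_set D : set A := [set a | same_cube D 1 a].

Lemma cube_stab1 D : cube_stab_set D 1. Proof. exact: (same_cube_refl HA). Qed.

Lemma cube_stabM D g h : cube_stab_set D g -> cube_stab_set D h -> cube_stab_set D (g * h).
Proof.
move=> Dg Dh; apply: (same_cube_trans HA Dg).
by rewrite -{1}(mulg1 g); exact: same_cube_mul.
Qed.

Lemma cube_stabV D g : cube_stab_set D g -> cube_stab_set D g^-1.
Proof.
by move=> /(same_cube_sym HA) /(same_cube_mul g^-1); rewrite mulVg mulg1.
Qed.

Definition cube_stab D : subgroup A :=
  Subgroup (@cube_stab1 D) (@cube_stabM D) (@cube_stabV D).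

Lemma same_cubeP D g h : same_cube D g h <-> sg_set (cube_stab D) (g^-1 * h).
Proof.
split=> [/(same_cube_mul g^-1)|/(same_cube_mul g)]; first by rewrite mulVg.
by rewrite mulg1 mulVKg.
Qed.

Lemma inU_open : open (inU : set A).
Proof. exact/raag_base_open/openT. Qed.

Lemma cube_stab_open D : open (cube_stab D : set A).
Proof.
pose K C : set A := if C \subset D then setT else set0.
pose W C : set A := (fun a => (1 * gp C)^-1 * (a * gp C)) @^-1` inU.
have -> : (cube_stab D : set A) = [set a | forall C, K C a -> W C a].
  apply/seteqP; split=> a /= Da C; first by rewrite /K; case: ifP => // /Da.
  by move=> CD; apply: Da; rewrite /K CD.
apply: open_forall_closed => C.
  by rewrite /K; case: ifP => _; [exact: closedT|exact: closed0].
apply: open_comp inU_open => a _.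
apply: (@comp_cont A A A (fun a => a * gp C) (fun a => (1 * gp C)^-1 * a)).
  exact: rmul_continuous.
exact: lmul_continuous.
Qed.

Lemma cube_stab_closed D : closed (cube_stab D : set A).
Proof. exact/open_subgroup_closed/cube_stab_open. Qed.

Lemma compact_nbhs1 : exists K : set A, compact K /\ nbhs 1 K.
Proof.
have [C nC [cC _]] := U_lc (x := 1) I.
exists (bs @` C); split.
  apply: continuous_compact => //; apply: continuous_subspaceT.
  exact: raag_base_continuous.
have {}nC : nbhs 1 C.
  by move: nC; rewrite /within /= => /filterS; apply => u; apply.
move: nC; rewrite nbhsE => -[V [oV V1] VC].
apply: (filterS (@image_subset _ _ bs _ _ VC)); apply: open_nbhs_nbhs; split.
  exact: raag_base_open.
by exists 1 => //; exact: (bs1 HA).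
Qed.

(** The compact sets for [quotient_prod_cont] are neighbourhoods of [a] that move the cube of [x] in
    the same way as [a]; they exist since cube stabilisers are open and the group is locally
    compact. *)
Lemma act_cont : continuous (fun p : A * X => act p.1 p.2).
Proof.
suff c : continuous (fun p : X * A => act p.2 p.1).
  apply: (@comp_cont _ (X * A)%type _ (fun p : A * X => (p.2, p.1)) _ _ c).
  by apply: pair_cont; [exact: snd_cont|exact: fst_cont].
apply: (@quotient_prod_cont X X A (A * clique E)%type (fun=> fn) (fun i => spt i.1 i.2)).
- by move=> x; have [g [T [f [_ ->]]]] := spt_surj x; exists (g, T), f.
- by move=> W oW; apply: spt_open => g T; exact: (oW (g, T)).
- move=> x a W oW /= Wax; have [g [T [f [_ ex]]]] := spt_surj x.
  have [K [cK nK]] := compact_nbhs1.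
  pose L := (fun k => g^-1 * (k * g)) @^-1` (cube_stab (\val T) : set A).
  have cL : continuous (fun k : A => g^-1 * (k * g)).
    apply: (@comp_cont A A A (fun k => k * g) (fun k => g^-1 * k)).
      exact: rmul_continuous.
    exact: lmul_continuous.
  exists ((fun k => a * k) @` (K `&` L)); split.
  + apply: continuous_compact.
      by apply: continuous_subspaceT => k; exact: lmul_continuous.
    apply: compact_closedI => //.
    by apply: preimage_closed (@cube_stab_closed _) => k _; exact: cL.
  + have -> : (fun k => a * k) @` (K `&` L) = (fun k => a^-1 * k) @^-1` (K `&` L).
      apply/seteqP; split=> [_ [k kKL <-]|k kKL]; first by rewrite /preimage /= mulKg.
      by exists (a^-1 * k) => //; rewrite mulVKg.
    apply: (@lmul_continuous A a^-1 a); rewrite mulVg; apply: filterI => //.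
    apply: open_nbhs_nbhs; split.
      by apply: open_comp (@cube_stab_open _) => k _; exact: cL.
    by rewrite /L /preimage /= mul1g mulVg; exact: cube_stab1.
  + move=> _ [k [_ Lk] <-]; rewrite ex spt_act -mulgA.
    move: Wax; rewrite ex spt_act (@spt_glue _ _ _ _ _ _ (a * g) (a * (k * g))) //.
    by apply: same_cube_mul; apply/same_cubeP.
- move=> [g T] /=; apply: local_cont => -[f0 a0].
  exists ((fun p : fn * A => (a0 * g)^-1 * (p.2 * g)) @^-1` (cube_stab (\val T) : set A)).
  exists (fun p => spt (a0 * g) T p.1); split.
  + apply: open_comp (@cube_stab_open _) => p _.
    apply: (@comp_cont _ A A (fun p : fn * A => p.2) (fun b => (a0 * g)^-1 * (b * g))).
      exact: snd_cont.
    apply: (@comp_cont A A A (fun k => k * g) (fun k => (a0 * g)^-1 * k)).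
      exact: rmul_continuous.
    exact: lmul_continuous.
  + by rewrite /preimage /= mulVg; exact: cube_stab1.
  + apply: (@comp_cont _ fn _ (fun p : fn * A => p.1)); first exact: fst_cont.
    exact: spt_cont.
  + move=> [f a] h /=; rewrite spt_act; apply/esym/spt_glue.
    by apply/same_cubeP; exact: h.
Qed.

Definition tofun D n (d : disc R n) : fn :=
  fun s => oapp (\val d : {ptws 'I_n -> R}) 0%R (insub (index s (enum D))).

(** [s0] is the default of [nth], not reached when [n] is the cardinality of [D]. *)
Definition todisc_fun D n f : {ptws 'I_n -> R} := fun i => clamp (f (nth s0 (enum D) i)).
Arguments todisc_fun : clear implicits.

Lemma todisc_fun_cube D n f : unit_cube (todisc_fun D n f).
Proof. by move=> i; exact: clamp_itv. Qed.

Definition todisc D n f : disc R n := SigSub (mem_set (@todisc_fun_cube D n f)).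
Arguments todisc : clear implicits.

Lemma tofunE D n (d : disc R n) s (i : 'I_n) : index s (enum D) = i ->
  tofun D d s = (\val d : {ptws 'I_n -> R}) i.
Proof. by move=> si; rewrite /tofun si valK. Qed.

Lemma index_dir D n s : #|D| = n -> s \in D -> exists i : 'I_n, index s (enum D) = i.
Proof.
move=> Dn sD; have lt : (index s (enum D) < n)%N.
  by rewrite -Dn cardE index_mem mem_enum.
by exists (Ordinal lt).
Qed.

Lemma dir_index D n (i : 'I_n) : #|D| = n ->
  nth s0 (enum D) i \in D /\ index (nth s0 (enum D) i) (enum D) = i.
Proof.
move=> Dn; have lt : (i < size (enum D))%N by rewrite -cardE Dn.
by rewrite -mem_enum mem_nth // index_uniq // enum_uniq.
Qed.

Lemma tofun_cube D n (d : disc R n) : #|D| = n -> cube D (tofun D d).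
Proof.
move=> Dn; split=> s; last first.
  move=> sD; rewrite /tofun insubF //; apply/negbTE.
  by rewrite -leqNgt -Dn cardE leqNgt index_mem mem_enum.
case: (boolP (s \in D)) => [/(index_dir Dn) [i /tofunE ->]|sD]; first exact: disc_itv.
rewrite /tofun insubF ?lexx ?ler01 //; apply/negbTE.
by rewrite -leqNgt -Dn cardE leqNgt index_mem mem_enum.
Qed.

Lemma tofun_todisc D n f s : #|D| = n -> s \in D -> tofun D (todisc D n f) s = clamp (f s).
Proof.
move=> Dn sD; have [i si] := index_dir Dn sD; rewrite (tofunE _ si) /= /todisc_fun.
by rewrite -si nth_index // mem_enum.
Qed.

Lemma tofun_cont D n : continuous (@tofun D n).
Proof.
apply: ptws_cont => s; rewrite /tofun.
case: insub => [i|] /=; last exact: const_cont.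
exact: (@coord_cont R n (disc R n) id i (fun x => cvg_id)).
Qed.

Lemma todisc_cont D n : continuous (@todisc D n).
Proof.
apply: into_set_type_cont; apply: ptws_cont => i /=.
exact/clamp_cont/eval_cont.
Qed.

Lemma interior_tofun D n (d : disc R n) : #|D| = n ->
  ~ disc_boundary d -> interior_dirs (tofun D d) = D.
Proof.
move=> Dn nb; apply/eqP; rewrite finset.eqEsubset interior_dirs_sub /=; last exact: tofun_cube.
apply/fintype.subsetP => s sD; rewrite inE; have [i si] := index_dir Dn sD.
rewrite (tofunE _ si); have /andP[d0 d1] := disc_itv d i.
rewrite !lt_neqAle d0 d1 !andbT eq_sym; apply/andP; split; apply/eqP => e; apply: nb; exists i.
  by left.
by right.
Qed.

Lemma card_interior_tofun D n (d : disc R n) : #|D| = n ->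
  (#|interior_dirs (tofun D d)| < n)%N <-> disc_boundary d.
Proof.
move=> Dn; split=> [lt|[i di]].
  apply: contrapT => /(interior_tofun Dn) e; move: lt.
  by rewrite e Dn ltnn.
rewrite -[X in (_ < X)%N]Dn; apply/proper_card/properP; split.
  exact/interior_dirs_sub/tofun_cube.
have [iD ei] := dir_index i Dn; exists (nth s0 (enum D) i) => //.
rewrite inE (tofunE _ ei); apply/negP => /andP[d0 d1].
by case: di => e; move: d0 d1; rewrite e ltxx.
Qed.

(** Strict inequality, since [skel n] is the skeleton of dimension [n - 1]. *)
Definition skeleton n : set X := [set p | exists g T f, (#|\val T| < n)%N /\ p = spt g T f].

Lemma skeletonP n g T f : cube (\val T) f ->
  skeleton n (spt g T f) <-> (#|interior_dirs f| < n)%N.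
Proof.
move=> cf; split=> [[g' [T' [f' [lt]]]]|lt].
  rewrite -(spt_clamp g' T' f') => /spt_carrier /(_ cf (tocubeP _ _)) [-> _ _].
  apply: leq_ltn_trans lt; apply: subset_leq_card.
  exact/interior_dirs_sub/tocubeP.
have [T' [eT ->]] := spt_decomp g cf.
by exists (g * gp (one_dirs f)), T', f; rewrite eT.
Qed.

(** Every cube on [T] is a translate of the one at the identity, so the orbits of [n]-cubes
    correspond to the cliques of size [n]. *)
Definition cell n : Type := {T : clique E | #|\val T| == n}.

Lemma cellP n (c : cell n) : #|\val (\val c)| = n. Proof. exact/eqP/(valP c). Qed.

Definition cell_stab n (c : cell n) : subgroup A := cube_stab (\val (\val c)).

Definition cell_char n (c : cell n) (p : coset_space (cell_stab c) * disc R n) : X :=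
  spt (repr (p.1 : coset_quot (cell_stab c))) (\val c) (tofun (\val (\val c)) p.2).

Lemma cell_charE n (c : cell n) g d :
  cell_char (to_coset (cell_stab c) g, d) = spt g (\val c) (tofun (\val (\val c)) d).
Proof.
rewrite /cell_char /=; apply: spt_glue; apply/same_cubeP.
apply/(coset_quotP (cell_stab c)).
by rewrite reprK.
Qed.

Lemma to_coset_surj (H : subgroup A) (q : coset_space H) : exists g, q = to_coset H g.
Proof. by exists (repr (q : coset_quot H)); rewrite /to_coset reprK. Qed.

Lemma to_coset_open (H : subgroup A) (q : coset_space H) : open (H : set A) -> open [set q].
Proof.
move=> oH; have [g ->] := to_coset_surj q.
rewrite /open /= /quotient_open.
rewrite (_ : _ @^-1` _ = (fun x => g^-1 * x) @^-1` (H : set A)).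
  by apply: open_comp => // x _; exact: lmul_continuous.
apply/seteqP; split=> x /=.
  by move=> /esym /(coset_quotP H).
by move=> h; apply/esym/(coset_quotP H).
Qed.

(** Stabilisers are open, so the coset space is discrete. *)
Lemma cell_char_cont n (c : cell n) : continuous (@cell_char n c).
Proof.
apply: local_cont => -[q d].
exists (fst @^-1` [set q]), (fun p => cell_char (q, p.2)); split=> //.
- apply: open_comp; first by move=> p _; exact: fst_cont.
  exact/to_coset_open/cube_stab_open.
- apply: (@comp_cont _ (disc R n) _ (fun p : coset_space (cell_stab c) * disc R n => p.2)
    (fun d => cell_char (q, d))); first exact: snd_cont.
  apply: (@comp_cont _ fn X (@tofun (\val (\val c)) n)
    (spt (repr (q : coset_quot (cell_stab c))) (\val c))).
    exact: tofun_cont.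
  exact: spt_cont.
- by move=> [q' d'] /= ->.
Qed.

Lemma cell_char_inj n (c c' : cell n) (a : coset_space (cell_stab c))
    (a' : coset_space (cell_stab c')) (d d' : disc R n) : ~ disc_boundary d -> ~ disc_boundary d' ->
  cell_char (a, d) = cell_char (a', d') ->
  existT (fun c => coset_space (cell_stab c)) c a = existT _ c' a' /\ d = d'.
Proof.
move=> nd nd' /spt_carrier /=.
have cd := tofun_cube d (cellP c); have cd' := tofun_cube d' (cellP c').
move=> /(_ cd cd') []; rewrite !interior_tofun ?cellP // => eT h ei.
have ecc : c = c' by do 2 apply: val_inj.
subst c'; move: h ei => h ei {eT}.
have one0 (d1 : disc R n) : ~ disc_boundary d1 ->
    one_dirs (tofun (\val (\val c)) d1) = finset.set0.
  move=> nd1; have cd1 := tofun_cube d1 (cellP c).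
  apply/eqP; rewrite -finset.subset0.
  have := one_interior (tofun (\val (\val c)) d1).
  rewrite interior_tofun ?cellP // -finset.setI_eq0 => /eqP <-.
  by rewrite finset.subsetI subxx one_dirs_sub.
move: h; rewrite !one0 // gp0 !mulg1 => /same_cubeP /(coset_quotP (cell_stab c)).
rewrite !reprK => ->; split=> //; apply: val_inj; apply/funext => i.
have [iD si] := dir_index i (cellP c).
have := congr1 (fun F => F (nth s0 (enum (\val (\val c))) i)) ei.
by rewrite /interior_part !interior_tofun ?cellP // iD !(tofunE _ si).
Qed.

Lemma skeleton_colim (W : set X) :
  (forall n, open (W : set (subspace (skeleton n)))) -> open W.
Proof.
move=> oW; apply: spt_open => g T.
have [V oV VW] := (open_subspaceP (skeleton #|\val T|.+1) W).1 (oW _).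
have -> : spt g T @^-1` W = spt g T @^-1` V.
  have sk f : skeleton #|\val T|.+1 (spt g T f) by exists g, T, f.
  by apply/seteqP; split=> f /= /(eq_on_trace VW (sk f)).
by apply: open_comp => // f _; exact: spt_cont.
Qed.

(* The face of the cube on [D] indexed by [(D', B)] in the notation of [GlueFace]. *)
Definition is_face n D (i : {set S} * {set S}) : bool :=
  [&& (#|i.1| <= n)%N, i.1 \subset D & i.2 \subset D :\: i.1].

Definition face_set D (i : {set S} * {set S}) : set fn :=
  [set f | forall s, (if s \in i.2 then 1 <= clamp (f s) else
    if s \in D :\: (i.1 :|: i.2) then clamp (f s) <= 0 else true)%R].

Lemma face_set_closed D i : closed (face_set D i).
Proof.
rewrite (_ : face_set D i = \bigcap_(s in [set: S]) [set f | (if s \in i.2 then 1 <= clamp (f s) else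
    if s \in D :\: (i.1 :|: i.2) then clamp (f s) <= 0 else true)%R]); last first.
  by apply/seteqP; split=> f /= h s; [move=> _; exact: h|exact: (h s I)].
apply: closed_bigI => s _.
have cs : continuous (fun f : fn => clamp (f s)) by exact/clamp_cont/eval_cont.
case: (s \in i.2); first by apply: closed_le_cont => //; exact: const_cont.
case: (s \in D :\: _); first by apply: closed_le_cont => //; exact: const_cont.
rewrite (_ : mkset _ = setT); first exact: closedT.
by apply/seteqP; split.
Qed.

Lemma skeleton_pushout n (W : set X) : open (W : set (subspace (skeleton n))) ->
  (forall c : cell n, open (@cell_char n c @^-1` W)) ->
  open (W : set (subspace (skeleton n.+1))).
Proof.
move=> /open_subspaceP [Vn oVn VnW] oc; apply/open_subspaceP.
(* The largest subset of the complex with the given trace. In a cube of any dimension it is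
   described by the finitely many closed faces of dimension at most [n]. *)
exists [set x | skeleton n.+1 x -> W x]; last first.
  by apply/seteqP; split=> x [] /= h sk; split=> //; exact: h.
apply: spt_open => g T.
pose K i : set fn := if is_face n (\val T) i then face_set (\val T) i else set0.
have face_clique i : is_face n (\val T) i -> is_clique E i.1.
  by move=> /and3P[_ iT _]; exact: clique_sub iT (valP T).
pose L i : set fn := [set f | forall c : is_face n (\val T) i,
  W (spt (g * gp i.2) (Sub i.1 (face_clique i c)) f)].
have faceE i (c : is_face n (\val T) i) f : face_set (\val T) i f ->
    spt g T f = spt (g * gp i.2) (Sub i.1 (face_clique i c)) f.
  move=> fi; have /and3P[_ iT jT] := c.
  rewrite -(spt_clamp g) (@spt_face _ _ _ _ _ _ g T (Sub i.1 (face_clique i c)) i.2) //.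
  - rewrite -[RHS]spt_clamp; apply: spt_ext => s; rewrite SubK => si.
    by rewrite /tocube si (fintype.subsetP iT _ si).
  - move=> s si; have := fi s; rewrite si => cs.
    have := fintype.subsetP jT _ si; rewrite inE => /andP[_ sT].
    rewrite /tocube sT; apply/eqP; rewrite eq_le cs andbT.
    by case/andP: (clamp_itv (f s)).
  - move=> s; rewrite SubK => si; have := fi s.
    have : s \notin i.2 by move: si; rewrite !inE negb_or => /andP[/andP[]].
    move=> /negPf ->; rewrite si => cs; rewrite /tocube.
    have -> : s \in \val T by move: si; rewrite inE => /andP[].
    by apply/eqP; rewrite eq_le cs /=; case/andP: (clamp_itv (f s)).
rewrite (_ : _ @^-1` _ = [set f | forall i, K i f -> L i f]); last first.
  apply/seteqP; split=> f /= h.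
    move=> i; rewrite /K; case: ifP => // c0 fi c; rewrite -faceE //; apply: h.
    rewrite (faceE i c) //; case/and3P: (c) => ci _ _.
    by exists (g * gp i.2), (Sub i.1 (face_clique i c)), f.
  rewrite -(spt_clamp g T f) => /(skeletonP _ _ (tocubeP _ _)) lt.
  have cf := tocubeP (\val T) f; set f' := tocube (\val T) f in lt cf.
  pose i := (interior_dirs f', one_dirs f').
  have c : is_face n (\val T) i.
    rewrite /is_face /= -ltnS lt interior_dirs_sub //= finset.subsetD.
    by rewrite one_dirs_sub //=; exact: one_interior.
  have fi : face_set (\val T) i f.
    move=> s; case: ifP => [|_] /=.
      rewrite inE /f' /tocube; case: ifP => _ /eqP => [->//|/eqP].
      by rewrite eq_sym oner_eq0.
    case: ifP => //; rewrite !inE negb_or => /andP[/andP[ni n1] sT].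
    move: ni n1; rewrite /f' /tocube sT => ni n1; have /andP[f0 f1] := clamp_itv (f s).
    by rewrite leNgt; apply: contra ni => c0; rewrite c0 lt_neqAle n1 f1.
  rewrite spt_clamp (faceE i c f fi); apply: h.
  by rewrite /K c.
apply: open_forall_closed => i.
  by rewrite /K; case: ifP => _; [exact: face_set_closed|exact: closed0].
have [c|nc] := boolP (is_face n (\val T) i); last first.
  have -> : L i = setT by apply/seteqP; split=> // f _ c; rewrite c in nc.
  exact: openT.
pose T' : clique E := Sub i.1 (face_clique i c).
have -> : L i = spt (g * gp i.2) T' @^-1` W.
  apply/seteqP; split=> f /= h; first exact: h.
  by move=> c'; rewrite (bool_irrelevance c' c).
(* Faces of dimension [n] are controlled by the characteristic maps, smaller ones by [Vn]. *)
have /and3P[ci _ _] := c; rewrite leq_eqVlt in ci; case/orP: ci => ci.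
  pose c' : cell n := Sub T' ci.
  have -> : spt (g * gp i.2) T' @^-1` W = (fun f =>
      (to_coset (cell_stab c') (g * gp i.2), todisc i.1 n f)) @^-1` (@cell_char n c' @^-1` W).
    have e f : cell_char (to_coset (cell_stab c') (g * gp i.2), todisc i.1 n f) =
        spt (g * gp i.2) T' f.
      rewrite cell_charE -[RHS]spt_clamp; apply: spt_ext => s sT'.
      rewrite tofun_todisc //; last exact/eqP.
      by rewrite /tocube sT'.
    by apply/seteqP; split=> f; rewrite /preimage /= e.
  apply: open_comp (oc c') => f _; apply: pair_cont; first exact: const_cont.
  exact: todisc_cont.
have -> : spt (g * gp i.2) T' @^-1` W = spt (g * gp i.2) T' @^-1` Vn.
  have sk f : skeleton n (spt (g * gp i.2) T' f) by exists (g * gp i.2), T', f.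
  by apply/seteqP; split=> f /= /(eq_on_trace VnW (sk f)).
by apply: open_comp => // f _; exact: spt_cont.
Qed.

Definition salvetti_gcw : @gcw R A X act.
Proof.
refine (@GCW R A X act skeleton cell cell_stab cell_char _ _ act_cont _ _ _ _
  skeleton_colim cell_char_cont _ _ _ cell_char_inj _ skeleton_pushout).
- by move=> x; have [g [T [f [_ ->]]]] := spt_surj x; rewrite spt_act mul1g.
- by move=> g h x; have [k [T [f [_ ->]]]] := spt_surj x; rewrite !spt_act mulgA.
- by move=> n c; exact: cube_stab_closed.
- by apply/seteqP; split=> // x [g [T [f []]]].
- by move=> n x [g [T [f [lt ->]]]]; exists g, T, f; split=> //; exact: ltnW.
- apply/seteqP; split=> // x _; have [g [T [f [_ ->]]]] := spt_surj x.
  by exists #|\val T|.+1 => //; exists g, T, f.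
- by move=> n c g a d; rewrite !cell_charE spt_act.
- move=> n c [q d]; exists (repr (q : coset_quot (cell_stab c))), (\val c).
  by exists (tofun (\val (\val c)) d); rewrite cellP.
- move=> n c q d; have [g ->] := to_coset_surj q; rewrite cell_charE.
  by rewrite (skeletonP _ _ (tofun_cube d (cellP c))); exact/card_interior_tofun/cellP.
- move=> n _ [g [T [f [lt ->]]]] nsk.
  have Tn : #|\val T| == n.
    rewrite eqn_leq -ltnS lt /= leqNgt; apply/negP => lt'; apply: nsk.
    by exists g, T, f.
  exists (Sub T Tn), (to_coset _ g, todisc (\val T) n f).
  rewrite cell_charE -[RHS]spt_clamp SubK; apply: spt_ext => s sT.
  by rewrite tofun_todisc //; [rewrite /tocube sT|exact/eqP].
Defined.

Lemma salvetti_closed_cells : closed_cells salvetti_gcw = salvetti_cubes R E phi.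
Proof.
apply/funext => n; apply/seteqP; split=> K /=.
  move=> [c [q ->]]; have [g ->] := to_coset_surj q.
  exists g, (\val c); split; first exact: cellP.
  apply/seteqP; split=> x /=.
    move=> [d _ <-]; exists (SigSub (mem_set (tofun_cube d (cellP c))) : cube_space R (g, \val c)) => //.
    by rewrite spt_val /= -[LHS]cell_charE.
  move=> [y _ <-]; exists (todisc (\val (\val c)) n (\val y)) => //.
  rewrite spt_val -[LHS]/(cell_char _) cell_charE -[RHS]spt_clamp; apply: spt_ext => s sT.
  by rewrite tofun_todisc ?cellP // /tocube sT.
move=> [g [T [Tn ->]]]; have Tn' : #|\val T| == n by rewrite Tn.
pose c : cell n := Sub T Tn'.
exists c, (to_coset _ g); apply/seteqP; split=> x /=.
  move=> [y _ <-]; exists (todisc (\val T) n (\val y)) => //.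
  rewrite spt_val -[LHS]/(cell_char _) cell_charE -[RHS]spt_clamp; apply: spt_ext => s sT.
  by rewrite tofun_todisc // /tocube sT.
move=> [d _ <-]; exists (SigSub (mem_set (tofun_cube d Tn)) : cube_space R (g, T)) => //.
by rewrite spt_val -[RHS]/(@cell_char n c (to_coset _ g, d)) cell_charE.
Qed.

End Complex.

(** * The contraction *)

Section BigMin.
Variables (R : realType) (T : eqType).

Lemma bigmin1P (r : seq T) (F : T -> R) : let m := \big[Order.min/1%R]_(s <- r) F s in
  [/\ (m <= 1)%R, {in r, forall s, (m <= F s)%R} & m = 1%R \/ exists2 s, s \in r & m = F s].
Proof.
elim: r => [|s r [m1 mr mE]] /=; first by rewrite big_nil; split=> //; left.
rewrite big_cons; set m := \big[_/_]_(_ <- r) _ in m1 mr mE *; split.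
- by rewrite ge_min m1 orbT.
- move=> t; rewrite inE => /orP[/eqP->|/mr mt]; first by rewrite ge_min lexx.
  by rewrite ge_min mt orbT.
- have [le|lt] := leP (F s) m; first by right; exists s; rewrite ?inE ?eqxx.
  case: mE => [->|[t tr ->]]; first by left.
  by right; exists t; rewrite ?inE ?tr ?orbT.
Qed.

Lemma bigmin_cont (X : topologicalType) (r : seq T) (F : T -> X -> R) :
  (forall s, continuous (F s)) -> continuous (fun x => \big[Order.min/1%R]_(s <- r) F s x).
Proof.
move=> cF; elim: r => [|s r IH].
  by under eq_fun do rewrite big_nil; exact: const_cont.
by under eq_fun do rewrite big_cons; exact: min_cont.
Qed.

End BigMin.

(** The reverse of the last edge of a shortest word descends. *)
Lemma no_desc_len0 (S : finType) (E : rel S) (U A : groupType) (O : subgroup U)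
    (phi : U -> U) (bs : U -> A) (gn : S -> A) (E_sym : symmetric E) (E_irr : irreflexive E)
    (phiO : phi @` (O : set U) = (O : set U)) (HA : raag_spec E (O : set U) phi bs gn) (h : A) :
  (forall u a, inU bs u -> descends E_sym phiO HA (h * u) a -> False) -> len HA h = 0%N.
Proof.
move=> nd; have [w [u Uu eh] sw] := lenP HA h; rewrite -sw.
case/lastP: w eh sw => // w x eh sw; exfalso.
apply: (nd u^-1 (letter_inv x.2) (inUV HA Uu)).
have Ux : inU bs (bs x.1) by exists x.1.
rewrite eh mulgK wv_rcons desc_inv (desc_lt E_sym E_irr) -leqNgt.
have -> : len HA (wv bs gn w * bs x.1 * letter gn x.2) = size (rcons w x).
  by rewrite sw eh (len_inUr _ _ Uu) wv_rcons.
rewrite size_rcons; apply: leqW; rewrite (len_inUr _ _ Ux).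
exact: len_wv_le.
Qed.

Section Contraction.
Variables (R : realType) (S : finType) (E : rel S) (U : topologicalGroupType).
Variables (O : openSubgroup U) (phi : openMono O).
Hypothesis E_sym : symmetric E.
Hypothesis E_irr : irreflexive E.
Hypothesis phiO : phi @` (O : set U) = (O : set U).

Local Notation A := (raag E phi).
Local Notation bs := (raag_base E phi).
Local Notation gn := (raag_gen E phi).
Local Notation HA := (raag_specP E phi).
Local Notation inU := (inU bs).
Local Notation gp := (gp gn).
Local Notation same_cube := (same_cube bs gn).
Local Notation X := (salvetti R E phi).
Local Notation fn := ({ptws S -> R}).
Local Notation spt := (@spt R S E U O phi).
Local Notation act := (salvetti_act R E phi).
Local Notation desc := (descends E_sym phiO HA).
Local Notation tops := (tops E_sym phiO HA).
Local Notation top := (top_corner E_sym phiO HA).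
Local Notation full := (full E_sym phiO HA).
Local Notation len := (len HA).
Implicit Types (g h a : A) (f : fn) (T : clique E) (s t : S) (B C D : {set S}).

(* The coordinates of a cube measured from its corner closest to the vertex
   [U]; [B] is the set of directions leading away from that vertex. *)
Definition height B f s : R := if s \in B then f s else (1 - f s)%R.

Definition lower D B f (t : R) : fn :=
  fun s => if s \in D then (if s \in B then f s - t else f s + t)%R else f s.

(** Heights in a cube are at most 1, so the unit 1 does not affect the minimum over a non-empty
    [D]. *)
Definition min_height D B f : R := \big[Order.min/1%R]_(s <- enum D) height B f s.

Lemma height_itv D B f s : cube D f -> (0 <= height B f s <= 1)%R.
Proof. by move=> [/(_ s) h _]; rewrite /height; case: ifP => _ //; lra. Qed.

Lemma min_heightP D B f : cube D f -> [/\ (0 <= min_height D B f <= 1)%R,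
  {in D, forall s, (min_height D B f <= height B f s)%R} &
  D != finset.set0 -> exists2 s, s \in D & min_height D B f = height B f s].
Proof.
move=> cf; have [m1 mr mE] := bigmin1P (enum D) (height B f).
rewrite -/(min_height D B f) in m1 mr mE; split.
- rewrite m1 andbT; case: mE => [->|[s _ ->]]; first exact: ler01.
  by have /andP[] := height_itv B s cf.
- by move=> s sD; apply: mr; rewrite mem_enum.
- move=> /set0Pn [s sD]; case: mE => [e|[t tD ->]].
    exists s => //; apply/eqP; rewrite eq_le mr ?mem_enum // e.
    by have /andP[] := height_itv B s cf.
  by exists t; rewrite // -mem_enum.
Qed.

Lemma height_cont B s : continuous (fun f : fn => height B f s).
Proof.
rewrite /height; case: (s \in B); first exact: eval_cont.
by apply: add_cont; [exact: const_cont|exact/opp_cont/eval_cont].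
Qed.

Lemma min_height_cont D B : continuous (fun f : fn => min_height D B f).
Proof. by apply: bigmin_cont => s; exact: height_cont. Qed.

Lemma lower_cont (Y : topologicalType) D B (F : Y -> fn) (t : Y -> R) :
  continuous F -> continuous t -> continuous (fun y => lower D B (F y) (t y)).
Proof.
move=> cF ct; have cs s : continuous (fun y => F y s).
  exact: (@comp_cont _ fn R F (fun f => f s) cF (@eval_cont _ _ s)).
apply: ptws_cont => s; rewrite /lower; case: (s \in D) => //.
by case: (s \in B); apply: add_cont => //; exact: opp_cont.
Qed.

Lemma lower0 D B f : lower D B f 0%R = f.
Proof. by apply/funext => s; rewrite /lower subr0 addr0; case: (s \in D) => //; case: (s \in B). Qed.

(* A description of a point by the unique open cell of a cube [gQ_T]
   containing all edges that descend from its top corner, in the union of the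
   faces through this corner. *)
Definition toprep (p : X) g T f := [/\ cube (\val T) f, full g (\val T),
  {in \val T, forall s, (0 < height (tops g (\val T)) f s)%R} & p = spt g T f].

(** The cube is a face through the top corner of a full cube; in the new directions its points have
    the coordinates of that corner. *)
Lemma extend_full g T : exists g' T' (e : fn -> fn),
  [/\ full g' (\val T'), len (top g' (\val T')) = len (top g (\val T)), continuous e &
    forall f, cube (\val T) f -> cube (\val T') (e f) /\ spt g T f = spt g' T' (e f)].
Proof.
have [g' [D [cD fD TD h]]] := full_ex E_sym E_irr phiO HA g (valP T).
pose T' : clique E := Sub D cD; set B := tops g' D in h.
pose e f : fn := fun s => if s \in \val T then f s else if s \in B then 1%R else 0%R.
exists g', T', e; split.
- exact: fD.
- rewrite [\val T']SubK -(top_face E_sym E_irr phiO HA g' cD TD) -/B.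
  have := top_same_cube E_sym E_irr phiO HA h; set x := top _ _; set y := top _ _ => xy.
  by rewrite -(mulVKg x y) (len_inUr _ _ xy).
- apply: ptws_cont => s; rewrite /e; case: (s \in \val T); first exact: eval_cont.
  exact: const_cont.
- move=> f cf; split.
    split=> s; rewrite /e.
      case: ifP => _; first by case: cf.
      by case: ifP => _; rewrite ?lexx ?ler01.
    rewrite [\val T']SubK => sD; case: ifPn => [/(fintype.subsetP TD)|_].
      by rewrite (negPf sD).
    by case: ifPn => // /(fintype.subsetP (tops_sub _ _ _ _ _)); rewrite (negPf sD).
  rewrite (spt_glue _ h) (@spt_face _ _ _ _ _ _ g' T' T (B :\: \val T)) //.
  + by apply: spt_ext => s sT; rewrite /e sT.
  + by rewrite [\val T']SubK; apply: finset.setSD; exact: tops_sub.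
  + by move=> s; rewrite inE /e => /andP[/negPf-> ->].
  + move=> s; rewrite !(finset.in_setD, finset.in_setU) /e.
    by case: (s \in \val T) => //= /andP[/negPf ->].
Qed.

Lemma delete_clique T s : is_clique E (\val T :\ s).
Proof. by apply: clique_sub (valP T); exact: finset.subD1set. Qed.

Definition delete_dir T s : clique E := Sub (\val T :\ s) (delete_clique T s).

(** Height 0 in direction [s] means coordinate 0 if [s] is in [tops] and coordinate 1 otherwise;
    only in the latter case is the base corner moved. *)
Definition bottom_base g T s : A := g * gp ([set s]%SET :\: tops g (\val T)).

Lemma len_top_bottom g T s : s \in \val T ->
  (len (top (bottom_base g T s) (\val (delete_dir T s)))).+1 = len (top g (\val T)).
Proof. by move=> sT; exact: (len_top_face E_sym E_irr phiO HA g (valP T) sT). Qed.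

Lemma spt_bottom g T s f : s \in \val T -> height (tops g (\val T)) f s = 0%R ->
  spt g T f = spt (bottom_base g T s) (delete_dir T s) f.
Proof.
move=> sT hs; apply: spt_face.
- by rewrite SubK; exact: finset.subD1set.
- rewrite SubK; apply/fintype.subsetP => t; rewrite !inE => /andP[_ /eqP->].
  by rewrite eqxx sT.
- move=> t; rewrite finset.in_setD finset.in_set1 => /andP[/negPf st /eqP et].
  by move: hs; rewrite /height -et st => /eqP; rewrite subr_eq0 => /eqP.
- move=> t; rewrite SubK finset.in_setD finset.in_setU finset.in_setD1 finset.in_setD finset.in_set1.
  case: (eqVneq t s) => [->|_] /=; last by move=> /andP[/norP[/negP]].
  by rewrite andbT negbK => /andP[st _]; move: hs; rewrite /height st.
Qed.

(** Pass to a full cube; if a height vanishes, the point is in a bottom face, whose top corner is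
    closer to [U], and the procedure is repeated. *)
Lemma toprep_ex g T f : exists g' T' f',
  toprep (spt g T f) g' T' f' /\ (len (top g' (\val T')) <= len (top g (\val T)))%N.
Proof.
have [n ln] : exists n, len (top g (\val T)) = n by eexists.
elim/ltn_ind: n g T f ln => n IH g T f ln.
have [g' [T' [e [fT' lT' _ eP]]]] := extend_full g T.
rewrite -(spt_clamp g T f); have [cf ->] := eP _ (tocubeP (\val T) f).
set f' := e _ in cf *.
have [pos|] := pselect ({in \val T', forall s, (0 < height (tops g' (\val T')) f' s)%R}).
  exists g', T', f'; split; last by rewrite lT'.
  by split; [exact: cf|exact: fT'|exact: pos|].
move=> /existsNP [s /not_implyP [sT /negP]]; rewrite -leNgt => h0.
have hs : height (tops g' (\val T')) f' s = 0%R.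
  by apply/eqP; rewrite eq_le h0; case/andP: (height_itv (tops g' (\val T')) s cf).
have l1 := len_top_bottom g' sT.
rewrite (spt_bottom sT hs).
have l2 := eq_trans l1 lT'; rewrite -l2; rewrite -l2 in ln.
move: ln IH l2; set b := bottom_base g' T' s; set T1 := delete_dir T' s => ln IH l2.
have lt : (len (top b (\val T1)) < n)%N by rewrite -ln; exact: ltnSn.
have [g2 [T2 [f2 [t2 l3]]]] := IH _ lt b T1 f' erefl.
by exists g2, T2, f2; split; [exact: t2|exact: leqW].
Qed.

Lemma toprep_ones p g T f : toprep p g T f -> one_dirs f = tops g (\val T) :\: interior_dirs f.
Proof.
move=> [cf _ pos _]; apply/finset.setP => s; rewrite finset.in_setD.
have sub := fintype.subsetP (tops_sub E_sym phiO HA g (\val T)).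
case: (boolP (s \in \val T)) => sT; last first.
  rewrite (contraNF (sub s) sT) andbF inE (proj2 cf s sT).
  by apply/negbTE; rewrite eq_sym oner_eq0.
have := pos s sT; have := proj1 cf s; rewrite /height !inE sT /=.
move=> /andP[f0 f1]; case: ifP => _ h; rewrite ?andbT ?andbF.
  by rewrite h /= -leNgt eq_le f1.
by apply/negbTE; rewrite lt_eqF // -subr_gt0.
Qed.

(** As the heights are positive, the open cell of [p] is a face through the top corner; so [p]
    determines the top vertex, and [full_unique] applies. *)
Lemma toprep_unique p g T f g' T' f' : toprep p g T f -> toprep p g' T' f' ->
  [/\ T = T', tops g (\val T) = tops g' (\val T'), same_cube (\val T) g g' &
    {in \val T, f =1 f'}].
Proof.
move=> tr tr'; have o1 := toprep_ones tr; have o2 := toprep_ones tr'.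
case: tr tr' => [cf fT pos ->] [cf' fT' pos' e].
have [ei sc ep] := spt_carrier e cf cf'.
have e1 : top (g * gp (one_dirs f)) (interior_dirs f) = top g (\val T).
  by rewrite o1; exact: (top_face E_sym E_irr phiO HA g (valP T) (interior_dirs_sub cf)).
have e2 : top (g' * gp (one_dirs f')) (interior_dirs f) = top g' (\val T').
  by rewrite ei o2; exact: (top_face E_sym E_irr phiO HA g' (valP T') (interior_dirs_sub cf')).
have := top_same_cube E_sym E_irr phiO HA sc; rewrite e1 e2 => Ut.
have [eT et sc'] := full_unique E_irr (valP T) (valP T') fT fT' Ut.
have eTT : T = T' by exact: val_inj.
subst T'; clear e e1 e2 Ut sc eT; split; [by []|exact: et|exact: sc'|].
move=> s sT; have := congr1 (@^~ s) ep; rewrite /= /interior_part -ei.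
case: (boolP (s \in interior_dirs f)) => [_ e0|ni _]; first exact: e0.
have nsE (F : fn) : cube (\val T) F -> one_dirs F = tops g (\val T) :\: interior_dirs F ->
    s \notin interior_dirs F -> F s = (if s \in tops g (\val T) then 1 else 0)%R.
  move=> cF oF nF; have /andP[F0 F1] := proj1 cF s.
  have : (s \in one_dirs F) = (s \in tops g (\val T)) by rewrite oF finset.in_setD nF.
  move: nF; rewrite !inE negb_and -!leNgt => ns <-.
  case: eqP => [->|/eqP F1']; first by [].
  apply/eqP; rewrite eq_le F0 andbT.
  by case/orP: ns => F1''; [exact: F1''|move: F1'; rewrite eq_le F1 F1''].
rewrite (nsE f cf o1 ni) (nsE f') //; first by rewrite o2 -et.
by rewrite -ei.
Qed.

Lemma toprep_all p : exists r : A * clique E * fn, toprep p r.1.1 r.1.2 r.2.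
Proof.
have [g [T [f [_ ->]]]] := spt_surj p.
by have [g' [T' [f' [h _]]]] := toprep_ex g T f; exists (g', T', f').
Qed.

Definition rep p : A * clique E * fn := sval (cid (toprep_all p)).

Lemma repP p : toprep p (rep p).1.1 (rep p).1.2 (rep p).2.
Proof. by rewrite /rep; case: cid. Qed.

(** * The retractions and their composition *)

Definition level p : nat := len (top (rep p).1.1 (\val (rep p).1.2)).

Lemma levelE p g T f : toprep p g T f -> level p = len (top g (\val T)).
Proof.
move=> tr; have [eT et sc _] := toprep_unique tr (repP p).
rewrite /level -eT -[RHS](len_inUr HA _ (sc _ (tops_sub E_sym phiO HA g (\val T)))) mulVKg.
by rewrite et -eT.
Qed.

Lemma level_le g T f : (level (spt g T f) <= len (top g (\val T)))%N.
Proof. by have [g' [T' [f' [/levelE -> ]]]] := toprep_ex g T f. Qed.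

Definition sink D B f (t : R) : fn := lower D B f (Order.min t (min_height D B f)).

Lemma sink_cont (Y : topologicalType) D B (F : Y -> fn) (t : Y -> R) :
  continuous F -> continuous t -> continuous (fun y => sink D B (F y) (t y)).
Proof.
move=> cF ct; apply: lower_cont => //; apply: min_cont => //.
exact: (@comp_cont _ fn R F (min_height D B) cF (@min_height_cont D B)).
Qed.

(* The retraction of the balls of radius [n] onto those of radius [n - 1],
   stopped at the time [t]: the points of level [n] move away from the top
   corner of their cube along its diagonal. *)
Definition push (t : R) n p : X := let: (g, T, f) := rep p in
  if len (top g (\val T)) == n then spt g T (sink (\val T) (tops g (\val T)) f t) else p.

Lemma pushE (t : R) n p g T f : toprep p g T f -> push t n p =
  if len (top g (\val T)) == n then spt g T (sink (\val T) (tops g (\val T)) f t) else p.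
Proof.
move=> tr; have tr' := repP p; have := levelE tr; have := levelE tr'.
rewrite /push; case: (rep p) tr' => [[g' T'] f'] /= tr' <- <-; case: ifP => // _.
have [eT et sc ff] := toprep_unique tr tr'; clear tr tr'.
subst T'; rewrite -et (spt_glue _ sc); apply: spt_ext => s sT.
have em : min_height (\val T) (tops g (\val T)) f = min_height (\val T) (tops g (\val T)) f'.
  apply: eq_big_seq => r; rewrite mem_enum => rT.
  by rewrite /height (ff r rT).
by rewrite /sink /lower em (ff s sT).
Qed.

Lemma push_other (t : R) n p : level p != n -> push t n p = p.
Proof. by move=> lp; rewrite (pushE _ _ (repP p)) -/(level p) (negPf lp). Qed.

Lemma sink0 D B f (t : R) s : cube D f -> (0 <= t)%R -> s \in D -> height B f s = 0%R ->
  sink D B f t = f.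
Proof.
move=> cf t0 sD hs; have [/andP[m0 _] /(_ s sD) ms _] := min_heightP B cf.
have -> : sink D B f t = lower D B f 0%R; last exact: lower0.
rewrite /sink; congr lower; rewrite hs in ms.
have -> : min_height D B f = 0%R by apply/eqP; rewrite eq_le ms m0.
exact/min_idPr.
Qed.

Lemma positive_or_zero D B f : cube D f ->
  {in D, forall s, (0 < height B f s)%R} \/ exists2 s, s \in D & height B f s = 0%R.
Proof.
move=> cf; have [h|] := pselect {in D, forall s, (0 < height B f s)%R}; first by left.
move=> /existsNP [s /not_implyP [sD /negP]]; rewrite -leNgt => h0; right; exists s => //.
by apply/eqP; rewrite eq_le h0; case/andP: (height_itv B s cf).
Qed.

(** The formula holds on the closed cube too: on a bottom face [sink] is the identity as a height is
    0, and [push] is the identity as the level is smaller. *)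
Lemma push_full (t : R) n g T f : (0 <= t)%R -> full g (\val T) -> cube (\val T) f ->
  len (top g (\val T)) = n ->
  push t n (spt g T f) = spt g T (sink (\val T) (tops g (\val T)) f t).
Proof.
move=> t0 fT cf ln; have [pos|[s sT hs]] := positive_or_zero (tops g (\val T)) cf.
  have tr : toprep (spt g T f) g T f by split.
  by rewrite (pushE _ _ tr) ln eqxx.
rewrite (sink0 cf t0 sT hs); apply: push_other; rewrite (spt_bottom sT hs).
apply/negP => /eqP ll; have := level_le (bottom_base g T s) (delete_dir T s) f.
by rewrite ll -ln -(len_top_bottom g sT) ltnn.
Qed.

Lemma push0 n p : push 0%R n p = p.
Proof.
have tr := repP p; rewrite (pushE _ _ tr); case: ifP => // _.
case: tr => cf _ _ ep; rewrite [RHS]ep; congr spt.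
have [/andP[m0 _] _ _] := min_heightP (tops (rep p).1.1 (\val (rep p).1.2)) cf.
by rewrite /sink (min_idPl m0) lower0.
Qed.

Fixpoint retract n (p : X) (s : R) : X :=
  if n is n'.+1 then
    if (n'%:R <= s)%R then push (clamp (n%:R - s)) n p else retract n' (push 1%R n p) s
  else p.

Lemma retract_ge n p (s : R) : (n%:R <= s)%R -> retract n p s = p.
Proof.
case: n => //= n ns; rewrite ifT; last by apply: le_trans ns; rewrite ler_nat.
by rewrite clamp_le0 ?push0 // subr_le0.
Qed.

Lemma retractS n p (s : R) : (level p <= n)%N -> retract n.+1 p s = retract n p s.
Proof.
move=> lp; have lp' : level p != n.+1 by rewrite neq_ltn ltnS lp.
rewrite /= !push_other //; case: ifP => // ns.
by rewrite retract_ge.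
Qed.

Lemma retract_level n p (s : R) : (level p <= n)%N -> retract n p s = retract (level p) p s.
Proof.
elim: n => [|n IH]; first by rewrite leqn0 => /eqP ->.
by rewrite leq_eqVlt => /orP[/eqP ->//|lp]; rewrite retractS ?IH.
Qed.

Lemma full_nonempty g T : full g (\val T) -> (0 < len (top g (\val T)))%N ->
  \val T != finset.set0.
Proof.
move=> fT l0; apply/eqP => T0; move: l0; rewrite (@no_desc_len0 _ _ _ _ _ _ _ _ E_sym E_irr phiO) //.
by move=> u a Uu /(fT _ _ Uu); rewrite T0 inE.
Qed.

Lemma bottom_sink g T f (t : R) s : s \in \val T -> cube (\val T) f ->
  min_height (\val T) (tops g (\val T)) f = height (tops g (\val T)) f s -> (1 <= t)%R ->
  spt g T (sink (\val T) (tops g (\val T)) f t) =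
  spt (bottom_base g T s) (delete_dir T s) (sink (\val T) (tops g (\val T)) f t).
Proof.
move=> sT cf ms t1; apply: spt_bottom => //.
have [/andP[_ m1] _ _] := min_heightP (tops g (\val T)) cf.
rewrite /sink (min_idPr (le_trans m1 t1)) /lower {1}/height sT ms /height.
case: (s \in tops g (\val T)); first by rewrite subrr.
by rewrite addrCA subrr addr0 subrr.
Qed.

Lemma level_push n p : (level p <= n.+1)%N -> (level (push 1%R n.+1 p) <= n)%N.
Proof.
rewrite leq_eqVlt ltnS => /orP[/eqP lp|lp]; last first.
  by rewrite push_other // neq_ltn ltnS lp.
have [g [T [f tr]]] : exists g T f, toprep p g T f.
  by exists (rep p).1.1, (rep p).1.2, (rep p).2; exact: repP.
rewrite (levelE tr) in lp; case: tr => [cf fT _ ->].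
rewrite (push_full ler01 fT cf lp).
have Tn : \val T != finset.set0 by apply: (full_nonempty fT); rewrite lp.
have [_ _ /(_ Tn) [s sT ms]] := min_heightP (tops g (\val T)) cf.
rewrite (bottom_sink sT cf ms (lexx _)) -ltnS -lp -(len_top_bottom g sT) ltnS.
exact: level_le.
Qed.

(** By induction on the distance of the top corner: once stage [n.+1] is over, the point is on a
    bottom face, where the induction hypothesis applies. *)
Lemma retract_cont n g T : (len (top g (\val T)) <= n)%N ->
  continuous (fun fs : fn * R => retract n (spt g T fs.1) fs.2).
Proof.
elim: n g T => [|n IH] g T lT.
  by apply: (@comp_cont (fn * R)%type fn X (fun fs => fs.1) (spt g T)); [exact: fst_cont|exact: spt_cont].
move: lT; rewrite leq_eqVlt ltnS => /orP[/eqP lT|lT]; last first.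
  rewrite (_ : (fun _ => _) = (fun fs : fn * R => retract n (spt g T fs.1) fs.2)).
    exact: IH.
  by apply/funext => fs; apply: retractS; apply: leq_trans (level_le _ _ _) lT.
have [g' [T' [e [fT' lT' ec eP]]]] := extend_full g T; rewrite lT in lT'.
pose F (fs : fn * R) : fn := e (tocube (\val T) fs.1).
have cF : continuous F.
  apply: (@comp_cont _ fn _ (fun fs : fn * R => tocube (\val T) fs.1)) => //.
  by apply: (@comp_cont _ fn _ (fun fs : fn * R => fs.1)); [exact: fst_cont|exact: tocube_cont].
have cubeF fs : cube (\val T') (F fs) by exact: (proj1 (eP _ (tocubeP _ _))).
have FE fs : spt g T fs.1 = spt g' T' (F fs).
  by rewrite -spt_clamp (proj2 (eP _ (tocubeP _ _))).
have Tn : \val T' != finset.set0 by apply: full_nonempty fT' _; rewrite lT'.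
pose B := tops g' (\val T'); pose D := \val T'.
(* [None] is the time during which stage [n.+1] runs; [Some s] is the time after it, on the part of
   the cube where direction [s] has the least height and hence reaches 0. *)
pose K (i : option S) : set (fn * R) := if i is Some s then
    if s \in D then [set fs | (fs.2 <= n%:R)%R] `&` [set fs | min_height D B (F fs) = height B (F fs) s]
    else set0
  else [set fs | (n%:R <= fs.2)%R].
pose G (i : option S) (fs : fn * R) : X := if i is Some s then
    if s \in D then retract n (spt (bottom_base g' T' s) (delete_dir T' s) (sink D B (F fs) 1%R)) fs.2
    else spt g T fs.1
  else spt g' T' (sink D B (F fs) (clamp (n.+1%:R - fs.2)%R)).
have c2 : continuous (fun fs : fn * R => fs.2) by exact: snd_cont.
have cst (r : R) : continuous (fun fs : fn * R => r) by exact: const_cont.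
apply: (@closed_cover_cont _ _ (option S) K G).
- case=> [s|]; rewrite /K; last exact: closed_le_cont.
  case: (s \in D); last exact: closed0.
  apply: closedI; first exact: closed_le_cont.
  apply: closed_eq_cont.
    exact: (@comp_cont _ fn R F (min_height D B) cF (@min_height_cont D B)).
  exact: (@comp_cont _ fn R F (fun f => height B f s) cF (@height_cont B s)).
- move=> fs; have [le|/ltW le] := leP n%:R%R fs.2; first by exists None.
  have [_ _ /(_ Tn) [s sD ms]] := min_heightP B (cubeF fs).
  by exists (Some s); rewrite /K [s \in D]sD.
- case=> [s|]; rewrite /G; last first.
    apply: (@comp_cont _ fn X (fun fs => sink D B (F fs) (clamp (n.+1%:R - fs.2)%R)) (spt g' T')).
      apply: sink_cont => //; apply: clamp_cont; apply: add_cont => //; exact: opp_cont.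
    exact: spt_cont.
  case: (boolP (s \in D)) => sD; last first.
    by apply: (@comp_cont (fn * R)%type fn X (fun fs => fs.1) (spt g T)); [exact: fst_cont|exact: spt_cont].
  have lb : (len (top (bottom_base g' T' s) (\val (delete_dir T' s))) <= n)%N.
    by rewrite -ltnS (len_top_bottom _ sD) lT'.
  apply: (@comp_cont _ (fn * R)%type X (fun fs => (sink D B (F fs) 1%R, fs.2)) _ _ (IH _ _ lb)).
  by apply: pair_cont => //; exact: sink_cont.
- case=> [s|] fs; rewrite /K /G /=; last first.
    move=> ns; rewrite ns FE (push_full _ fT' (cubeF fs) lT') //.
    by case/andP: (clamp_itv (n.+1%:R - fs.2)%R).
  case: (boolP (s \in D)) => // sD [sn ms].
  rewrite -(bottom_sink sD (cubeF fs) ms (lexx _)) -(push_full ler01 fT' (cubeF fs) lT') -FE.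
  (* The pieces overlap at time [n], when stage [n.+1] is complete and the next has not begun. *)
  case: ifP => // ns; have -> : fs.2 = n%:R%R by apply/eqP; rewrite eq_le sn ns.
  rewrite retract_ge // clamp_ge1 //.
  by rewrite -addn1 natrD addrAC subrr add0r.
Qed.

Lemma clique0 : is_clique E finset.set0.
Proof. by apply/'forall_implyP => s; rewrite inE. Qed.

Definition base_vertex : X := spt 1 (Sub finset.set0 clique0) (fun=> 0%R).

Lemma retract0 n p : (level p <= n)%N -> retract n p 0%R = base_vertex.
Proof.
elim: n p => [|n IH] p lp.
  move: lp; rewrite leqn0 => /eqP lp; have [cf fT _ ep] := repP p.
  move: cf fT ep lp; rewrite /level; case: (rep p) => [[g T] f] /= cf fT ep lp.
  have T0 : \val T = finset.set0.
    apply/eqP/set0Pn => -[s sT].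
    by have := desc_len E_irr (desc_top E_sym E_irr phiO HA g (valP T) sT); rewrite lp.
  have eT : T = Sub finset.set0 clique0 by apply: val_inj; rewrite SubK.
  rewrite /= ep /base_vertex eT; rewrite T0 /top_corner tops0 gp0 mulg1 in lp.
  rewrite -(@spt_glue _ _ _ _ _ _ 1 g); first by apply: spt_ext => s; rewrite SubK inE.
  by rewrite SubK; apply/same_cube0; rewrite invg1 mul1g; exact: (len0 lp).
(* For [n = 0] the test succeeds at time 0, but stage 1 is then complete. *)
have -> : retract n.+1 p 0%R = retract n (push 1%R n.+1 p) 0%R.
  rewrite /=; case: ifP => //; case: n {IH lp} => [_|n]; last by rewrite lern0.
  by rewrite subr0 clamp_ge1.
by apply: IH; exact: level_push.
Qed.

Definition contraction (pt : X * R) : X :=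
  if (pt.2 <= 0)%R then pt.1 else retract (level pt.1) pt.1 ((1 - pt.2) / pt.2)%R.

Lemma contraction0 p : contraction (p, 0%R) = p.
Proof. by rewrite /contraction lexx. Qed.

Lemma contraction1 p : contraction (p, 1%R) = base_vertex.
Proof. by rewrite /contraction leNgt ltr01 /= subrr mul0r retract0. Qed.

Lemma contraction_cell_cont g T :
  continuous (fun ft : fn * R => contraction (spt g T ft.1, ft.2)).
Proof.
pose N := len (top g (\val T)).
(* Up to time [r] the cube is at rest, as [(1 - t) / t >= N] there. The maximum with [r] in [G]
   keeps the denominator away from 0. *)
pose r : R := (N.+1%:R^-1)%R.
have r0 : (0 < r)%R by rewrite invr_gt0 ltr0n.
pose K (b : bool) : set (fn * R) := if b then [set ft | (ft.2 <= r)%R] else [set ft | (r <= ft.2)%R].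
pose G (b : bool) (ft : fn * R) : X := if b then spt g T ft.1 else
  retract N (spt g T ft.1) ((1 - ft.2) / Order.max ft.2 r)%R.
have c2 : continuous (fun ft : fn * R => ft.2) by exact: snd_cont.
have cst (x : R) : continuous (fun ft : fn * R => x) by exact: const_cont.
have cE ft : (0 < ft.2)%R -> contraction (spt g T ft.1, ft.2) =
    retract N (spt g T ft.1) ((1 - ft.2) / ft.2)%R.
  move=> t0; rewrite /contraction ifF; last by rewrite leNgt t0.
  exact: esym (retract_level _ (level_le g T ft.1)).
apply: (@closed_cover_cont _ _ bool K G).
- by rewrite /K; case; apply: closed_le_cont.
- by move=> ft; have [le|/ltW le] := leP ft.2 r; [exists true|exists false].
- rewrite /G; case.
    by apply: (@comp_cont (fn * R)%type fn X (fun fs => fs.1) (spt g T)); [exact: fst_cont|exact: spt_cont].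
  change (continuous (fun ft : fn * R =>
    retract N (spt g T ft.1) ((1 - ft.2) / Order.max ft.2 r)%R)).
  apply: (@comp_cont (fn * R)%type (fn * R)%type X (fun ft => (ft.1, ((1 - ft.2) / Order.max ft.2 r)%R))
    (fun fs => retract N (spt g T fs.1) fs.2) _ (@retract_cont N g T (leqnn _))).
  apply: pair_cont; first exact: fst_cont.
  apply: mul_cont; first by apply: add_cont => //; exact: opp_cont.
  apply: inv_cont; last exact: (max_cont c2 (cst r)).
  by move=> ft; rewrite gt_eqF // lt_max r0 orbT.
- rewrite /K /G; case=> ft /=; last first.
    by move=> rt; rewrite cE ?(lt_le_trans r0 rt) // (max_idPl rt).
  move=> tr; have [t0|t0] := leP ft.2 0%R; first by rewrite /contraction t0.
  rewrite cE // retract_ge // ler_pdivlMr //.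
  have : (ft.2 * N.+1%:R <= 1)%R by rewrite -ler_pdivlMr ?ltr0n // div1r.
  by rewrite -natr1 mulrDr mulr1 lerBrDr mulrC.
Qed.

Lemma contraction_cont : continuous contraction.
Proof.
apply: (@quotient_prod_cont X X R (A * clique E)%type (fun=> fn) (fun i => spt i.1 i.2)).
- by move=> x; have [g [T [f [_ ->]]]] := spt_surj x; exists (g, T), f.
- by move=> W oW; apply: spt_open => g T; exact: (oW (g, T)).
- move=> x p W oW; have [g [T [f [_ ->]]]] := spt_surj x => Wp.
  have c : continuous (fun t : R => contraction (spt g T f, t)).
    apply: (@comp_cont R (fn * R)%type X (fun r => (f, r))
      (fun ft => contraction (spt g T ft.1, ft.2)) _ (@contraction_cell_cont g T)).
    by apply: pair_cont; [exact: const_cont|move=> t; exact: cvg_id].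
  have : nbhs p ((fun t : R => contraction (spt g T f, t)) @^-1` W).
    by apply: (c p); exact: open_nbhs_nbhs.
  move=> /nbhs_ballP [e /= e0 be].
  exists `[(p - e / 2)%R, (p + e / 2)%R]%classic; split.
  + exact: segment_compact.
  + apply/nbhs_ballP; exists (e / 2)%R => /=; first by rewrite divr_gt0.
    move=> t; rewrite /ball /= in_itv /= ltr_norml => /andP[h1 h2].
    by apply/andP; split; lra.
  + move=> t; rewrite /= in_itv /= => /andP[h1 h2]; apply: be.
    by rewrite /ball /= ltr_norml; apply/andP; split; lra.
- by move=> [g T]; exact: contraction_cell_cont.
Qed.

(** * Equivariance under the stabiliser of the base vertex *)

Lemma toprep_act u p g T f : inU u -> toprep p g T f -> toprep (act u p) (u * g) T f.
Proof.
move=> Uu [cf fT pos ->]; split=> //; last by rewrite spt_act.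
  exact: full_inUl.
by move=> s sT; rewrite tops_inUl //; exact: pos.
Qed.

Lemma level_act u p : inU u -> level (act u p) = level p.
Proof.
move=> Uu; rewrite (levelE (toprep_act Uu (repP p))) top_inUl // len_inUl //.
Qed.

Lemma push_act u (t : R) n p : inU u -> push t n (act u p) = act u (push t n p).
Proof.
move=> Uu; have tr := repP p; rewrite (pushE _ _ tr) (pushE _ _ (toprep_act Uu tr)).
rewrite top_inUl // len_inUl // tops_inUl //; case: ifP => // _.
by rewrite spt_act.
Qed.

Lemma retract_act u n p (s : R) : inU u -> retract n (act u p) s = act u (retract n p s).
Proof.
move=> Uu; elim: n p => //= n IH p; case: ifP => _; first exact: push_act.
by rewrite push_act // IH.
Qed.

Lemma contraction_act u p (t : R) : inU u ->
  contraction (act u p, t) = act u (contraction (p, t)).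
Proof.
move=> Uu; rewrite /contraction /=; case: ifP => // _.
by rewrite level_act // retract_act.
Qed.

End Contraction.

(** * Stabilisers and fixed points *)

Section Classifying.
Variables (R : realType) (S : finType) (E : rel S) (U : topologicalGroupType).
Variables (O : openSubgroup U) (phi : openMono O).
Hypothesis E_sym : symmetric E.
Hypothesis E_irr : irreflexive E.
Hypothesis phiO : phi @` (O : set U) = (O : set U).

Local Notation A := (raag E phi).
Local Notation bs := (raag_base E phi).
Local Notation gn := (raag_gen E phi).
Local Notation HA := (raag_specP E phi).
Local Notation inU := (inU bs).
Local Notation gp := (gp gn).
Local Notation X := (salvetti R E phi).
Local Notation act := (salvetti_act R E phi).
Local Notation fn := ({ptws S -> R}).
Local Notation spt := (@spt R S E U O phi).
Implicit Types (g h a : A) (f : fn) (T : clique E) (s t : S) (B C D : {set S}).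

(** Intersecting with [K i0] keeps the induction away from the empty intersection, which need not be
    in [F]. *)
Lemma family_bigcap (F : set (set A)) (I : finType) (P : pred I) (K : I -> set A) (i0 : I) :
  is_family F -> P i0 -> (forall i, P i -> F (K i)) -> F [set a | forall i, P i -> K i a].
Proof.
move=> famF Pi0 FK.
have -> : [set a | forall i, P i -> K i a] =
    [set a | forall i, i \in enum P -> K i a] `&` K i0.
  apply/seteqP; split=> a /=.
    by move=> h; split=> [i|]; [rewrite mem_enum; exact: h|exact: h].
  by move=> [h _] i Pi; apply: h; rewrite mem_enum.
have : {subset enum P <= P} by move=> i; rewrite mem_enum.
elim: (enum P) => [|i r IH] rP.
  rewrite (_ : mkset _ = setT) ?setTI; first exact: FK.
  by apply/seteqP; split.
rewrite (_ : _ `&` _ = K i `&` ([set a | forall i, i \in r -> K i a] `&` K i0)).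
  apply: family_setI => //; first by apply: FK; apply: rP; rewrite inE eqxx.
  by apply: IH => j jr; apply: rP; rewrite inE jr orbT.
apply/seteqP; split=> a /=.
  by move=> [h h0]; split; [|split=> // j jr]; apply: h; rewrite inE ?eqxx // jr orbT.
move=> [hi [h h0]]; split=> // j.
by rewrite inE => /orP[/eqP->|/h].
Qed.

Lemma conjs_inU g a : conjs g inU a <-> inU (g^-1 * a * g).
Proof.
split=> [[u Uu <-]|Ua]; first by rewrite !mulgA mulVg mul1g mulgVK.
by exists (g^-1 * a * g) => //; rewrite !mulgA mulgV mul1g mulgK.
Qed.

(** An element fixing all corners maps the cube to one with the same corners at the same
    coordinates, and such cubes are glued pointwise. *)
Lemma pointwise_stabiliser_cube g T :
  pointwise_stabiliser act [set salvetti_pt x | x in [set: cube_space R (g, T)]] =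
  [set a | forall C, C \subset \val T -> conjs (g * gp C) inU a].
Proof.
apply/seteqP; split=> a /=.
  move=> ha C CT; pose f : fn := fun s => if s \in C then 1%R else 0%R.
  have cf : cube (\val T) f.
    split=> s; rewrite /f; first by case: ifP; rewrite ?lexx ?ler01.
    by move=> sT; case: ifPn => // /(fintype.subsetP CT); rewrite (negPf sT).
  have : act a (spt g T f) = spt g T f.
    apply: ha; exists (SigSub (mem_set cf) : cube_space R (g, T)) => //.
    exact: spt_val.
  rewrite spt_act => e; have [_ sc _] := spt_carrier e cf cf.
  have := sc _ (finset.sub0set _); rewrite !gp0 !mulg1.
  have -> : one_dirs f = C.
    apply/finset.setP => s; rewrite inE /f; case: ifP => _; first by rewrite eqxx.
    by apply/negbTE; rewrite eq_sym oner_eq0.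
  move=> /(inUV HA); rewrite invgM invgK => Ua.
  by apply/conjs_inU; move: Ua; rewrite !mulgA.
move=> ha _ [x _ <-]; rewrite spt_val spt_act; apply: spt_glue => C CT.
have /conjs_inU Ua := ha C CT.
by move: (inUV HA Ua); rewrite !invgM !invgK !mulgA.
Qed.

Lemma stabiliser_in_family (F : set (set A)) n (K : set X) : is_family F -> F inU ->
  salvetti_cubes R E phi n K -> F (pointwise_stabiliser act K).
Proof.
move=> famF FU [g [T [_ ->]]]; rewrite pointwise_stabiliser_cube.
apply: (@family_bigcap F _ (fun C => C \subset \val T) (fun C => conjs (g * gp C) inU) finset.set0).
- by [].
- exact: finset.sub0set.
- by move=> C _; exact: family_conj.
Qed.

Lemma fixed_points_contractible (H : set A) g : H `<=` conjs g inU ->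
  weakly_contractible R (set_type (fixed_points act H)).
Proof.
move=> HU; pose h (pt : X * R) : X := act g (contraction E_sym E_irr phiO (act g^-1 pt.1, pt.2)).
have act1 x : act 1 x = x :> X.
  by have [k [T [f [_ ->]]]] := spt_surj x; rewrite spt_act mul1g.
have actM a b x : act (a * b) x = act a (act b x) :> X.
  by have [k [T [f [_ ->]]]] := spt_surj x; rewrite !spt_act mulgA.
have act_cont1 a : continuous (fun x : X => act a x).
  apply/continuousP => W oW; apply: spt_open => k T.
  rewrite (_ : _ @^-1` _ = spt (a * k) T @^-1` W).
    by apply: open_comp => // f _; exact: spt_cont.
  by apply/seteqP; split=> f; rewrite /preimage /= spt_act.
have h_cont : continuous h.
  apply: (@comp_cont (X * R)%type X X
    (fun pt => contraction E_sym E_irr phiO (act g^-1 pt.1, pt.2)) _ _ (act_cont1 g)).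
  apply: (@comp_cont (X * R)%type (X * R)%type X
    (fun pt => (act g^-1 pt.1, pt.2)) _ _ (@contraction_cont R S E U O phi E_sym E_irr phiO)).
  apply: pair_cont; last exact: snd_cont.
  by apply: (@comp_cont (X * R)%type X X (fun pt => pt.1) _ _ (act_cont1 _)); exact: fst_cont.
have h0 x : h (x, 0%R) = x by rewrite /h contraction0 -actM mulgV act1.
pose v : X := act g (base_vertex R E phi).
have h1 x : h (x, 1%R) = v by rewrite /h contraction1.
have contr_fix a x r : H a -> act a x = x -> act a (h (x, r)) = h (x, r).
  move=> Ha ax; have [u Uu au] := HU a Ha.
  have ux : act u (act g^-1 x) = act g^-1 x.
    by rewrite -actM -[in RHS]ax -actM -au !mulgA mulVg mul1g.
  rewrite /h /= -au -actM mulgVK actM.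
  by rewrite -[act u (contraction _ _ _ _)](contraction_act E_sym E_irr phiO) // ux.
have h_fix x r : fixed_points act H x -> fixed_points act H (h (x, r)).
  by move=> fx a Ha; apply: contr_fix => //; exact: fx.
have v_fix : fixed_points act H v.
  move=> a Ha; have [u Uu au] := HU a Ha.
  rewrite /v -au -actM mulgVK actM -[in LHS](contraction1 E_sym E_irr phiO (base_vertex R E phi)).
  by rewrite -(contraction_act E_sym E_irr phiO) // contraction1.
pose Y := set_type (fixed_points act H).
pose hh (pt : Y * R) : Y :=
  SigSub (mem_set (h_fix (\val pt.1) pt.2 (set_mem (valP pt.1)))).
apply: (@contractible_weakly R Y (SigSub (mem_set v_fix)) hh).
- apply: into_set_type_cont.
  apply: (@comp_cont (Y * R)%type (X * R)%type X (fun pt => (\val pt.1, pt.2)) h) => //.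
  apply: pair_cont; last exact: snd_cont.
  by apply: (@comp_cont (Y * R)%type Y X (fun pt => pt.1) _ _ (@val_cont _ _)); exact: fst_cont.
- by move=> y; apply: val_inj; exact: h0.
- by move=> y; apply: val_inj; exact: h1.
Qed.

End Classifying.

Theorem theorem5 (R : realType) (S : finType) (E : rel S)
    (E_sym : symmetric E) (E_irr : irreflexive E) (S_nonempty : (0 < #|S|)%N)
    (U : topologicalGroupType) (U_hausdorff : hausdorff_space U)
    (U_lc : locally_compact [set: U])
    (O : openSubgroup U) (phi : openMono O)
    (phiO : phi @` (O : set U) = (O : set U))
    (O_index : finite_index [set: U] (O : set U))
    (F : set (set (raag E phi))) (F_family : is_family F)
    (F_U : F (range (raag_base E phi)))
    (F_index : forall H, F H -> exists g : raag E phi,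
      finite_index H (H `&` conjs g (range (raag_base E phi)))) :
  is_classifying_complex R (salvetti_act R E phi) (salvetti_cubes R E phi) F.
Proof.
have /card_gt0P[s0 _] := S_nonempty.
exists (salvetti_gcw R E phi s0 U_lc); split.
- exact: salvetti_closed_cells.
- by move=> n K; exact: stabiliser_in_family.
move=> H FH; have [K _ HK] := family_closed_subgroup F_family FH.
have [g Hg] := F_index H FH; rewrite HK in Hg *.
have [x Kx] := fixed_vertex E_sym E_irr phiO (raag_specP E phi) Hg.
exact: (fixed_points_contractible R E_sym E_irr phiO Kx).
Qed.
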